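(* Let $\lambda\neq0$, $k_1$ and $k_2\neq0$ be constants, let $S=\dfrac{u_{3x}}{u_x}-\dfrac32\dfrac{u_{xx}^2}{u_x^2}$, and consider the fully-nonlinear third-order evolution equation $$u_t=\lambda\frac{u_x}{\sqrt S}. $$ Let $$R[u]=G_2D_x^2+G_1D_x+G_0+\lambda\frac{u_x}{\sqrt S}\,D_x^{-1}\circ\Lambda,$$ where $$G_0=\frac{k_2}{4}\Big(\frac{S_{xx}}{S^2}+\frac{u_{xx}}{u_x}\frac{S_x}{S^2}-\frac32\frac{S_x^2}{S^3}-\frac{u_{xx}^2}{u_x^2}\frac1S\Big)+k_1+k_2,$$ $$G_1=k_2\Big(\frac{u_{xx}}{u_x}\frac1S-\frac14\frac{S_x}{S^2}\Big),\qquad G_2=-\frac{k_2}{2S},$$ $$\Lambda=-\frac{k_2}{4\lambda u_x}\Big(\frac{S_{3x}}{S^{3/2}}-\frac92\frac{S_xS_{xx}}{S^{5/2}}+\frac{15}{4}\frac{S_x^3}{S^{7/2}}\Big).$$ Then $R[u]$ is a recursion operator of this equation, and the equation provides the symmetry-integrable hierarchy $$u_{t_j}=R^j[u]\,u_t,\qquad j=1,2,\dots$$ (where $u_t$ on the right-hand side stands for $\lambda u_x/\sqrt S$). Every member of this hierarchy is of the form $$u_{t_j}=u_x\Psi_j(S,S_x,S_{xx},\dots,S_{nx})$$ for some function $\Psi_j$ and some $n$ depending on $j$.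
   Context: Here $u=u(x,t)$, subscripts denote derivatives, $u_{px}=\partial^pu/\partial x^p$; $S$ is the Schwarzian derivative of $u$ with respect to $x$, and one works where $u_x\neq0$ and $S>0$. $D_x$ is the total $x$-derivative and $D_x^{-1}$ its formal inverse (integration constants taken to be zero). For an evolution equation $E:=u_t-\Phi(x,t,u,u_x,\dots,u_{qx})=0$, a Lie–Bäcklund symmetry of order $n$ is a generator $Z=Q\,\partial_u$ with characteristic $Q=Q(x,t,u,u_x,\dots,u_{nx})$, $\partial Q/\partial u_{nx}\neq0$, satisfying $L_E[u]Q\big|_{E=0}=0$, where $L_E[u]=\frac{\partial E}{\partial u}+\frac{\partial E}{\partial u_t}D_t+\frac{\partial E}{\partial u_x}D_x+\dots+\frac{\partial E}{\partial u_{qx}}D_x^q$. A recursion operator is a (formal integro-differential) operator mapping characteristics of symmetries to characteristics of symmetries, i.e. satisfying $[L_E[u],R[u]]=0$ on solutions. An equation is called symmetry-integrable if it admits higher-order Lie–Bäcklund symmetries and a recursion operator that generates these symmetries. A symmetry-integrable hierarchy is a sequence of such equations obtained by repeatedly applying a recursion operator. An evolution equation is fully-nonlinear if it is nonlinear in its highest $x$-derivative. *)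

(* Defs.v *)
From Stdlib Require Import Reals ZArith List.
From Coquelicot Require Import Coquelicot.
Open Scope R_scope.

(* Coordinates x, t and u_{kx} = U k (so U 0 is u itself). *)
Inductive jvar : Type := X | T | U (k : nat).

Definition jvar_eq_dec (v w : jvar) : {v = w} + {v <> w}.
Proof. decide equality; apply Nat.eq_dec. Defined.

Definition jet : Type := jvar -> R.

(* Functions on the jet space are total; only their values on [dom] matter. *)
Definition jfun : Type := jet -> R.

Definition upd (p : jet) (v : jvar) (s : R) : jet :=
  fun w => if jvar_eq_dec v w then s else p w.

Definition ex_pd (v : jvar) (F : jfun) (p : jet) : Prop :=
  ex_derive (fun s => F (upd p v s)) (p v).

Definition pd (v : jvar) (F : jfun) : jfun :=
  fun p => Derive (fun s => F (upd p v s)) (p v).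

Definition u (k : nat) : jfun := fun p => p (U k).

Definition Schw : jfun := fun p =>
  u 3 p / u 1 p - 3 / 2 * (u 2 p ^ 2 / u 1 p ^ 2).

Definition dom (p : jet) : Prop := u 1 p <> 0 /\ 0 < Schw p.

Definition eq_dom (F G : jfun) : Prop := forall p, dom p -> F p = G p.

Definition depends_upto (n : nat) (F : jfun) : Prop :=
  forall p q : jet, dom p -> dom q ->
    p X = q X -> p T = q T -> (forall k, (k <= n)%nat -> p (U k) = q (U k)) ->
    F p = F q.

(* C^infinity on [dom].  [fct_UniformSpace] carries the sup-distance; on functions
   of finitely many coordinates this is the usual joint continuity. *)
Definition smooth (F : jfun) : Prop :=
  forall (l : list jvar) (p : jet), dom p ->
    @continuous (fct_UniformSpace jvar R_UniformSpace) R_UniformSpace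
      (fold_right pd F l) p
    /\ forall v, ex_pd v (fold_right pd F l) p.

Definition has_order (n : nat) (F : jfun) : Prop :=
  depends_upto n F /\ exists p, dom p /\ pd (U n) F p <> 0.

Definition diff_fun (F : jfun) : Prop :=
  smooth F /\ exists n, depends_upto n F.

(* The series below have finitely many nonzero terms when the function being
   differentiated is a differential function. *)
Definition Dx (F : jfun) : jfun := fun p =>
  pd X F p + Series (fun k => u (k + 1) p * pd (U k) F p).

Definition Dxn (n : nat) (F : jfun) : jfun := Nat.iter n Dx F.

(* Total t-derivative on the solutions of u_t = Phi. *)
Definition Dt (Phi F : jfun) : jfun := fun p =>
  pd T F p + Series (fun k => Dxn k Phi p * pd (U k) F p).

Definition evolution_equation (q : nat) (Phi : jfun) : Prop :=
  smooth Phi /\ has_order q Phi.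

Definition fully_nonlinear (q : nat) (Phi : jfun) : Prop :=
  (0 < q)%nat /\ evolution_equation q Phi /\
  ~ exists A B : jfun, depends_upto (q - 1) A /\ depends_upto (q - 1) B /\
      eq_dom Phi (fun p => A p * u q p + B p).

(* L_E Q restricted to E = 0, for E = u_t - Phi. *)
Definition L_E (Phi Q : jfun) : jfun := fun p =>
  Dt Phi Q p - Series (fun k => pd (U k) Phi p * Dxn k Q p).

Definition characteristic (Phi Q : jfun) : Prop :=
  diff_fun Q /\ eq_dom (L_E Phi Q) (fun _ => 0).

Definition LB_symmetry (n : nat) (Phi Q : jfun) : Prop :=
  characteristic Phi Q /\ has_order n Q.

(* The formal series sum_{m >= 0} (pcf m) D_x^(pdeg - m). *)
Record psdo : Type := Psdo { pdeg : Z ; pcf : nat -> jfun }.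

Definition coef (A : psdo) (n : Z) : jfun :=
  if (n <=? pdeg A)%Z then pcf A (Z.to_nat (pdeg A - n)) else fun _ => 0.

(* a (a - 1) ... (a - k + 1) / k! *)
Fixpoint gbinom (a : Z) (k : nat) : R :=
  match k with
  | O => 1
  | S k' => gbinom a k' * (IZR a - INR k') / INR k
  end.

Definition padd (A B : psdo) : psdo :=
  let d := Z.max (pdeg A) (pdeg B) in
  Psdo d (fun m p => coef A (d - Z.of_nat m) p + coef B (d - Z.of_nat m) p).

Definition popp (A : psdo) : psdo := Psdo (pdeg A) (fun m p => - pcf A m p).

Definition psub (A B : psdo) : psdo := padd A (popp B).

(* Generalised Leibniz rule:
   D_x^a o b = sum_{k >= 0} gbinom a k * D_x^k(b) * D_x^(a - k)  for a in Z. *)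
Definition pmul (A B : psdo) : psdo :=
  Psdo (pdeg A + pdeg B) (fun m p =>
    sum_f_R0 (fun i =>
      sum_f_R0 (fun k =>
        gbinom (pdeg A - Z.of_nat i) k * pcf A i p * Dxn k (pcf B (m - i - k)) p)
      (m - i)) m).

Definition pDinv : psdo := Psdo (-1) (fun m _ => if Nat.eqb m 0 then 1 else 0).

(* sum_{i <= n} (a i) D_x^i *)
Definition pdiffop (n : nat) (a : nat -> jfun) : psdo :=
  Psdo (Z.of_nat n) (fun m => if Nat.leb m n then a (n - m)%nat else fun _ => 0).

Definition pfun (a : jfun) : psdo := pdiffop 0 (fun _ => a).

(* [L_E, A] on solutions, with L_E = D_t - sum_{k <= q} (dPhi/du_{kx}) D_x^k.
   Since D_t and D_x commute, [D_t, a D_x^n] = D_t(a) D_x^n. *)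
Definition L_E_commutator (q : nat) (Phi : jfun) (A : psdo) : psdo :=
  let F := pdiffop q (fun k => pd (U k) Phi) in
  psub (Psdo (pdeg A) (fun m => Dt Phi (pcf A m)))
       (psub (pmul F A) (pmul A F)).

(* sum_{i <= iod_order} (iod_loc i) D_x^i + iod_left D_x^{-1} o iod_right *)
Record intdiffop : Type := Intdiffop
  { iod_order : nat ; iod_loc : nat -> jfun ; iod_left : jfun ; iod_right : jfun }.

Definition psdo_of (A : intdiffop) : psdo :=
  padd (pdiffop (iod_order A) (iod_loc A))
       (pmul (pfun (iod_left A)) (pmul pDinv (pfun (iod_right A)))).

(* P = D_x^{-1} F.  A primitive is determined only up to a function of t (and of the
   sign of u_x).  Taking the integration constant to be zero means that P has no term
   free of x-derivatives of S: it vanishes at the jets with S_x = S_xx = ... = 0. *)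
Definition Dx_inv (F P : jfun) : Prop :=
  diff_fun P /\ eq_dom (Dx P) F /\
  forall p, dom p -> (forall k, (1 <= k)%nat -> Dxn k Schw p = 0) -> P p = 0.

(* Q' = A Q; a relation, since D_x^{-1} is only partially defined. *)
Definition maps_to (A : intdiffop) (Q Q' : jfun) : Prop :=
  exists P, Dx_inv (fun p => iod_right A p * Q p) P /\
    eq_dom Q' (fun p =>
      sum_f_R0 (fun i => iod_loc A i p * Dxn i Q p) (iod_order A)
      + iod_left A p * P p).

Definition recursion_operator (q : nat) (Phi : jfun) (A : intdiffop) : Prop :=
  evolution_equation q Phi /\
  (forall n : Z, eq_dom (coef (L_E_commutator q Phi (psdo_of A)) n) (fun _ => 0)) /\
  (forall Q Q', characteristic Phi Q -> maps_to A Q Q' -> diff_fun Q' ->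
     characteristic Phi Q').

Definition symmetry_integrable (q : nat) (Phi : jfun) (A : intdiffop) : Prop :=
  recursion_operator q Phi A /\
  exists Z : nat -> jfun,
    (forall i, characteristic Phi (Z i)) /\
    (forall i, maps_to A (Z i) (Z (i + 1)%nat)) /\
    (forall N, exists i n, (N < n)%nat /\ LB_symmetry n Phi (Z i)).

(* Q j = A^j Phi *)
Definition hierarchy (A : intdiffop) (Phi : jfun) (Q : nat -> jfun) : Prop :=
  eq_dom (Q 0%nat) Phi /\ forall j, maps_to A (Q j) (Q (j + 1)%nat).

Definition Sx (k : nat) : jfun := Dxn k Schw.

Definition Phi_S (lambda : R) : jfun := fun p => lambda * (u 1 p / sqrt (Schw p)).

Definition G0 (k1 k2 : R) : jfun := fun p =>
  k2 / 4 * (Sx 2 p / Schw p ^ 2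
            + u 2 p / u 1 p * (Sx 1 p / Schw p ^ 2)
            - 3 / 2 * (Sx 1 p ^ 2 / Schw p ^ 3)
            - u 2 p ^ 2 / u 1 p ^ 2 * (1 / Schw p))
  + k1 + k2.

Definition G1 (k2 : R) : jfun := fun p =>
  k2 * (u 2 p / u 1 p * (1 / Schw p) - 1 / 4 * (Sx 1 p / Schw p ^ 2)).

Definition G2 (k2 : R) : jfun := fun p => - (k2 / (2 * Schw p)).

Definition Lambda (lambda k2 : R) : jfun := fun p =>
  - (k2 / (4 * lambda * u 1 p))
  * (Sx 3 p / Rpower (Schw p) (3 / 2)
     - 9 / 2 * (Sx 1 p * Sx 2 p / Rpower (Schw p) (5 / 2))
     + 15 / 4 * (Sx 1 p ^ 3 / Rpower (Schw p) (7 / 2))).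

Definition R_S (lambda k1 k2 : R) : intdiffop :=
  Intdiffop 2
    (fun i => match i with O => G0 k1 k2 | 1%nat => G1 k2 | _ => G2 k2 end)
    (Phi_S lambda) (Lambda lambda k2).

(* Main.v *)
(* Write D = D_x, s = S^(-1/2), P1 = D^3 [ham1],
   P2 = 2 S D + S_x [ham2] and theta = P1 + P2.  The
   evolution u_t = u_x psi moves S by theta psi, and Lambda = k2/(2 lambda u_x) s_xxx, so that
   R = u_x (k1 + k2/2 - k2 P2^(-1) P1) u_x^(-1).

   Locality.  The power series chi(z) with chi(0) = s and
   S chi^2 - z (chi chi_xx - chi_x^2/2) = 1 has coefficients that are polynomials in
   S^(1/2), s, s_x, ...; differentiating the relation gives P2 chi_(n+1) = P1 chi_n.  Hence
   R^j(lambda u_x s) is u_x times a linear combination of chi_0, ..., chi_j.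

   Symmetry.  Linearising chi(z) over dual numbers in the direction dS = (P2 - z P1) f gives
   chi_x f - chi f_x, by uniqueness for the linearised relation.  It follows that for every
   flow of the hierarchy, with T the linearised flow conjugated by u_x, P2 g = P1 f implies
   P2 T g = P1 T f.  This is the commutation of R with the linearised flow.  It is used twice:
   over the ring of differential functions, for the action on characteristics, and over its
   square-zero extension by the module of formal pseudodifferential operators, for the
   commutator; there D is injective.

   Integration constants.  A differential function killed by D depends on no u_k with k > 3, and
   every jet agrees up to u_3 with one at which all S_kx, k >= 1, vanish.  At such a jet the flow
   is a multiple of the translation in x and all operators have constant coefficients modulo
   functions that vanish there, so the constant produced by D^(-1) is zero. *)
From Stdlib Require Import Reals ZArith List Lia Lra.
From Stdlib Require Import FunctionalExtensionality ProofIrrelevance ClassicalEpsilon.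
From Coquelicot Require Import Coquelicot.
Require Import Defs.
Open Scope R_scope.

(** * Smooth functions on the jet space *)

(** Origin of [chi]: products of two solutions of z y_xx = (S/2) y satisfy z f_xxx = 2 S f_x + S_x
    f, and the relation defining [chi] is the Wronskian integral of that equation, expanded at z =
    0. For a vector field f on the x-line, (P2 - z P1) f is the projective coadjoint action on S,
    and [chi] moves under it as a vector field does, whence the bracket chi_x f - chi f_x. In the
    same way u_t = u_x psi is an infinitesimal change of x.

    The obstacle is D_x^(-1). It is not defined on all differential functions, and expanding the
    commutator coefficient by coefficient cannot be done uniformly along the hierarchy. The relation
    P2 g = P1 f therefore replaces g = P2^(-1) P1 f, so that the algebra contains no inverse; only
    at the end is P2 = 2 r D r, with r = S^(1/2), inverted by one cancellation of D. The identities
    are stated for an arbitrary commutative differential ring containing 1/2, because they are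
    needed over functions, over power series, over dual numbers, and with operators adjoined as a
    square-zero ideal. *)

Definition jet_space : UniformSpace := fct_UniformSpace jvar R_UniformSpace.

Definition cont_at (F : jfun) (p : jet) : Prop :=
  @continuous jet_space R_UniformSpace F p.

Lemma upd_id (p : jet) v : upd p v (p v) = p.
Proof.
  apply functional_extensionality; intro w; unfold upd.
  destruct (jvar_eq_dec v w) as [<-|]; reflexivity.
Qed.

Lemma upd_same (p : jet) v s : upd p v s v = s.
Proof. unfold upd; destruct (jvar_eq_dec v v); congruence. Qed.

Lemma upd_other (p : jet) v w s : v <> w -> upd p v s w = p w.
Proof. intro H; unfold upd; destruct (jvar_eq_dec v w); congruence. Qed.

Lemma upd_upd (p : jet) v a b : upd (upd p v a) v b = upd p v b.
Proof.
  apply functional_extensionality; intro w; unfold upd.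
  destruct (jvar_eq_dec v w); reflexivity.
Qed.

Lemma upd_swap (p : jet) v w a b :
  v <> w -> upd (upd p v a) w b = upd (upd p w b) v a.
Proof.
  intro H; apply functional_extensionality; intro z; unfold upd.
  destruct (jvar_eq_dec v z); destruct (jvar_eq_dec w z); congruence.
Qed.

Lemma cont_const c p : cont_at (fun _ => c) p.
Proof. apply continuous_const. Qed.

Lemma cont_coord v p : cont_at (fun q => q v) p.
Proof.
  intros P [e He]; exists e; intros q Hq; apply He, Hq.
Qed.

Lemma cont_plus F G p : cont_at F p -> cont_at G p -> cont_at (fun q => F q + G q) p.
Proof. exact (@continuous_plus jet_space _ R_NormedModule F G p). Qed.

Lemma cont_mult F G p : cont_at F p -> cont_at G p -> cont_at (fun q => F q * G q) p.
Proof. exact (@continuous_mult jet_space R_AbsRing F G p). Qed.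

Lemma cont_inv F p : cont_at F p -> F p <> 0 -> cont_at (fun q => / F q) p.
Proof.
  intros H H0. apply (@continuous_comp jet_space R_UniformSpace R_UniformSpace F Rinv p H).
  apply continuous_Rinv, H0.
Qed.

Lemma cont_sqrt F p : cont_at F p -> cont_at (fun q => sqrt (F q)) p.
Proof.
  intros H. apply (@continuous_comp jet_space R_UniformSpace R_UniformSpace F sqrt p H).
  apply continuous_sqrt.
Qed.

Lemma cont_schw p : u 1 p <> 0 -> cont_at Schw p.
Proof.
  intro H.
  assert (E : Schw = fun q => q (U 3) * / q (U 1)
    + (- (3 / 2)) * ((q (U 2) * q (U 2)) * / (q (U 1) * q (U 1)))).
  { apply functional_extensionality; intro q; unfold Schw, u, Rdiv.
    replace (q (U 2) ^ 2) with (q (U 2) * q (U 2)) by ring.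
    replace (q (U 1) ^ 2) with (q (U 1) * q (U 1)) by ring. ring. }
  unfold u in H; rewrite E.
  apply cont_plus; apply cont_mult.
  - apply cont_coord.
  - apply cont_inv; [apply cont_coord | exact H].
  - apply cont_const.
  - apply cont_mult; [apply cont_mult; apply cont_coord |].
    apply cont_inv; [apply cont_mult; apply cont_coord |].
    apply Rmult_integral_contrapositive_currified; exact H.
Qed.

Lemma dom_open p : dom p -> @locally jet_space p dom.
Proof.
  intros [H1 H2]; unfold dom; apply filter_and.
  - exact (cont_coord (U 1) p _ (open_neq 0 _ H1)).
  - exact (cont_schw p H1 _ (open_gt 0 _ H2)).
Qed.

Lemma locally_coord (P : jet -> Prop) p v :
  @locally jet_space p P -> locally (p v) (fun s => P (upd p v s)).
Proof.
  intros [e He]; exists e; intros s Hs; apply He; intro w.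
  destruct (jvar_eq_dec v w) as [<-|n].
  - rewrite upd_same; exact Hs.
  - rewrite upd_other by exact n; apply ball_center.
Qed.

Lemma dom_coord p v : dom p -> locally (p v) (fun s => dom (upd p v s)).
Proof. intro H; apply locally_coord, dom_open, H. Qed.

Lemma pd_ext F G v p : eq_dom F G -> dom p -> pd v F p = pd v G p.
Proof.
  intros E H; apply Derive_ext_loc.
  generalize (dom_coord p v H); apply filter_imp; intros s Hs; apply E, Hs.
Qed.

Lemma ex_pd_ext F G v p : eq_dom F G -> dom p -> ex_pd v F p -> ex_pd v G p.
Proof.
  intros E H; apply ex_derive_ext_loc.
  generalize (dom_coord p v H); apply filter_imp; intros s Hs; apply E, Hs.
Qed.

Lemma cont_ext F G p : eq_dom F G -> dom p -> cont_at F p -> cont_at G p.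
Proof.
  intros E H; apply continuous_ext_loc.
  generalize (dom_open p H); apply filter_imp; intros q Hq; apply E, Hq.
Qed.

Lemma pd_const c v p : pd v (fun _ => c) p = 0.
Proof. unfold pd; apply Derive_const. Qed.

Lemma pd_plus F G v p : ex_pd v F p -> ex_pd v G p ->
  pd v (fun q => F q + G q) p = pd v F p + pd v G p.
Proof. exact (Derive_plus _ _ _). Qed.

Lemma pd_mult F G v p : ex_pd v F p -> ex_pd v G p ->
  pd v (fun q => F q * G q) p = pd v F p * G p + F p * pd v G p.
Proof.
  intros HF HG; unfold pd; rewrite Derive_mult by assumption.
  rewrite !upd_id; reflexivity.
Qed.

Lemma pd_inv F v p : ex_pd v F p -> F p <> 0 ->
  pd v (fun q => / F q) p = - 1 * (pd v F p * (/ F p * / F p)).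
Proof.
  intros HF H0; unfold pd; rewrite Derive_inv; rewrite ?upd_id; try assumption.
  field; exact H0.
Qed.

Lemma pd_sqrt F v p : ex_pd v F p -> 0 < F p ->
  pd v (fun q => sqrt (F q)) p = / 2 * (pd v F p * / sqrt (F p)).
Proof.
  intros HF H0; unfold pd.
  assert (E : 0 < F (upd p v (p v))) by (rewrite upd_id; exact H0).
  etransitivity; [exact (is_derive_unique _ _ _ (is_derive_sqrt _ _ _ (Derive_correct _ _ HF) E))|].
  change (pd v F p / (2 * sqrt (F (upd p v (p v)))) = / 2 * (pd v F p * / sqrt (F p))).
  rewrite upd_id.
  field; apply Rgt_not_eq, sqrt_lt_R0, H0.
Qed.

Lemma pd_coord v w p : pd v (fun q => q w) p = if jvar_eq_dec v w then 1 else 0.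
Proof.
  unfold pd, upd; destruct (jvar_eq_dec v w).
  - apply Derive_id.
  - apply Derive_const.
Qed.

Lemma ex_pd_const c v p : ex_pd v (fun _ => c) p.
Proof. unfold ex_pd; apply ex_derive_const. Qed.

Lemma ex_pd_plus F G v p : ex_pd v F p -> ex_pd v G p -> ex_pd v (fun q => F q + G q) p.
Proof. exact (ex_derive_plus _ _ _). Qed.

Lemma ex_pd_mult F G v p : ex_pd v F p -> ex_pd v G p -> ex_pd v (fun q => F q * G q) p.
Proof. exact (ex_derive_mult _ _ _). Qed.

Lemma ex_pd_inv F v p : ex_pd v F p -> F p <> 0 -> ex_pd v (fun q => / F q) p.
Proof. intros H H0; apply ex_derive_inv; rewrite ?upd_id; assumption. Qed.

Lemma ex_pd_sqrt F v p : ex_pd v F p -> 0 < F p -> ex_pd v (fun q => sqrt (F q)) p.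
Proof.
  intros H H0; eexists; apply is_derive_sqrt.
  - apply Derive_correct, H.
  - rewrite upd_id; exact H0.
Qed.

Lemma ex_pd_coord v w p : ex_pd v (fun q => q w) p.
Proof.
  unfold ex_pd, upd; destruct (jvar_eq_dec v w).
  - apply ex_derive_id.
  - apply ex_derive_const.
Qed.

(** Closure under products, inverses and roots goes by induction on the number of derivatives. The
    quantification over lists in [smooth] offers no such induction, hence this graded form;
    [smoothP] links the two. *)
Fixpoint smooth_upto (n : nat) (F : jfun) : Prop :=
  (forall p, dom p -> cont_at F p) /\
  match n with
  | O => True
  | S m => forall v, (forall p, dom p -> ex_pd v F p) /\ smooth_upto m (pd v F)
  end.

Lemma smooth_upto_ext n F G : eq_dom F G -> smooth_upto n F -> smooth_upto n G.
Proof.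
  revert F G; induction n as [|n IH]; intros F G E [Hc Hd]; split.
  - intros p Hp; apply (cont_ext F G p E Hp), Hc, Hp.
  - exact I.
  - intros p Hp; apply (cont_ext F G p E Hp), Hc, Hp.
  - intro v; destruct (Hd v) as [He Hs]; split.
    + intros p Hp; apply (ex_pd_ext F G v p E Hp), He, Hp.
    + apply (IH (pd v F)); [|exact Hs]. intros p Hp; apply pd_ext; assumption.
Qed.

Lemma smooth_upto_pred n F : smooth_upto (S n) F -> smooth_upto n F.
Proof.
  revert F; induction n as [|n IH]; intros F [Hc Hd]; split; try exact Hc; try exact I.
  intro v; destruct (Hd v) as [He Hs]; split; [exact He | apply IH, Hs].
Qed.

Lemma smooth_upto_cont n F p : smooth_upto n F -> dom p -> cont_at F p.
Proof. destruct n; intros [H _]; apply H. Qed.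

Lemma smooth_pd v F : smooth F -> smooth (pd v F).
Proof.
  intros H l p Hp. generalize (H (l ++ v :: nil) p Hp).
  rewrite fold_right_app; exact (fun h => h).
Qed.

Lemma smoothP F : smooth F <-> forall n, smooth_upto n F.
Proof.
  split.
  - intros H n; revert F H; induction n as [|n IH]; intros F H.
    + split; [intros p Hp; exact (proj1 (H nil p Hp)) | exact I].
    + split; [intros p Hp; exact (proj1 (H nil p Hp)) |].
      intro v; split.
      * intros p Hp; exact (proj2 (H nil p Hp) v).
      * apply IH, smooth_pd, H.
  (* [fold_right pd F l] differentiates by the last element of [l] first, so the list is peeled from
     the right. *)
  - intros H l; revert F H; induction l as [|v l IH] using rev_ind; intros F H p Hp.
    + split; [exact (smooth_upto_cont 0 F p (H 0%nat) Hp)|].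
      intro v; exact (proj1 (proj2 (H 1%nat) v) p Hp).
    + rewrite fold_right_app; apply IH; [|exact Hp].
      intro n; exact (proj2 (proj2 (H (S n)) v)).
Qed.

Lemma smooth_upto_plus n F G :
  smooth_upto n F -> smooth_upto n G -> smooth_upto n (fun p => F p + G p).
Proof.
  revert F G; induction n as [|n IH]; intros F G HF HG;
    (split; [intros p Hp; apply cont_plus; eapply smooth_upto_cont; eassumption |]).
  - exact I.
  - intro v; destruct (proj2 HF v) as [EF SF], (proj2 HG v) as [EG SG]; split.
    + intros p Hp; apply ex_pd_plus; auto.
    + apply (smooth_upto_ext n (fun p => pd v F p + pd v G p)); [|apply IH; assumption].
      intros p Hp; symmetry; apply pd_plus; auto.
Qed.

Lemma smooth_upto_mult n F G :
  smooth_upto n F -> smooth_upto n G -> smooth_upto n (fun p => F p * G p).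
Proof.
  revert F G; induction n as [|n IH]; intros F G HF HG;
    (split; [intros p Hp; apply cont_mult; eapply smooth_upto_cont; eassumption |]).
  - exact I.
  - intro v; destruct (proj2 HF v) as [EF SF], (proj2 HG v) as [EG SG]; split.
    + intros p Hp; apply ex_pd_mult; auto.
    + apply (smooth_upto_ext n (fun p => pd v F p * G p + F p * pd v G p)).
      * intros p Hp; symmetry; apply pd_mult; auto.
      * apply smooth_upto_plus; apply IH; try assumption; apply smooth_upto_pred; assumption.
Qed.

Lemma smooth_upto_const n c : smooth_upto n (fun _ => c).
Proof.
  revert c; induction n as [|n IH]; intro c;
    (split; [intros p Hp; apply cont_const |]); [exact I|].
  intro v; split; [intros p Hp; apply ex_pd_const|].
  apply (smooth_upto_ext n (fun _ => 0)); [|apply IH].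
  intros p Hp; symmetry; apply pd_const.
Qed.

Lemma smooth_upto_inv n F : (forall p, dom p -> F p <> 0) ->
  smooth_upto n F -> smooth_upto n (fun p => / F p).
Proof.
  intro H0; induction n as [|n IH]; intro HF;
    (split; [intros p Hp; apply cont_inv;
             [eapply smooth_upto_cont; eassumption | apply H0, Hp] |]); [exact I|].
  intro v; destruct (proj2 HF v) as [EF SF]; split.
  - intros p Hp; apply ex_pd_inv; auto.
  (* The derivative contains 1/F again, but is only needed one level lower, where the induction
     hypothesis supplies it. *)
  - apply (smooth_upto_ext n (fun p => - 1 * (pd v F p * (/ F p * / F p)))).
    + intros p Hp; symmetry; apply pd_inv; auto.
    + apply smooth_upto_pred in HF.
      repeat apply smooth_upto_mult; auto using smooth_upto_const.
Qed.

Lemma smooth_upto_sqrt n F : (forall p, dom p -> 0 < F p) ->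
  smooth_upto n F -> smooth_upto n (fun p => sqrt (F p)).
Proof.
  intro H0; induction n as [|n IH]; intro HF;
    (split; [intros p Hp; apply cont_sqrt;
             eapply smooth_upto_cont; eassumption |]); [exact I|].
  intro v; destruct (proj2 HF v) as [EF SF]; split.
  - intros p Hp; apply ex_pd_sqrt; auto.
  - apply (smooth_upto_ext n (fun p => / 2 * (pd v F p * / sqrt (F p)))).
    + intros p Hp; symmetry; apply pd_sqrt; auto.
    + apply smooth_upto_pred in HF.
      repeat apply smooth_upto_mult; auto using smooth_upto_const.
      apply smooth_upto_inv; auto.
      intros p Hp; apply Rgt_not_eq, sqrt_lt_R0, H0, Hp.
Qed.

Lemma smooth_upto_coord n v : smooth_upto n (fun p => p v).
Proof.
  destruct n as [|n]; (split; [intros p Hp; apply cont_coord |]); [exact I|].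
  intro w; split; [intros p Hp; apply ex_pd_coord|].
  apply (smooth_upto_ext n (fun _ => if jvar_eq_dec w v then 1 else 0)).
  - intros p Hp; symmetry; apply pd_coord.
  - apply smooth_upto_const.
Qed.

(** * Dependence on finitely many coordinates *)

Lemma depends_le m n F : (m <= n)%nat -> depends_upto m F -> depends_upto n F.
Proof. intros L H p q Hp Hq E1 E2 E3; apply H; auto; intros k Hk; apply E3; lia. Qed.

Lemma depends_pd_high n F k p :
  depends_upto n F -> (n < k)%nat -> dom p -> pd (U k) F p = 0.
Proof.
  intros H L Hp; unfold pd; rewrite <- (Derive_const (F p) (p (U k))).
  apply Derive_ext_loc; generalize (dom_coord p (U k) Hp); apply filter_imp; intros s Hs.
  apply H; auto; intros; apply upd_other; try discriminate; injection; lia.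
Qed.

Lemma depends_pd n F v : depends_upto n F -> depends_upto n (pd v F).
Proof.
  intro H.
  (* Either [v] lies beyond the bound and the derivative vanishes, or p and q share the coordinate
     [v] and the difference quotients are taken at the same point. *)
  assert (K : (exists k, v = U k /\ (n < k)%nat) \/
              (forall p q : jet, p X = q X -> p T = q T ->
                (forall k, (k <= n)%nat -> p (U k) = q (U k)) -> p v = q v)).
  { destruct v as [| |k]; auto.
    destruct (le_lt_dec k n); [right; auto | left; eauto]. }
  destruct K as [(k & -> & L)|K]; intros p q Hp Hq E1 E2 E3.
  - rewrite !(depends_pd_high n F k) by assumption; reflexivity.
  - unfold pd; rewrite <- (K p q E1 E2 E3).
    apply Derive_ext_loc.
    generalize (filter_and _ _ (dom_coord p v Hp)
      (eq_rect_r (fun a => locally a (fun s => dom (upd q v s)))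
         (dom_coord q v Hq) (K p q E1 E2 E3))).
    apply filter_imp; intros s [H1 H2]; apply H; auto; intros; unfold upd;
      destruct (jvar_eq_dec _ _); auto.
Qed.

(** The mean value theorem needs the whole line inside [dom]. This holds for x, t, u and u_k with k
    > 3, but not for u_1, u_2, u_3, which is why later order arguments stop at 3. *)
Lemma constant_along F v p : smooth F -> (forall s, dom (upd p v s)) ->
  (forall q, dom q -> pd v F q = 0) -> forall s, F (upd p v s) = F p.
Proof.
  intros HS D H0 s.
  rewrite <- (upd_id p v) at 2.
  set (g := fun s => F (upd p v s)); change (g s = g (p v)).
  assert (G : forall t, is_derive g t 0).
  { intro t. assert (Ht := H0 _ (D t)). unfold pd in Ht; rewrite upd_same in Ht.
    assert (He := proj2 (HS nil _ (D t)) v); simpl in He; unfold ex_pd in He.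
    rewrite upd_same in He. rewrite <- Ht.
    apply (is_derive_ext (fun s => F (upd (upd p v t) v s))).
    - intro x; rewrite upd_upd; reflexivity.
    - apply Derive_correct, He. }
  destruct (Rtotal_order (p v) s) as [O|[<-|O]]; auto.
  - symmetry; apply (eq_is_derive g); auto.
  - apply (eq_is_derive g); auto.
Qed.

Lemma dom_upd p v s : dom p -> v <> U 1 -> v <> U 2 -> v <> U 3 -> dom (upd p v s).
Proof.
  intros [A B] H1 H2 H3; unfold dom, Schw, u in *; rewrite !upd_other by assumption; auto.
Qed.

(* For [n >= 3] the coordinate u_(n+1) ranges over the whole line in [dom]. *)
Lemma depends_lower n F : (3 <= n)%nat -> smooth F -> depends_upto (S n) F ->
  (forall p, dom p -> pd (U (S n)) F p = 0) -> depends_upto n F.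
Proof.
  intros L HS HD H0 p q Hp Hq E1 E2 E3.
  assert (D : forall s, dom (upd p (U (S n)) s))
    by (intro s; apply dom_upd; [exact Hp | injection; lia ..]).
  rewrite <- (constant_along F (U (S n)) p HS D H0 (q (U (S n)))).
  apply HD; auto; try (rewrite upd_other by discriminate; assumption).
  intros k Hk; destruct (Nat.eq_dec k (S n)) as [->|N]; [apply upd_same|].
  rewrite upd_other by (injection; lia); apply E3; lia.
Qed.

Lemma locally_coord2 (P : jet -> Prop) p v w : v <> w ->
  @locally jet_space p P -> locally_2d (fun a b => P (upd (upd p v a) w b)) (p v) (p w).
Proof.
  intros N [e He]; exists e; intros a b Ha Hb; apply He; intro z.
  unfold upd; destruct (jvar_eq_dec w z) as [<-|]; [exact Hb|].
  destruct (jvar_eq_dec v z) as [<-|]; [exact Ha | apply ball_center].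
Qed.

Lemma pd_upd F p v a : pd v F (upd p v a) = Derive (fun s => F (upd p v s)) a.
Proof.
  unfold pd; rewrite upd_same; apply Derive_ext; intro; rewrite upd_upd; reflexivity.
Qed.

Lemma ex_pd_upd F p v a : ex_pd v F (upd p v a) -> ex_derive (fun s => F (upd p v s)) a.
Proof.
  unfold ex_pd; rewrite upd_same; apply ex_derive_ext; intro; rewrite upd_upd; reflexivity.
Qed.

(** Schwarz's theorem on the plane through p in the directions v and w; continuity for the
    sup-distance on jets restricts to continuity on that plane. *)
Lemma pd_comm F v w p : smooth F -> dom p -> pd v (pd w F) p = pd w (pd v F) p.
Proof.
  intros HS Hp; destruct (jvar_eq_dec v w) as [->|N]; [reflexivity|].
  set (f := fun a b => F (upd (upd p v a) w b)).
  assert (Nw : w <> v) by congruence.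
  assert (B : forall a b, Derive (fun t => f a t) b = pd w F (upd (upd p v a) w b)).
  { intros a b; rewrite pd_upd; reflexivity. }
  assert (A : forall a b, Derive (fun t => f t b) a = pd v F (upd (upd p v a) w b)).
  { intros a b; rewrite (upd_swap p v w a b N), pd_upd; apply Derive_ext; intro t.
    unfold f; rewrite (upd_swap p v w t b N); reflexivity. }
  assert (BA : forall a b, Derive (fun z => Derive (fun t => f z t) b) a
                 = pd v (pd w F) (upd (upd p v a) w b)).
  { intros a b; rewrite (upd_swap p v w a b N), pd_upd; apply Derive_ext; intro z.
    rewrite B, (upd_swap p v w z b N); reflexivity. }
  assert (AB : forall a b, Derive (fun z => Derive (fun t => f t z) a) b
                 = pd w (pd v F) (upd (upd p v a) w b)).
  { intros a b; rewrite pd_upd; apply Derive_ext; intro z; apply A. }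
  assert (E : upd (upd p v (p v)) w (p w) = p).
  { apply functional_extensionality; intro z; unfold upd.
    destruct (jvar_eq_dec w z) as [<-|]; auto; destruct (jvar_eq_dec v z) as [<-|]; auto. }
  assert (C : forall G, cont_at G p ->
            continuity_2d_pt (fun a b => G (upd (upd p v a) w b)) (p v) (p w)).
  { intros G HG eps; apply (locally_coord2 (fun q => Rabs (G q - _) < eps) p v w N).
    rewrite E; exact (HG _ (locally_ball (G p) eps)). }
  transitivity (Derive (fun z => Derive (fun t => f z t) (p w)) (p v)).
  { rewrite BA, E; reflexivity. }
  transitivity (Derive (fun z => Derive (fun t => f t z) (p v)) (p w)).
  2: { rewrite AB, E; reflexivity. }
  apply Schwarz.
  - generalize (locally_coord2 dom p v w N (dom_open p Hp)).
    apply locally_2d_impl, locally_2d_forall; intros a b Hd.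
    set (q := upd (upd p v a) w b) in *.
    assert (EQ : q = upd (upd p w b) v a) by apply (upd_swap p v w a b N).
    repeat split.
    + apply (ex_derive_ext (fun t => F (upd (upd p w b) v t))).
      { intro t; unfold f; rewrite (upd_swap p v w t b N); reflexivity. }
      apply ex_pd_upd; rewrite <- EQ; exact (proj2 (HS nil q Hd) v).
    + apply ex_pd_upd; exact (proj2 (HS nil q Hd) w).
    + apply (ex_derive_ext (fun t => pd w F (upd (upd p w b) v t))).
      { intro t; rewrite B, (upd_swap p v w t b N); reflexivity. }
      apply ex_pd_upd; rewrite <- EQ; exact (proj2 (HS (w :: nil) q Hd) v).
    + apply (ex_derive_ext (fun t => pd v F (upd (upd p v a) w t))).
      { intro t; symmetry; apply A. }
      apply ex_pd_upd; exact (proj2 (HS (v :: nil) q Hd) w).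
  - intro eps; rewrite BA.
    generalize (C (pd v (pd w F)) (proj1 (HS (v :: w :: nil) p Hp)) eps).
    apply locally_2d_impl, locally_2d_forall; intros a b; rewrite BA; auto.
  - intro eps; rewrite AB.
    generalize (C (pd w (pd v F)) (proj1 (HS (w :: v :: nil) p Hp)) eps).
    apply locally_2d_impl, locally_2d_forall; intros a b; rewrite AB; auto.
Qed.

(** * Differential rings and formal power series *)

(** The field [half] is an atom for [ring]; wherever 1/2 + 1/2 has to cancel, the term is first
    written with [half + half] and then rewritten by [half_half]. *)
Record dring := DRing {
  car :> Type;
  dzero : car; done : car; dadd : car -> car -> car; dmul : car -> car -> car;
  dsub : car -> car -> car; dopp : car -> car;
  dring_th : ring_theory dzero done dadd dmul dsub dopp eq;
  half : car; half_half : dadd half half = done;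
  der : car -> car;
  der_add : forall a b, der (dadd a b) = dadd (der a) (der b);
  der_mul : forall a b, der (dmul a b) = dadd (dmul (der a) b) (dmul a (der b)) }.

Arguments dzero {d}. Arguments done {d}. Arguments dadd {d}. Arguments dmul {d}.
Arguments dsub {d}. Arguments dopp {d}. Arguments half {d}. Arguments der {d}.
Arguments half_half {d}. Arguments der_add {d}. Arguments der_mul {d}.

Declare Scope dring_scope.
Delimit Scope dring_scope with dr.
Notation "0" := dzero : dring_scope.
Notation "1" := done : dring_scope.
Infix "+" := dadd : dring_scope.
Infix "*" := dmul : dring_scope.
Infix "-" := dsub : dring_scope.
Notation "- a" := (dopp a) : dring_scope.
Local Open Scope dring_scope.

Section DerFacts.
Variable K : dring.
Add Ring Kring : (dring_th K).
Implicit Types a b : K.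

Lemma dadd_cancel a b : a + b = a -> b = 0.
Proof. intro H; replace b with ((a + b) - a) by ring; rewrite H; ring. Qed.

Lemma dsub_eq a b : a - b = 0 -> a = b.
Proof. intro H; replace a with ((a - b) + b) by ring; rewrite H; ring. Qed.

Lemma der0 : der 0 = (0 : K).
Proof. apply (dadd_cancel (der 0)); rewrite <- der_add; f_equal; ring. Qed.

Lemma der1 : der 1 = (0 : K).
Proof.
  apply (dadd_cancel (der 1)). transitivity (der ((1 : K) * 1)).
  - rewrite der_mul; ring.
  - f_equal; ring.
Qed.

Lemma der_opp a : der (- a) = - der a.
Proof.
  apply dsub_eq. replace (der (- a) - - der a) with (der (- a) + der a) by ring.
  rewrite <- der_add, <- der0; f_equal; ring.
Qed.

Lemma der_sub a b : der (a - b) = der a - der b.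
Proof.
  replace (a - b) with (a + - b) by ring; rewrite der_add, der_opp; ring.
Qed.

Lemma der_minus_one : der (- (1)) = (0 : K).
Proof. rewrite der_opp, der1; ring. Qed.

Lemma der_half : der half = (0 : K).
Proof.
  assert (H : der half + der half = (0 : K)) by (rewrite <- der_add, half_half; apply der1).
  replace (der half) with ((half + half) * der half :> K) by (rewrite half_half; ring).
  replace ((half + half) * der half) with (half * (der half + der half) :> K) by ring.
  rewrite H; ring.
Qed.

End DerFacts.

Ltac dsimp := repeat first
  [ rewrite der_add | rewrite der_sub | rewrite der_opp | rewrite der_mul
  | rewrite der_half | rewrite der0 | rewrite der1 ].

Section PowerSeries.
Variable K : dring.
Add Ring Kring : (dring_th K).
Implicit Types f g h : nat -> K.

Fixpoint conv f g (n : nat) : K :=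
  match n with
  | O => f O * g O
  | S m => f O * g (S m) + conv (fun i => f (S i)) g m
  end.

Lemma conv_ext f f' g g' n : (forall i, f i = f' i) -> (forall i, g i = g' i) ->
  conv f g n = conv f' g' n.
Proof.
  revert f f'; induction n as [|n IH]; intros f f' Hf Hg; simpl; rewrite Hf, Hg;
    [|f_equal; apply IH]; auto.
Qed.

Lemma conv_last f g n : conv f g (S n) = f (S n) * g O + conv f (fun i => g (S i)) n.
Proof.
  revert f; induction n as [|n IH]; intro f; [simpl; ring|].
  change (conv f g (S (S n))) with (f O * g (S (S n)) + conv (fun i => f (S i)) g (S n)).
  rewrite IH; simpl; ring.
Qed.

Lemma conv_comm f g n : conv f g n = conv g f n.
Proof.
  revert f g; induction n as [|n IH]; intros f g; [simpl; ring|].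
  rewrite conv_last, IH; simpl; ring.
Qed.

Lemma conv_add_l f g h n : conv (fun i => f i + g i) h n = conv f h n + conv g h n.
Proof.
  revert f g; induction n as [|n IH]; intros f g; simpl; [ring|].
  rewrite (IH (fun i => f (S i)) (fun i => g (S i))); ring.
Qed.

Lemma conv_scal_l (a : K) f h n : conv (fun i => a * f i) h n = a * conv f h n.
Proof.
  revert f; induction n as [|n IH]; intros f; simpl; [ring|].
  rewrite (IH (fun i => f (S i))); ring.
Qed.

Lemma conv_zero_l f h n : (forall i, f i = 0) -> conv f h n = 0.
Proof.
  revert f; induction n as [|n IH]; intros f H; simpl; rewrite H; [ring|].
  rewrite IH by auto; ring.
Qed.

Lemma conv_assoc f g h n : conv (conv f g) h n = conv f (conv g h) n.
Proof.
  revert f; induction n as [|n IH]; intro f; [simpl; ring|].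
  change (conv (conv f g) h (S n)) with
    (f O * g O * h (S n)
     + conv (fun i => f O * g (S i) + conv (fun j => f (S j)) g i) h n).
  rewrite (conv_add_l (fun i => f O * g (S i)) (conv (fun j => f (S j)) g)).
  rewrite conv_scal_l, IH; simpl; ring.
Qed.

Definition ps_const (a : K) (n : nat) : K := match n with O => a | _ => 0 end.
Definition ps_z (n : nat) : K := match n with S O => 1 | _ => 0 end.
Definition ps_shift f (n : nat) : K := match n with O => 0 | S m => f m end.

Lemma conv_const a f n : conv (ps_const a) f n = a * f n.
Proof.
  destruct n; simpl; [reflexivity|]. rewrite conv_zero_l by reflexivity; ring.
Qed.

Lemma conv_z f n : conv ps_z f n = ps_shift f n.
Proof.
  destruct n as [|n]; simpl; [ring|].
  transitivity (0 * f (S n) + conv (ps_const 1) f n).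
  - f_equal; apply conv_ext; auto; intros [|i]; reflexivity.
  - rewrite conv_const; ring.
Qed.

Lemma conv_der f g n :
  der (conv f g n) = conv (fun i => der (f i)) g n + conv f (fun i => der (g i)) n.
Proof.
  revert f; induction n as [|n IH]; intro f; simpl; rewrite ?der_add, der_mul; [ring|].
  rewrite IH; ring.
Qed.

Lemma ps_ring_theory : ring_theory (fun _ : nat => 0) (ps_const 1) (fun f g n => f n + g n)
  conv (fun f g n => f n - g n) (fun f n => - f n) (@eq (nat -> K)).
Proof.
  split; intros; apply functional_extensionality; intro n; try ring.
  - rewrite conv_const; ring.
  - apply conv_comm.
  - symmetry; apply conv_assoc.
  - apply conv_add_l.
Qed.

Definition ps : dring.
Proof.
  refine (DRing (nat -> K) (fun _ => 0) (ps_const 1) (fun f g n => f n + g n) conv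
    (fun f g n => f n - g n) (fun f n => - f n) ps_ring_theory (ps_const half) _
    (fun f n => der (f n)) _ _).
  - apply functional_extensionality; intros [|n]; simpl; [apply half_half | ring].
  - intros; apply functional_extensionality; intro n; apply der_add.
  - intros; apply functional_extensionality; intro n; apply conv_der.
Defined.

Definition psc (a : K) : ps := ps_const a.
Definition psz : ps := ps_z.

Lemma psc_der a : der (psc a) = psc (der a).
Proof.
  apply functional_extensionality; intros [|n]; simpl; [reflexivity | apply der0].
Qed.

Lemma psz_der : der psz = 0.
Proof.
  apply functional_extensionality; intros [|[|n]]; simpl; [apply der0|apply der1|apply der0].
Qed.

(** The z-adic filtration: f is divisible by z^n. Equalities of series are proved by climbing it. *)
Definition vanish (n : nat) f := forall k, (k < n)%nat -> f k = 0.

Lemma vanish_conv n f g : vanish n f -> vanish n (conv f g).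
Proof.
  intros H k Hk; revert f n H Hk; induction k as [|k IH]; intros f n H Hk; simpl.
  - rewrite H by lia; ring.
  - rewrite H by lia. rewrite (IH (fun i => f (S i)) (pred n)); [ring | | lia].
    intros i Hi; apply H; lia.
Qed.

Lemma vanish_lead n f g : vanish n f -> conv f g n = f n * g O.
Proof.
  revert f; induction n as [|n IH]; intros f H; simpl; [reflexivity|].
  rewrite H by lia. rewrite (IH (fun i => f (S i))); [ring|].
  intros i Hi; apply H; lia.
Qed.

Lemma vanish_succ n f : vanish n f -> f n = 0 -> vanish (S n) f.
Proof.
  intros H E k Hk; destruct (Nat.eq_dec k n) as [->|]; [exact E | apply H; lia].
Qed.

Lemma vanish_all f : (forall n, vanish n f) -> forall n, f n = 0.
Proof. intros H n; apply (H (S n)); lia. Qed.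

End PowerSeries.

Arguments ps_const {K}. Arguments ps_z {K}. Arguments ps_shift {K}. Arguments vanish {K}.
Arguments conv {K}. Arguments psc {K}. Arguments psz {K}.

Section PsVanish.
Variable K : dring.
Add Ring Kring : (dring_th K).
Add Ring Pring : (dring_th (ps K)).
Implicit Types f g : ps K.

Lemma vanish_mul n f g : vanish n f -> vanish n (f * g).
Proof. apply vanish_conv. Qed.

Lemma vanish_mul_r n f g : vanish n g -> vanish n (f * g).
Proof. intro H; replace (f * g) with (g * f) by ring; apply vanish_mul, H. Qed.

Lemma vanish_add n f g : vanish n f -> vanish n g -> vanish n (f + g).
Proof. intros Hf Hg k Hk; simpl; rewrite Hf, Hg by exact Hk; ring. Qed.

Lemma vanish_sub n f g : vanish n f -> vanish n g -> vanish n (f - g).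
Proof. intros Hf Hg k Hk; simpl; rewrite Hf, Hg by exact Hk; ring. Qed.

Lemma vanish_der n f : vanish n f -> vanish n (der f).
Proof. intros Hf k Hk; simpl; rewrite Hf by exact Hk; apply der0. Qed.

Lemma vanish_z n f : vanish n f -> vanish (S n) (psz * f).
Proof.
  intros H [|k] Hk; simpl; [ring|].
  transitivity (ps_shift f (S k)); [apply (conv_z K f (S k)) |].
  apply H; lia.
Qed.

Lemma vanish_mul0 n f g : vanish n f -> g O = 0 -> vanish (S n) (f * g).
Proof.
  intros H E; apply vanish_succ; [apply vanish_mul, H|].
  change (conv f g n = 0); rewrite (vanish_lead K n f g H), E; ring.
Qed.

Lemma vanish_eq f : (forall n, vanish n f) -> f = 0.
Proof. intro H; apply functional_extensionality; intro n; apply vanish_all, H. Qed.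

(** The lowest coefficient of g that could survive is multiplied by the unit [f O], so it vanishes
    as well. *)
Lemma ps_unit_cancel f g (a : K) : f O * a = 1 -> f * g = 0 -> g = 0.
Proof.
  intros E H; apply vanish_eq; induction n as [|n IH]; [intros k Hk; lia|].
  apply vanish_succ; [exact IH|].
  assert (H1 : conv g f n = 0).
  { change ((g * f) n = 0); replace (g * f) with (f * g) by ring; rewrite H; reflexivity. }
  rewrite (vanish_lead K n g f IH) in H1.
  replace (g n) with (g n * (f O * a)) by (rewrite E; ring).
  replace (g n * (f O * a)) with (g n * f O * a) by ring; rewrite H1; ring.
Qed.

End PsVanish.

(** * The generating series of the hierarchy *)

(** Up to a constant factor this is the squared Wronskian of two solutions of z y_xx = (S/2) y,
    written in terms of their product f. *)
Definition first_integral {L : dring} (z S f : L) : L :=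
  S * f * f - z * (f * der (der f) - half * (der f * der f)).

Section FirstIntegral.
Variable L : dring.
Add Ring Lring : (dring_th L).
Variables z S : L.
Hypothesis Hz : der z = 0.

Lemma first_integral_add (f y : L) :
  first_integral z S (f + y) = first_integral z S f + S * y * (f + f) + S * y * y
    - z * (f * der (der y) + y * der (der f) + y * der (der y)
           - (der f * der y + half * (der y * der y))).
Proof.
  unfold first_integral; dsimp.
  (* The cross term of the square carries the coefficient 1/2 + 1/2, which has to be made visible to
     [ring]. *)
  replace (der f * der y) with ((half + half) * (der f * der y))
    by (rewrite half_half; ring).
  ring.
Qed.

Lemma first_integral_der (f : L) :
  der (first_integral z S f)
  = f * ((S + S) * der f + der S * f - z * der (der (der f))).
Proof.
  unfold first_integral; dsimp; rewrite Hz.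
  match goal with |- ?a = ?b => transitivity
    (b + z * (((half + half) - 1) * (der f * der (der f)))); [ring|] end.
  rewrite half_half; ring.
Qed.

(** The conclusion is the linearisation of the first integral when S moves by x and f by y. These
    are the infinitesimal changes of S and of the vector field f under the vector field g; the first
    integral is a scalar, and by the hypothesis it is constant along x, so it does not move. *)
Lemma linearized_first_integral (f g : L) : (S + S) * der f + der S * f = z * der (der (der f)) ->
  let x := (S + S) * der g + der S * g - z * der (der (der g)) in
  let y := der f * g - f * der g in
  x * f * f + (S + S) * f * y
  = z * (f * der (der y) + der (der f) * y - der f * der y).
Proof.
  intros H x y.
  transitivity (f * g * ((S + S) * der f + der S * f) - z * f * f * der (der (der g)));
    [subst x y; ring|].
  rewrite H; subst x y; dsimp; ring.
Qed.

End FirstIntegral.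

Section Chi.
Variable K : dring.
Add Ring Kring : (dring_th K).
Add Ring Pring : (dring_th (ps K)).
Variables r s : K.

(** Newton's iteration with frozen slope. At f = s the derivative of S f^2 is 2 r^2 s = 2 r, whose
    inverse is [half * s]; the differential terms carry a factor z and need not enter the slope. *)
Fixpoint chi_it (n : nat) : ps K :=
  match n with
  | O => psc s
  | Datatypes.S m =>
      chi_it m + psc (half * s) * (1 - first_integral psz (psc (r * r)) (chi_it m))
  end.

Lemma chi_it_succ m : chi_it (Datatypes.S m) =
  chi_it m + psc (half * s) * (1 - first_integral psz (psc (r * r)) (chi_it m)).
Proof. reflexivity. Qed.

Lemma vanish_perturbation n (f y : ps K) : vanish n y ->
  vanish n (f * der (der y) + y * der (der f) + y * der (der y)
            - (der f * der y + half * (der y * der y))).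
Proof.
  intro H; assert (H1 := vanish_der K n y H); assert (H2 := vanish_der K n _ H1).
  repeat first [ apply vanish_add | apply vanish_sub ];
    solve [ apply vanish_mul; assumption
          | repeat (apply vanish_mul_r; try assumption) ].
Qed.

(** The iterate [chi_it n] is correct modulo z^(n+1), so the diagonal picks each coefficient after
    it has stabilised. *)
Definition chi : ps K := fun n => chi_it n n.

Lemma psc_mul_at (a : K) (f : ps K) n : (psc a * f) n = a * f n.
Proof. apply conv_const. Qed.

Lemma psz_mul_at (f : ps K) n : (psz * f) n = ps_shift f n.
Proof. apply conv_z. Qed.

Lemma psc_mul (a b : K) : psc (a * b) = psc a * psc b.
Proof.
  apply functional_extensionality; intro n; rewrite psc_mul_at; destruct n; simpl; ring.
Qed.

Lemma psc_one : psc 1 = (1 : ps K).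
Proof. reflexivity. Qed.

Hypothesis Hrs : r * s = 1.

Lemma chi_it_inv n : chi_it n O = s /\
  vanish (Datatypes.S n) (1 - first_integral psz (psc (r * r)) (chi_it n)).
Proof.
  induction n as [|n [I0 IH]].
  - split; [reflexivity|]. intros [|k] Hk; [|lia].
    unfold first_integral; simpl.
    transitivity (1 - r * s * (r * s)); [ring | rewrite Hrs; ring].
  - set (f := chi_it n) in *; set (e := 1 - first_integral psz (psc (r * r)) f) in *.
    assert (E0 : e O = 0) by (apply IH; lia).
    set (y := psc (half * s) * e).
    assert (Hy : vanish (Datatypes.S n) y) by (apply vanish_mul_r, IH).
    change (chi_it (Datatypes.S n)) with (f + y). split.
    + change (f O + (half * s) * e O = s); rewrite I0, E0; ring.
    + rewrite first_integral_add.
      set (w := f * der (der y) + _ + _ - _).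
      (* The new error is the old one times a factor whose constant term is 1 - (r s)^2 = 0, plus a
         multiple of z by terms in y. Both gain one power of z. *)
      replace (1 - _) with
        (e * (1 - psc (r * r) * psc (half * s) * (f + f)
              - psc (r * r) * psc (half * s) * y) + psz * w)
        by (subst y; unfold e; ring).
      apply vanish_add.
      * apply vanish_mul0; [exact IH|].
        change (1 - r * r * (half * s) * (f O + f O)
                - r * r * (half * s) * (half * s * e O) = 0).
        rewrite E0, I0.
        transitivity (1 - (half + half) * (r * s) * (r * s)); [ring|].
        rewrite half_half, Hrs; ring.
      * apply vanish_z, vanish_perturbation, Hy.
Qed.

Lemma chi_it_stable n m k : (k <= n)%nat -> (n <= m)%nat -> chi_it m k = chi_it n k.
Proof.
  intros Hk H; induction H as [|m H IH]; [reflexivity|].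
  rewrite <- IH. simpl chi_it.
  assert (V := vanish_mul_r K _ (psc (half * s)) _ (proj2 (chi_it_inv m))).
  transitivity (chi_it m k + 0); [|ring].
  rewrite <- (V k) by lia; reflexivity.
Qed.

Lemma chi_vanish n : vanish (Datatypes.S n) (chi - chi_it n).
Proof.
  intros k Hk; change (chi_it k k - chi_it n k = 0).
  rewrite (chi_it_stable k n k) by lia; ring.
Qed.

Lemma chi_first_integral : first_integral psz (psc (r * r)) chi = 1.
Proof.
  apply dsub_eq, vanish_eq; intro n.
  assert (V := chi_vanish n); set (y := chi - chi_it n) in V.
  replace chi with (chi_it n + y) by (subst y; ring).
  rewrite first_integral_add.
  set (w := chi_it n * der (der y) + _ + _ - _).
  intros k Hk.
  assert (Hw : vanish (Datatypes.S n) (psz * w))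
    by apply vanish_mul_r, vanish_perturbation, V.
  assert (Hi := proj2 (chi_it_inv n)).
  set (c := psc (r * r)) in *.
  assert (H1 : vanish (Datatypes.S n) (c * y * (chi_it n + chi_it n))) by
    (apply vanish_mul, vanish_mul_r, V).
  assert (H2 : vanish (Datatypes.S n) (c * y * y)) by apply vanish_mul_r, V.
  replace (_ - 1) with
    ((c * y * (chi_it n + chi_it n)) + (c * y * y) - (psz * w)
     - (1 - first_integral psz c (chi_it n))) by ring.
  apply (vanish_sub K (Datatypes.S n)); [|exact Hi|lia].
  apply vanish_sub; [|exact Hw]. apply vanish_add; assumption.
Qed.

Lemma chi_0 : chi O = s.
Proof. reflexivity. Qed.

(** Multiplied by [chi], the equation is the derivative of the first integral, which equals 1. The
    factor cancels because its constant term s has the inverse r. *)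
Lemma chi_ps_rec :
  (psc (r * r) + psc (r * r)) * der chi + der (psc (r * r)) * chi
  = psz * der (der (der chi)).
Proof.
  apply dsub_eq, (ps_unit_cancel K chi _ r).
  - rewrite chi_0, <- Hrs; ring.
  - rewrite <- first_integral_der by apply psz_der.
    rewrite chi_first_integral; apply der1.
Qed.

(** These are the Lenard relations. At n = 0 the shift gives 0: the chain starts with s in the
    kernel of P2. *)
Lemma chi_rec n :
  (r * r + r * r) * der (chi n) + der (r * r) * chi n
  = ps_shift (fun i => der (der (der (chi i)))) n.
Proof.
  assert (H := f_equal (fun f : ps K => f n) chi_ps_rec); cbv beta in H.
  rewrite psz_mul_at, psc_der in H.
  change (((psc (r * r) + psc (r * r)) * der chi) n + (psc (der (r * r)) * chi) n
          = ps_shift (fun i => der (der (der (chi i)))) n) in H.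
  rewrite <- H, psc_mul_at.
  replace ((psc (r * r) + psc (r * r)) * der chi)
    with (psc (r * r) * der chi + psc (r * r) * der chi) by ring.
  change ((r * r + r * r) * der (chi n) + der (r * r) * chi n =
    (psc (r * r) * der chi) n + (psc (r * r) * der chi) n + der (r * r) * chi n).
  rewrite psc_mul_at; simpl; ring.
Qed.

(** The right side is divisible by one more power of z than Y, while the left side multiplies the
    lowest coefficient of Y by the unit 2 r^2 s = 2 r. *)
Lemma linear_unique (Y : ps K) :
  (psc (r * r) + psc (r * r)) * chi * Y
  = psz * (chi * der (der Y) + der (der chi) * Y - der chi * der Y) -> Y = 0.
Proof.
  intro H; apply vanish_eq; induction n as [|n IH]; [intros k Hk; lia|].
  apply vanish_succ; [exact IH|].
  set (c := (psc (r * r) + psc (r * r)) * chi) in *.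
  assert (Z : (Y * c) n = 0).
  { replace (Y * c) with (c * Y) by ring; rewrite H.
    apply (vanish_z K n); [|lia].
    apply vanish_sub; [apply vanish_add|]; apply vanish_mul_r;
      [apply vanish_der, vanish_der, IH | exact IH | apply vanish_der, IH]. }
  change (conv Y c n = 0) in Z; rewrite (vanish_lead K n Y c IH) in Z.
  change (c O) with ((r * r + r * r) * s) in Z.
  replace (Y n) with (half * s * (Y n * ((r * r + r * r) * s))).
  - rewrite Z; ring.
  - transitivity ((half + half) * (r * s) * (r * s) * Y n); [ring|].
    rewrite half_half, Hrs; ring.
Qed.

Lemma conv_closed (P : K -> Prop) (f g : nat -> K) n :
  (forall a b, P a -> P b -> P (a + b)) -> (forall a b, P a -> P b -> P (a * b)) ->
  (forall i, P (f i)) -> (forall i, P (g i)) -> P (conv f g n).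
Proof.
  intros Ha Hm; revert f; induction n as [|n IH]; intros f Hf Hg; simpl; auto.
Qed.

Lemma chi_closed (P : K -> Prop) : P 0 -> P 1 -> P half -> P r -> P s ->
  (forall a b, P a -> P b -> P (a + b)) -> (forall a b, P a -> P b -> P (a - b)) ->
  (forall a b, P a -> P b -> P (a * b)) -> (forall a, P a -> P (der a)) ->
  forall n, P (chi n).
Proof.
  intros H0 H1 Hh Hr Hs Ha Hb Hm Hd n.
  assert (C : forall a, P a -> forall i, P (psc a i)) by (intros a H [|i]; simpl; auto).
  assert (M : forall f g : ps K, (forall i, P (f i)) -> (forall i, P (g i)) ->
    forall i, P ((f * g) i)) by (intros f g Hf Hg i; apply (conv_closed P f g i); auto).
  assert (Z : forall i, P ((psz : ps K) i)) by (intros [|[|i]]; simpl; auto).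
  assert (HH : forall i, P ((half : ps K) i)) by (intros [|i]; simpl; auto).
  (* In [chi_it n n] the number of iterations is separated from the index of the coefficient; the
     induction is on the former. *)
  unfold chi; generalize n at 2; induction n as [|m IH]; intro k; [apply C, Hs|].
  simpl chi_it.
  assert (D : forall f : ps K, (forall i, P (f i)) -> forall i, P (der f i))
    by (intros f Hf i; apply Hd, Hf).
  apply Ha; [apply IH|]; apply M; [apply C; auto|]; intro i; apply Hb.
  - apply (C 1 H1).
  - apply Hb; [apply M; [apply M; [apply C; auto|]|]; exact IH|].
    apply M; [exact Z|]; intro j; apply Hb.
    + apply M; [exact IH | apply D, D, IH].
    + apply M; [exact HH | apply M; apply D, IH].
Qed.

End Chi.

(** * Naturality of the generating series *)

Record dhom (K L : dring) := Dhom {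
  dmap :> K -> L;
  dmap_zero : dmap 0 = 0; dmap_one : dmap 1 = 1;
  dmap_add : forall a b, dmap (a + b) = dmap a + dmap b;
  dmap_sub : forall a b, dmap (a - b) = dmap a - dmap b;
  dmap_mul : forall a b, dmap (a * b) = dmap a * dmap b;
  dmap_half : dmap half = half;
  dmap_der : forall a, dmap (der a) = der (dmap a) }.

Section ChiHom.
Variables K L : dring.
Variable h : dhom K L.
Add Ring Lring' : (dring_th L).

Lemma dmap_conv (f g : nat -> K) n :
  h (conv f g n) = conv (fun i => h (f i)) (fun i => h (g i)) n.
Proof.
  revert f; induction n as [|n IH]; intro f; simpl;
    rewrite ?dmap_add, dmap_mul, ?IH; reflexivity.
Qed.

Definition ps_map (f : ps K) : ps L := fun n => h (f n).

Lemma ps_map_mul f g : ps_map (f * g) = ps_map f * ps_map g.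
Proof. apply functional_extensionality; intro n; apply dmap_conv. Qed.

Lemma ps_map_add f g : ps_map (f + g) = ps_map f + ps_map g.
Proof. apply functional_extensionality; intro n; apply dmap_add. Qed.

Lemma ps_map_sub f g : ps_map (f - g) = ps_map f - ps_map g.
Proof. apply functional_extensionality; intro n; apply dmap_sub. Qed.

Lemma ps_map_der f : ps_map (der f) = der (ps_map f).
Proof. apply functional_extensionality; intro n; apply dmap_der. Qed.

Lemma ps_map_psc a : ps_map (psc a) = psc (h a).
Proof.
  apply functional_extensionality; intros [|n]; [reflexivity|]; apply dmap_zero.
Qed.

Lemma ps_map_psz : ps_map psz = psz.
Proof.
  apply functional_extensionality; intros [|[|n]];
    [apply dmap_zero|apply dmap_one|apply dmap_zero].
Qed.

Lemma ps_map_one : ps_map 1 = 1.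
Proof.
  apply functional_extensionality; intros [|n]; [apply dmap_one|apply dmap_zero].
Qed.

Lemma ps_map_half : ps_map half = half.
Proof.
  apply functional_extensionality; intros [|n]; [apply dmap_half|apply dmap_zero].
Qed.

(** Every coefficient is built by ring operations and [der]. Applied to homomorphisms into dual
    numbers, this turns differentiation of [chi] into evaluation of [chi] over another ring. *)
Lemma chi_map r s n : h (chi K r s n) = chi L (h r) (h s) n.
Proof.
  assert (E : forall m, ps_map (chi_it K r s m) = chi_it L (h r) (h s) m).
  { induction m as [|m IH]; [apply ps_map_psc|].
    rewrite !chi_it_succ; unfold first_integral.
    rewrite ps_map_add, ps_map_mul, !ps_map_sub, !ps_map_mul, !ps_map_sub, !ps_map_mul,
      !ps_map_der, !ps_map_psc, ps_map_psz, ps_map_one, ps_map_half, IH, !dmap_mul, dmap_half.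
    reflexivity. }
  exact (f_equal (fun f : ps L => f n) (E n)).
Qed.

End ChiHom.

(** * Square-zero extensions and dual numbers *)

Record dmodule (K : dring) := DModule {
  mcar :> Type;
  mzero : mcar; madd : mcar -> mcar -> mcar; mopp : mcar -> mcar;
  mscal : K -> mcar -> mcar; mder : mcar -> mcar;
  madd_comm : forall m n, madd m n = madd n m;
  madd_assoc : forall l m n, madd l (madd m n) = madd (madd l m) n;
  madd_zero : forall m, madd mzero m = m;
  madd_opp : forall m, madd m (mopp m) = mzero;
  mscal_one : forall m, mscal 1 m = m;
  mscal_zero : forall m, mscal 0 m = mzero;
  mscal_zero_r : forall a, mscal a mzero = mzero;
  mscal_mul : forall a b m, mscal (a * b) m = mscal a (mscal b m);
  mscal_add_l : forall a b m, mscal (a + b) m = madd (mscal a m) (mscal b m);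
  mscal_add_r : forall a m n, mscal a (madd m n) = madd (mscal a m) (mscal a n);
  mder_add : forall m n, mder (madd m n) = madd (mder m) (mder n);
  mder_scal : forall a m, mder (mscal a m) = madd (mscal (der a) m) (mscal a (mder m)) }.

Arguments mzero {K d}. Arguments madd {K d}. Arguments mopp {K d}. Arguments mscal {K d}.
Arguments mder {K d}.

(* Linear identities in a module become ring identities in its square-zero extension. *)
Section Extension.
Variable K : dring.
Variable M : dmodule K.
Add Ring Kring : (dring_th K).

Lemma madd_swap (a b c d : M) :
  madd (madd a b) (madd c d) = madd (madd a c) (madd b d).
Proof.
  rewrite <- !madd_assoc; f_equal; rewrite !madd_assoc; f_equal; apply madd_comm.
Qed.

Lemma ext_ring_theory : @ring_theory (K * M) (0, mzero) (1, mzero)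
  (fun x y => (fst x + fst y, madd (snd x) (snd y)))
  (fun x y => (fst x * fst y, madd (mscal (fst x) (snd y)) (mscal (fst y) (snd x))))
  (fun x y => (fst x - fst y, madd (snd x) (mopp (snd y))))
  (fun x => (- fst x, mopp (snd x))) eq.
Proof.
  split; intros; repeat match goal with x : (_ * _)%type |- _ => destruct x as [? ?] end;
    simpl; f_equal; try ring.
  - apply madd_zero.
  - apply madd_comm.
  - apply madd_assoc.
  - rewrite mscal_one, mscal_zero_r, madd_comm; apply madd_zero.
  - apply madd_comm.
  - rewrite !mscal_add_r, <- !mscal_mul, madd_assoc.
    f_equal; [f_equal|]; f_equal; ring.
  - rewrite mscal_add_l, mscal_add_r; apply madd_swap.
  - apply madd_opp.
Qed.

Definition extension : dring.
Proof.
  refine (DRing _ _ _ _ _ _ _ ext_ring_theory (half, mzero) _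
    (fun x => (der (fst x), mder (snd x))) _ _).
  - simpl; f_equal; [apply half_half | apply madd_zero].
  - intros a b; simpl; f_equal; [apply der_add | apply mder_add].
  - intros a b; simpl; f_equal; [apply der_mul|].
    rewrite mder_add, !mder_scal, (madd_comm _ _ (mscal (der (fst b)) _)), madd_swap.
    reflexivity.
Defined.

End Extension.

Section Regular.
Variable K : dring.
Add Ring Kring : (dring_th K).

Definition regular : dmodule K.
Proof.
  refine (DModule K K 0 dadd dopp dmul der _ _ _ _ _ _ _ _ _ _ der_add der_mul);
    intros; ring.
Defined.

End Regular.

Definition dual (K : dring) : dring := extension K (regular K).

Section Dual.
Variable K : dring.
Add Ring Kring : (dring_th K).

Definition real_part : dhom (dual K) K.
Proof. refine (Dhom (dual K) K fst _ _ _ _ _ _ _); reflexivity. Defined.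

(** Series with dual coefficients are dual numbers over series. The identification turns the first
    integral over [dual K] into an equation over [dual (ps K)], whose second component can be read
    off. *)
Definition ps_dual : dhom (ps (dual K)) (dual (ps K)).
Proof.
  refine (Dhom (ps (dual K)) (dual (ps K))
    (fun f => (fun n => fst (f n), fun n => snd (f n))) _ _ _ _ _ _ _).
  - reflexivity.
  - simpl; f_equal; apply functional_extensionality; intros [|n]; reflexivity.
  - reflexivity.
  - intros a b. simpl; f_equal.
  - intros a b; simpl; f_equal; apply functional_extensionality; intro n; simpl.
    + exact (dmap_conv _ _ real_part a b n).
    + revert a; induction n as [|n IH]; intro a; [reflexivity|].
      rewrite (conv_last K (fun i => fst (b i)) (fun i => snd (a i))).
      simpl; rewrite (IH (fun i => a (S i))).
      ring.
  - simpl; f_equal; apply functional_extensionality; intros [|n]; reflexivity.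
  - reflexivity.
Defined.

End Dual.

(** * Linearisation of the generating series *)

Lemma dmap_first_integral (K L : dring) (h : dhom K L) z S f :
  h (first_integral z S f) = first_integral (h z) (h S) (h f).
Proof.
  unfold first_integral.
  rewrite !dmap_sub, !dmap_mul, !dmap_sub, !dmap_mul, !dmap_der, dmap_half; reflexivity.
Qed.

Section DualFirstIntegral.
Variable L : dring.
Add Ring Lring : (dring_th L).

Lemma dual_first_integral (z S x f y : L) :
  first_integral ((z, 0) : dual L) ((S, x) : dual L) ((f, y) : dual L) = 1 ->
  x * f * f + (S + S) * f * y = z * (f * der (der y) + der (der f) * y - der f * der y).
Proof.
  intro H; apply (f_equal snd) in H; simpl in H.
  apply dsub_eq.
  match type of H with ?a = _ => transitivity (a - z * (half + half - 1) * (der f * der y)) end.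
  - ring.
  - rewrite H, half_half; ring.
Qed.

End DualFirstIntegral.

Section Lin.
Variable K : dring.
Variables r s : K.
Hypothesis Hrs : r * s = 1.
Add Ring Kring : (dring_th K).
Add Ring Pring : (dring_th (ps K)).

Notation chi_rs := (chi K r s).

(** If S = r^2 becomes S + eps x with eps^2 = 0, its square root becomes r + eps x / (2 r), and the
    inverse root becomes s - eps x s^3 / 2. *)
Definition dual_r (x : K) : dual K := (r, half * s * x).
Definition dual_s (x : K) : dual K := (s, - (half * s * s * s * x)).

(* The derivative of the coefficients of [chi] when S = r^2 moves in the direction [x]. *)
Definition lin (x : K) : ps K := fun n => snd (chi (dual K) (dual_r x) (dual_s x) n).

Lemma dual_rs x : dual_r x * dual_s x = 1.
Proof.
  simpl; f_equal; [exact Hrs|].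
  transitivity (half * s * x * s * (1 - r * s)); [ring | rewrite Hrs; ring].
Qed.

Lemma dual_rr x : dual_r x * dual_r x = (r * r, x).
Proof.
  simpl; f_equal.
  transitivity ((half + half) * (r * s) * x); [ring | rewrite half_half, Hrs; ring].
Qed.

Lemma chi_dual x n : chi (dual K) (dual_r x) (dual_s x) n = (chi_rs n, lin x n).
Proof.
  rewrite (surjective_pairing (chi (dual K) (dual_r x) (dual_s x) n)); f_equal.
  exact (chi_map (dual K) K (real_part K) (dual_r x) (dual_s x) n).
Qed.

Lemma lin_eq x :
  psc x * chi_rs * chi_rs + (psc (r * r) + psc (r * r)) * chi_rs * lin x
  = psz * (chi_rs * der (der (lin x)) + der (der chi_rs) * lin x - der chi_rs * der (lin x)).
Proof.
  apply dual_first_integral.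
  transitivity (ps_dual K
    (first_integral psz (psc (dual_r x * dual_r x)) (chi (dual K) (dual_r x) (dual_s x)))).
  - rewrite dmap_first_integral; f_equal.
    + simpl; f_equal; apply functional_extensionality; intros [|[|n]]; reflexivity.
    + rewrite dual_rr; simpl; f_equal; apply functional_extensionality;
        intros [|n]; reflexivity.
    + simpl; f_equal; apply functional_extensionality; intro n; rewrite chi_dual; reflexivity.
  - rewrite (chi_first_integral (dual K) _ _ (dual_rs x)); apply dmap_one.
Qed.

Lemma psc_add (a b : K) : psc (a + b) = psc a + psc b.
Proof. apply functional_extensionality; intros [|n]; simpl; ring. Qed.

(** [lin] comes out of a nonlinear construction over the dual numbers, so additivity is not visible
    in it; it follows from uniqueness for the linearised equation. *)
Lemma lin_add x y n : lin (x + y) n = lin x n + lin y n.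
Proof.
  assert (E : lin (x + y) - lin x - lin y = 0).
  { apply (linear_unique K r s Hrs).
    assert (Hx := lin_eq x); assert (Hy := lin_eq y); assert (Hxy := lin_eq (x + y)).
    rewrite psc_add in Hxy. rewrite !der_sub.
    set (c := psc (r * r)) in *; set (f := chi_rs) in *.
    set (a := lin x) in *; set (b := lin y) in *; set (d := lin (x + y)) in *.
    match goal with |- _ = ?rhs => transitivity
      (((psc x + psc y) * f * f + (c + c) * f * d) - (psc x * f * f + (c + c) * f * a)
       - (psc y * f * f + (c + c) * f * b)); [ring|] end.
    rewrite Hx, Hy, Hxy; ring. }
  apply (f_equal (fun f : ps K => f n)) in E; simpl in E.
  apply dsub_eq; rewrite <- E; ring.
Qed.

(** Together with [ham2] this is the Hamiltonian pair of the Harry Dym equation. *)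
Definition ham1 (x : K) : K := der (der (der x)).
Definition ham2 (x : K) : K := (r * r + r * r) * der x + der (r * r) * x.

(* Both sides of this identity, read as power series in z, solve the linearised equation of
   the first integral in the direction (ham2 - z ham1) x, whose solution is unique. *)
Lemma lin_pencil x n :
  lin (ham2 x) n = ps_shift (lin (ham1 x)) n - chi_rs n * der x + der (chi_rs n) * x.
Proof.
  assert (E : lin (ham2 x) - psz * lin (ham1 x) - (der chi_rs * psc x - chi_rs * psc (der x)) = 0).
  { apply (linear_unique K r s Hrs).
    assert (H1 := lin_eq (ham1 x)); assert (H2 := lin_eq (ham2 x)).
    assert (H3 := linearized_first_integral (ps K) psz (psc (r * r)) chi_rs (psc x)
                    (chi_ps_rec K r s Hrs)); cbv zeta in H3.
    assert (EP : (psc (r * r) + psc (r * r)) * der (psc x) + der (psc (r * r)) * psc x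
                 = psc (ham2 x)).
    { unfold ham2; rewrite psc_add, (psc_mul K (r * r + r * r)), (psc_mul K (der (r * r))), psc_add, !psc_der; reflexivity. }
    rewrite EP in H3.
    assert (EP1 : der (der (der (psc x))) = psc (ham1 x)) by (rewrite !psc_der; reflexivity).
    rewrite EP1 in H3. rewrite <- !(psc_der K x).
    set (q1 := psc (ham1 x)) in *; set (q2 := psc (ham2 x)) in *.
    set (y := der chi_rs * psc x - chi_rs * der (psc x)) in *.
    set (c := psc (r * r)) in *; set (f := chi_rs) in *.
    set (a := lin (ham1 x)) in *; set (b := lin (ham2 x)) in *.
    match goal with |- _ = ?rhs => transitivity
      ((q2 * f * f + (c + c) * f * b) - psz * (q1 * f * f + (c + c) * f * a)
       - ((q2 - psz * q1) * f * f + (c + c) * f * y)); [ring|] end.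
    rewrite H1, H2, H3; rewrite !der_sub, !der_mul, !der_add, !der_mul, !psz_der, !der0; ring. }
  apply (f_equal (fun f : ps K => f n)) in E.
  change (lin (ham2 x) n - (psz * lin (ham1 x)) n - ((der chi_rs * psc x) n - (chi_rs * psc (der x)) n)
          = 0) in E.
  rewrite psz_mul_at in E.
  assert (C : forall (f : ps K) a, (f * psc a) n = f n * a).
  { intros f a; replace (f * psc a) with (psc a * f) by ring; rewrite psc_mul_at; ring. }
  rewrite !C in E. change (der chi_rs n) with (der (chi_rs n)) in E.
  apply dsub_eq; rewrite <- E; ring.
Qed.

(** The derivative of [chi_rec] in the direction x. The last two terms come from varying the
    coefficients 2 S and S_x of P2. *)
Lemma lin_rec x n :
  ham2 (lin x n) = ps_shift (fun i => ham1 (lin x i)) n - chi_rs n * der x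
                 - (der (chi_rs n) + der (chi_rs n)) * x.
Proof.
  assert (H := chi_rec (dual K) _ _ (dual_rs x) n).
  rewrite dual_rr, chi_dual in H; apply (f_equal snd) in H.
  assert (E : snd (ps_shift (fun i => der (der (der (chi (dual K) (dual_r x) (dual_s x) i)))) n)
    = ps_shift (fun i => ham1 (lin x i)) n) by (destruct n; reflexivity).
  rewrite E in H; rewrite <- H; unfold ham2; simpl; ring.
Qed.

Lemma ham2_chi (n : nat) : ham2 (chi_rs n) = ps_shift (fun i => ham1 (chi_rs i)) n.
Proof. apply chi_rec, Hrs. Qed.

End Lin.

(** * Intertwining by the Hamiltonian pair *)

Section Intertwining.
Variable K : dring.
Variables r s : K.
Hypothesis Hrs : r * s = 1.
Add Ring Kring : (dring_th K).

Notation P1 := (ham1 K).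
Notation P2 := (ham2 K r).
Notation chi_rs := (chi K r s).
Notation lin_rs := (lin K r s).

Definition theta (x : K) : K := P1 x + P2 x.

Lemma ham1_shift (f : nat -> K) n : P1 (ps_shift f n) = ps_shift (fun i => P1 (f i)) n.
Proof. destruct n; [unfold ham1; simpl; rewrite !der0|]; reflexivity. Qed.

Lemma ham1_add x y : P1 (x + y) = P1 x + P1 y.
Proof. unfold ham1; rewrite !der_add; ring. Qed.

Lemma ham2_add x y : P2 (x + y) = P2 x + P2 y.
Proof. unfold ham2; rewrite !der_add; ring. Qed.

Lemma ham1_const a x : der a = 0 -> P1 (a * x) = a * P1 x.
Proof. intro H; unfold ham1; dsimp; rewrite H; dsimp; ring. Qed.

Lemma ham2_const a x : der a = 0 -> P2 (a * x) = a * P2 x.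
Proof. intro H; unfold ham2; dsimp; rewrite H; ring. Qed.

Lemma theta_add x y : theta (x + y) = theta x + theta y.
Proof. unfold theta; rewrite ham1_add, ham2_add; ring. Qed.

Lemma theta_const a x : der a = 0 -> theta (a * x) = a * theta x.
Proof. intro H; unfold theta; rewrite ham1_const, ham2_const by exact H; ring. Qed.

(* [Xf] is the derivative of [psi] with respect to S; the identity says that both
   Hamiltonian operators P1 and P2 intertwine the linearisation of the flow of [psi] with
   one and the same operator. *)
Definition intertwines (psi : K) (Xf : K -> K) : Prop :=
  forall f g, P2 g = P1 f ->
  P2 (der psi * g - psi * der g - Xf (theta g))
    - ((theta psi + theta psi) * der g + der (theta psi) * g)
  = P1 (der psi * f - psi * der f - Xf (theta f)).

(** [lin_pencil] expresses the linearisations in the directions P1 f and P2 f through those in the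
    directions P1 g and P2 g, because P1 f = P2 g. [lin_rec] then replaces P2 of a linearisation by
    P1 of the shifted one. What is left is an identity between differential polynomials in chi_n, g
    and S. *)
Lemma intertwines_chi n : intertwines (chi_rs n) (fun x => lin_rs x n).
Proof.
  intros f g H; cbv beta.
  assert (E : forall x, lin_rs (theta x) n = lin_rs (P1 x) n + lin_rs (P2 x) n)
    by (intro x; apply lin_add, Hrs).
  rewrite !E; clear E.
  assert (A1 := lin_rec K r s Hrs (P1 g) n); assert (A2 := lin_rec K r s Hrs (P2 g) n).
  assert (B1 := lin_pencil K r s Hrs f n); assert (B2 := lin_pencil K r s Hrs g n).
  rewrite <- ham1_shift in A1, A2. rewrite <- H in B1 |- *. rewrite B1, B2 in *.
  set (a := ps_shift (lin_rs (P1 g)) n) in *; set (b := ps_shift (lin_rs (P2 g)) n) in *.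
  set (p := chi_rs n) in *.
  rewrite <- B2 in A2 |- *.
  set (l2 := lin_rs (P2 g) n) in *; set (l1 := lin_rs (P1 g) n) in *.
  replace (der p * g - p * der g - (l1 + l2))
    with ((der p * g - p * der g) + (- (1) * l1) + (- (1) * l2)) by ring.
  rewrite !ham2_add, !ham2_const by (dsimp; ring).
  rewrite A1, A2, B2.
  (* The explicit terms in f cancel: f entered otherwise only through P1 f = P2 g. *)
  replace (P1 (der p * f - p * der f - _)) with
     (P1 (p * der g - der p * g) + - (1) * P1 a + - (1) * P1 b).
  2: { rewrite <- !ham1_const by (dsimp; ring); rewrite <- !ham1_add; f_equal; ring. }
  unfold theta, ham1, ham2; dsimp; ring.
Qed.

Lemma intertwines_comb p q X Y a b : der a = 0 -> der b = 0 ->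
  intertwines p X -> intertwines q Y ->
  intertwines (a * p - b * q) (fun x => a * X x - b * Y x).
Proof.
  intros Ha Hb HX HY f g H; specialize (HX f g H); specialize (HY f g H).
  assert (Hb' : der (- b) = 0) by (dsimp; rewrite Hb; ring).
  replace (a * p - b * q) with (a * p + - b * q) by ring.
  rewrite theta_add, !theta_const by assumption. dsimp. rewrite Ha, Hb.
  match goal with |- P2 ?x - _ = P1 ?y =>
    replace x with (a * (der p * g - p * der g - X (theta g))
                  + (- b) * (der q * g - q * der g - Y (theta g))) by ring;
    replace y with (a * (der p * f - p * der f - X (theta f))
                  + (- b) * (der q * f - q * der f - Y (theta f))) by ring end.
  rewrite ham1_add, ham2_add, !ham1_const, !ham2_const by assumption.
  rewrite <- HX, <- HY; ring.
Qed.

(* The j-th row starts with R^j applied to the coefficients of [chi], where the recursion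
   operator acts on a sequence f with P2 f_(i+1) = P1 f_i as c - k * (shift). *)
Fixpoint table (lam c k : K) (f : nat -> K) (j i : nat) : K :=
  match j with
  | O => lam * f i
  | Datatypes.S j' => c * table lam c k f j' i - k * table lam c k f j' (Datatypes.S i)
  end.

Section Table.
Variables lam c k : K.
Hypotheses (Hlam : der lam = 0) (Hc : der c = 0) (Hk : der k = 0).

Lemma table_pencil j i :
  P2 (table lam c k chi_rs j (Datatypes.S i)) = P1 (table lam c k chi_rs j i).
Proof.
  revert i; induction j as [|j IH]; intro i; simpl.
  - rewrite ham1_const, ham2_const by assumption; rewrite (ham2_chi K r s Hrs); reflexivity.
  - assert (E : forall x y : K, c * x - k * y = c * x + (- k) * y) by (intros; ring).
    assert (Hk' : der (- k) = 0) by (dsimp; rewrite Hk; ring).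
    rewrite !E, ham1_add, ham2_add, !ham1_const, !ham2_const, !IH by assumption; reflexivity.
Qed.

Lemma intertwines_table j i :
  intertwines (table lam c k chi_rs j i) (fun x => table lam c k (lin_rs x) j i).
Proof.
  revert i; induction j as [|j IH]; intro i.
  - assert (H := intertwines_comb _ _ _ _ lam 0 Hlam (der0 K)
      (intertwines_chi i) (intertwines_chi i)).
    intros f g E; specialize (H f g E); simpl; simpl in H.
    assert (Z : forall x y : K, lam * x - 0 * y = lam * x) by (intros; ring).
    rewrite !Z in H; exact H.
  - exact (intertwines_comb _ _ _ _ c k Hc Hk (IH i) (IH (Datatypes.S i))).
Qed.

End Table.

(* [Dt] is the derivation along a flow u_t = u_x psi; [flow_lin Dt psi Xf] is its
   linearisation conjugated by u_x. *)
Definition flow_lin (Dt : K -> K) (psi : K) (Xf : K -> K) (f : K) : K :=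
  Dt f + der psi * f - psi * der f - Xf (theta f).

(** Differentiating P2 g = P1 f along the flow varies also the coefficients of P2, by dS = theta
    psi. This defect is exactly the correction term in [intertwines]. *)
Lemma flow_lin_pencil (Dt : K -> K) psi Xf :
  (forall a b, Dt (a + b) = Dt a + Dt b) ->
  (forall a b, Dt (a * b) = Dt a * b + a * Dt b) ->
  (forall a, Dt (der a) = der (Dt a)) ->
  Dt (r * r) = theta psi -> intertwines psi Xf ->
  forall f g, P2 g = P1 f -> P2 (flow_lin Dt psi Xf g) = P1 (flow_lin Dt psi Xf f).
Proof.
  intros Ha Hm Hd HS HX f g E; specialize (HX f g E).
  assert (E' := f_equal Dt E).
  assert (D2 : Dt (P2 g) = P2 (Dt g) + (theta psi + theta psi) * der g + der (theta psi) * g).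
  { unfold ham2 at 1; rewrite Ha, !Hm, Ha, !Hd, HS; unfold ham2; ring. }
  assert (D1 : Dt (P1 f) = P1 (Dt f)) by (unfold ham1; rewrite !Hd; reflexivity).
  rewrite D1, D2 in E'.
  assert (F : forall x y z w : K, x + y - z - w = x + (y - z - w)) by (intros; ring).
  unfold flow_lin; rewrite !F, ham1_add, ham2_add, <- HX, <- E'; ring.
Qed.

End Intertwining.

(** * The recursion operator in terms of the Hamiltonian pair *)

Section RecursionOperator.
Variable K : dring.
Variables r s u1 v h lam c k kap : K.
Hypotheses (Hrs : r * s = 1) (Huv : u1 * v = 1) (Hu1 : der u1 = h * u1)
  (Hk : der k = 0) (Hc : der c = 0) (Hlam : der lam = 0)
  (Hkap : k * kap = lam) (Hkap0 : der kap = 0).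
Add Ring Kring : (dring_th K).

Lemma der_v : der v = - (h * v).
Proof.
  assert (E : der (u1 * v) = 0) by (rewrite Huv; apply der1).
  rewrite der_mul, Hu1 in E.
  transitivity (v * (h * u1 * v + u1 * der v) - (u1 * v) * (h * v)
                + (1 - u1 * v) * der v); [ring|].
  rewrite E, Huv; ring.
Qed.

Lemma der_r : der r = - (r * r * der s).
Proof.
  assert (E : der (r * s) = 0) by (rewrite Hrs; apply der1).
  rewrite der_mul in E.
  transitivity (r * (der r * s + r * der s) - r * r * der s + (1 - r * s) * der r); [ring|].
  rewrite E, Hrs; ring.
Qed.

(** The factorisation P2 = 2 r D r reduces inverting P2 to a single D^(-1), namely P2^(-1) = (1/2) s
    D^(-1) s. *)
Lemma ham2_rDr x : ham2 K r x = (r + r) * der (r * x).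
Proof. unfold ham2; dsimp; ring. Qed.

(** Integration by parts: s x_xxx = D (s x_xx - s_x x_x + s_xx x) - s_xxx x. Hence P2^(-1) P1 x is
    half of this expression minus (1/2) s D^(-1) (s_xxx x), and the last term is the origin of
    Lambda. *)
Definition local_part (x : K) : K :=
  s * s * der (der x) - s * der s * der x + s * der (der s) * x.

(* [n] stands for D_x^(-1) (Lambda m). *)
Definition rec_preimage (m n : K) : K := half * local_part (v * m) - kap * s * n.

Lemma rec_preimage_pencil m n :
  kap * der n = half * der (der (der s)) * (v * m) ->
  ham2 K r (rec_preimage m n) = ham1 K (v * m).
Proof.
  intro H; rewrite ham2_rDr.
  assert (E : r * rec_preimage m n = half * (s * der (der (v * m)) - der s * der (v * m)
     + der (der s) * (v * m)) - kap * n).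
  { unfold rec_preimage, local_part; set (x := v * m).
    transitivity ((r * s) * (half * (s * der (der x) - der s * der x + der (der s) * x) - kap * n));
      [ring | rewrite Hrs; ring]. }
  rewrite E; set (x := v * m) in *; clearbody x.
  dsimp; rewrite Hkap0.
  transitivity ((r + r) * (half * (s * der (der (der x)) + der (der (der s)) * x) - kap * der n));
    [ring|].
  rewrite H. unfold ham1.
  transitivity ((half + half) * (r * s) * der (der (der x))); [ring|].
  rewrite half_half, Hrs; ring.
Qed.

(** The local coefficients of R are those of c - k P2^(-1) P1 after conjugation by u1; each
    derivative of v contributes a factor -h, where h = u_xx / u_x. *)
Lemma rec_split g2 g1 g0 m n :
  g2 = - (k * half * s * s) ->
  g1 = k * half * ((h + h) * s * s + s * der s) ->
  g0 = c - k * half * (s * s * (h * h - der h) + s * der s * h + s * der (der s)) ->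
  g2 * der (der m) + g1 * der m + g0 * m + lam * u1 * s * n
  = u1 * (c * (v * m) - k * rec_preimage m n).
Proof.
  intros -> -> ->; unfold rec_preimage, local_part; rewrite <- Hkap.
  rewrite !der_mul, !der_v; dsimp; rewrite !der_v.
  match goal with |- ?a = ?b => transitivity ((u1 * v) * (a - k * kap * u1 * s * n)
     + k * kap * u1 * s * n) end.
  - rewrite Huv; ring.
  - ring.
Qed.

End RecursionOperator.

(** * Reduction modulo an ideal containing the derivative of s *)

Section Ideal.
Variable K : dring.
Variables r s : K.
Hypothesis Hrs : r * s = 1.
Variable J : K -> Prop.
Hypotheses (J0 : J 0) (Jadd : forall a b, J a -> J b -> J (a + b))
  (Jmul : forall a b, J b -> J (a * b)) (Jder : forall a, J a -> J (der a))
  (Js : J (der s)).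
Add Ring Kring : (dring_th K).
Add Ring Pring : (dring_th (ps K)).

Notation chi_rs := (chi K r s).
Notation lin_rs := (lin K r s).

Lemma Jopp a : J a -> J (- a).
Proof. intro H; replace (- a) with ((- (1)) * a) by ring; apply Jmul, H. Qed.

Lemma Jsub a b : J a -> J b -> J (a - b).
Proof. intros Ha Hb; replace (a - b) with (a + - b) by ring; apply Jadd, Jopp; assumption. Qed.

Lemma Jmul_l a b : J a -> J (a * b).
Proof. intro H; replace (a * b) with (b * a) by ring; apply Jmul, H. Qed.

Definition cong (a b : K) : Prop := J (a - b).

Lemma cong_refl a : cong a a.
Proof. unfold cong; replace (a - a) with (0 : K) by ring; exact J0. Qed.

Lemma cong_sym a b : cong a b -> cong b a.
Proof. unfold cong; intro H; replace (b - a) with (- (a - b)) by ring; apply Jopp, H. Qed.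

Lemma cong_trans a b c : cong a b -> cong b c -> cong a c.
Proof.
  unfold cong; intros H1 H2; replace (a - c) with ((a - b) + (b - c)) by ring; auto.
Qed.

Lemma cong_sub a b c d : cong a b -> cong c d -> cong (a - c) (b - d).
Proof.
  unfold cong; intros H1 H2; replace (a - c - (b - d)) with ((a - b) - (c - d)) by ring.
  apply Jsub; auto.
Qed.

Lemma cong_mul a b c : cong b c -> cong (a * b) (a * c).
Proof.
  unfold cong; intros H; replace (a * b - a * c) with (a * (b - c)) by ring; auto.
Qed.

Lemma cong_der a b : cong a b -> cong (der a) (der b).
Proof. unfold cong; intros H; rewrite <- der_sub; auto. Qed.

Lemma cong_der_mul a b : J (der a) -> cong (der (a * b)) (a * der b).
Proof.
  intro H; unfold cong; rewrite der_mul.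
  replace (der a * b + a * der b - a * der b) with (der a * b) by ring; apply Jmul_l, H.
Qed.

Definition PJ (f : ps K) : Prop := forall n, J (f n).

Lemma PJ_mul f g : PJ g -> PJ (f * g).
Proof.
  intros H n. change (J (conv f g n)). revert f; induction n as [|n IH]; intro f; simpl; auto.
Qed.

Lemma PJ_mul_l f g : PJ f -> PJ (f * g).
Proof. intro H; replace (f * g) with (g * f) by ring; apply PJ_mul, H. Qed.

Lemma PJ_add f g : PJ f -> PJ g -> PJ (f + g).
Proof. intros Hf Hg n; apply Jadd; auto. Qed.

Lemma PJ_sub f g : PJ f -> PJ g -> PJ (f - g).
Proof. intros Hf Hg n; apply Jsub; auto. Qed.

Lemma PJ_der f : PJ f -> PJ (der f).
Proof. intros Hf n; apply Jder, Hf. Qed.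

Lemma PJ_psc a : J a -> PJ (psc a).
Proof. intros H [|n]; simpl; auto. Qed.

(** With s constant modulo J, the constant series s already solves the first integral modulo J,
    because all differential terms drop out; the iteration then never leaves it. *)
Lemma chi_it_cong n : PJ (chi_it K r s n - psc s).
Proof.
  induction n as [|n IH].
  - intro n; simpl; replace (_ - _) with (0 : K) by ring; exact J0.
  - rewrite chi_it_succ; set (f := chi_it K r s n) in *.
    assert (Hf : PJ (der f)).
    { replace (der f) with (der (f - psc s) + psc (der s))
        by (rewrite der_sub, psc_der; ring).
      apply PJ_add; [apply PJ_der, IH | apply PJ_psc, Js]. }
    replace (_ - psc s) with ((f - psc s)
      + psc (half * s) * (1 - first_integral psz (psc (r * r)) f)) by ring.
    apply PJ_add; [exact IH|]; apply PJ_mul.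
    assert (E : psc (r * r) * psc s * psc s = (1 : ps K)).
    { rewrite <- !psc_mul, <- psc_one; f_equal.
      transitivity ((r * s) * (r * s)); [ring | rewrite Hrs; ring]. }
    unfold first_integral; rewrite <- E.
    replace (_ - _) with
      (psz * (f * der (der f) - half * (der f * der f))
       - psc (r * r) * (f + psc s) * (f - psc s)) by ring.
    apply PJ_sub; [|apply PJ_mul, IH]; apply PJ_mul, PJ_sub;
      repeat apply PJ_mul; auto using PJ_der.
Qed.

Lemma chi_cong : PJ (chi_rs - psc s).
Proof. intro n; exact (chi_it_cong n n). Qed.

Lemma chi_ideal n : J (chi_rs (S n)).
Proof.
  assert (H := chi_cong (S n)); simpl in H.
  replace (chi_rs (S n)) with (chi_rs (S n) - 0) by ring; exact H.
Qed.

Lemma lin_cong x : PJ (psc x * psc s * psc s + (psc r + psc r) * lin_rs x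
  - psz * (psc s * der (der (lin_rs x)))).
Proof.
  assert (C := chi_cong).
  set (j := chi_rs - psc s) in C.
  assert (Ec : chi_rs = psc s + j) by (unfold j; ring).
  assert (E := lin_eq K r s Hrs x); rewrite Ec in E.
  assert (Er : psc r = psc (r * r) * psc s).
  { rewrite <- psc_mul; f_equal; transitivity (r * (r * s)); [rewrite Hrs|]; ring. }
  set (Y := lin_rs x) in *; set (c := psc (r * r)) in *.
  assert (Hd : PJ (der (psc s + j))).
  { rewrite der_add; apply PJ_add; [rewrite psc_der; apply PJ_psc, Js | apply PJ_der, C]. }
  rewrite Er.
  match type of E with ?a = ?b => replace (_ - _) with
    (psz * (j * der (der Y) + der (der (psc s + j)) * Y - der (psc s + j) * der Y)
     - (psc x * (psc s + psc s + j) + (c + c) * Y) * j + (a - b)) by ring end.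
  rewrite E; apply PJ_add.
  - apply PJ_sub; [|apply PJ_mul, C]. apply PJ_mul, PJ_sub; [apply PJ_add|];
      apply PJ_mul_l; auto using PJ_der.
  - intro n; simpl; replace (_ - _) with (0 : K) by ring; exact J0.
Qed.

Lemma lin_cong_0 x : cong (lin_rs x O) (- (half * s * s * s * x)).
Proof.
  assert (H := lin_cong x O); simpl in H. unfold cong.
  generalize dependent (lin_rs x O); intros y H.
  match type of H with J ?a => replace (_ - _) with (half * s * a) end;
    [apply Jmul, H|].
  transitivity ((half + half) * (r * s) * y - - (half * s * s * s * x)); [ring|].
  rewrite half_half, Hrs; ring.
Qed.

Lemma lin_cong_succ x n : cong (lin_rs x (S n)) (half * s * s * der (der (lin_rs x n))).
Proof.
  assert (H := lin_cong x (S n)).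
  set (a := psc x * psc s * psc s) in H; set (b := (psc r + psc r) * lin_rs x) in H.
  set (d := psz * (psc s * der (der (lin_rs x)))) in H.
  change (J (a (S n) + b (S n) - d (S n))) in H.
  assert (Ea : a (S n) = 0).
  { unfold a; rewrite <- !psc_mul; reflexivity. }
  assert (Eb : b (S n) = (r + r) * lin_rs x (S n)).
  { unfold b; rewrite <- psc_add, psc_mul_at; reflexivity. }
  assert (Ed : d (S n) = s * der (der (lin_rs x n))).
  { unfold d; rewrite psz_mul_at; unfold ps_shift; rewrite psc_mul_at; reflexivity. }
  rewrite Ea, Eb, Ed in H. unfold cong; clear Ea Eb Ed a b d.
  generalize dependent (lin_rs x (S n)); intros y H; generalize dependent (lin_rs x n); intros w H.
  match type of H with J ?t => replace (_ - _) with (half * s * t) end;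
    [apply Jmul, H|].
  transitivity ((half + half) * (r * s) * y - half * s * s * der (der w)); [ring|].
  rewrite half_half, Hrs; ring.
Qed.

(** The properties used of a polynomial in D whose coefficients are constant modulo J. They are
    abstracted because the operators at hand are given only through [lin]. *)
Record constant_coef (Y : K -> K) : Prop := {
  cc_ideal : forall x, J x -> J (Y x);
  cc_add : forall x y, Y (x + y) = Y x + Y y;
  cc_der : forall x, cong (Y (der x)) (der (Y x));
  cc_mul : forall a x, J (der a) -> cong (Y (a * x)) (a * Y x) }.

Lemma constant_coef_lin n : constant_coef (fun x => lin_rs x n).
Proof.
  induction n as [|n [Hi Ha Hd Hm]]; split.
  - intros x Hx; assert (H := lin_cong_0 x); unfold cong in H.
    match type of H with J (?a - ?b) => replace a with ((a - b) + b) by ring end.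
    apply Jadd; [exact H | apply Jopp, Jmul, Hx].
  - intros; apply lin_add, Hrs.
  - intro x; eapply cong_trans; [apply lin_cong_0|].
    eapply cong_trans; [|apply cong_sym, cong_der, lin_cong_0].
    apply cong_sym; unfold cong; dsimp.
    match goal with |- J ?a => replace a with
      (- (half * (s * s + s * s + s * s) * x) * der s) by ring end.
    apply Jmul, Js.
  - intros a x H; eapply cong_trans; [apply lin_cong_0|].
    eapply cong_trans; [|apply cong_sym, cong_mul, lin_cong_0].
    match goal with |- cong ?a ?b => replace a with b by ring end; apply cong_refl.
  - intros x Hx; assert (H := lin_cong_succ x n); unfold cong in H.
    generalize dependent (lin_rs x (S n)); intros y H.
    match type of H with J (?a - ?b) => replace a with ((a - b) + b) by ring end.
    apply Jadd; [exact H | apply Jmul, Jder, Jder, Hi, Hx].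
  - intros; apply lin_add, Hrs.
  - intro x; eapply cong_trans; [apply lin_cong_succ|].
    eapply cong_trans; [|apply cong_sym, cong_der, lin_cong_succ].
    eapply cong_trans; [apply cong_mul, cong_der, cong_der, Hd|].
    apply cong_sym, cong_der_mul.
    dsimp; repeat first [ apply Jadd | apply Jmul, Js | apply Jmul_l, Jmul, Js | apply Jmul_l, Jadd];
      auto; try apply Jmul_l; auto.
  - intros a x H; eapply cong_trans; [apply lin_cong_succ|].
    eapply cong_trans; [|apply cong_sym, cong_mul, lin_cong_succ].
    eapply cong_trans; [apply cong_mul, cong_der, cong_der, Hm, H|].
    eapply cong_trans; [apply cong_mul, cong_der, cong_der_mul, H|].
    eapply cong_trans; [apply cong_mul, cong_der_mul, H|].
    match goal with |- cong ?a ?b => replace a with b by ring end; apply cong_refl.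
Qed.

Lemma constant_coef_comb X Y a b : J (der a) -> J (der b) ->
  constant_coef X -> constant_coef Y -> constant_coef (fun x => a * X x - b * Y x).
Proof.
  intros Ha Hb [Xi Xa Xd Xm] [Yi Ya Yd Ym]; split.
  - intros x Hx; apply Jsub; apply Jmul; auto.
  - intros; rewrite Xa, Ya; ring.
  - intro x; rewrite der_sub; apply cong_sub.
    + eapply cong_trans; [apply cong_mul, Xd | apply cong_sym, cong_der_mul, Ha].
    + eapply cong_trans; [apply cong_mul, Yd | apply cong_sym, cong_der_mul, Hb].
  - intros e x He; replace (e * (a * X x - b * Y x)) with (a * (e * X x) - b * (e * Y x)) by ring.
    apply cong_sub; apply cong_mul; auto.
Qed.

Lemma table_constant_coef lam c k : der lam = 0 -> der c = 0 -> der k = 0 ->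
  forall j i, constant_coef (fun x => table K lam c k (lin_rs x) j i).
Proof.
  intros Hlam Hc Hk j; assert (Z : forall a : K, der a = 0 -> J (der a)) by (intros a ->; exact J0).
  induction j as [|j IH]; intro i; simpl.
  - assert (H := constant_coef_comb _ _ lam 0 (Z _ Hlam) (Z _ (der0 K))
                   (constant_coef_lin i) (constant_coef_lin i)).
    assert (E : (fun x => lam * lin_rs x i - 0 * lin_rs x i) = fun x => lam * lin_rs x i)
      by (apply functional_extensionality; intro; ring).
    cbv beta in H; rewrite E in H; exact H.
  - exact (constant_coef_comb _ _ c k (Z _ Hc) (Z _ Hk) (IH i) (IH (S i))).
Qed.

Lemma table_ideal lam c k j i : J (table K lam c k chi_rs j (S i)).
Proof.
  revert i; induction j as [|j IH]; intro i; simpl.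
  - apply Jmul, chi_ideal.
  - apply Jsub; apply Jmul; apply IH.
Qed.

End Ideal.

(** * The ring of differential functions *)

Local Close Scope dring_scope.

Lemma diff_fun_ext F G : eq_dom F G -> diff_fun F -> diff_fun G.
Proof.
  intros E [HS [n HD]]; split.
  - apply smoothP; intro m; apply (smooth_upto_ext m F G E), smoothP, HS.
  - exists n; intros p q Hp Hq E1 E2 E3; rewrite <- !E by assumption; apply HD; auto.
Qed.

Lemma diff_fun_const c : diff_fun (fun _ => c).
Proof.
  split; [apply smoothP; intro; apply smooth_upto_const|].
  exists 0%nat; intros p q; reflexivity.
Qed.

Lemma diff_fun_plus F G : diff_fun F -> diff_fun G -> diff_fun (fun p => F p + G p).
Proof.
  intros [SF [n DF]] [SG [m DG]]; rewrite smoothP in SF, SG; split.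
  - apply smoothP; intro; apply smooth_upto_plus; auto.
  - exists (Nat.max n m); intros p q Hp Hq E1 E2 E3; f_equal;
      [apply DF | apply DG]; auto; intros; apply E3; lia.
Qed.

Lemma diff_fun_mult F G : diff_fun F -> diff_fun G -> diff_fun (fun p => F p * G p).
Proof.
  intros [SF [n DF]] [SG [m DG]]; rewrite smoothP in SF, SG; split.
  - apply smoothP; intro; apply smooth_upto_mult; auto.
  - exists (Nat.max n m); intros p q Hp Hq E1 E2 E3; f_equal;
      [apply DF | apply DG]; auto; intros; apply E3; lia.
Qed.

Lemma diff_fun_inv F : (forall p, dom p -> F p <> 0) -> diff_fun F -> diff_fun (fun p => / F p).
Proof.
  intros H0 [SF [n DF]]; rewrite smoothP in SF; split.
  - apply smoothP; intro; apply smooth_upto_inv; auto.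
  - exists n; intros p q Hp Hq E1 E2 E3; f_equal; apply DF; auto.
Qed.

Lemma diff_fun_sqrt F : (forall p, dom p -> 0 < F p) -> diff_fun F ->
  diff_fun (fun p => sqrt (F p)).
Proof.
  intros H0 [SF [n DF]]; rewrite smoothP in SF; split.
  - apply smoothP; intro; apply smooth_upto_sqrt; auto.
  - exists n; intros p q Hp Hq E1 E2 E3; f_equal; apply DF; auto.
Qed.

Lemma diff_fun_u k : diff_fun (u k).
Proof.
  split; [apply smoothP; intro; apply smooth_upto_coord|].
  exists k; intros p q Hp Hq E1 E2 E3; apply E3; lia.
Qed.

Lemma diff_fun_pd v F : diff_fun F -> diff_fun (pd v F).
Proof.
  intros [SF [n DF]]; split; [apply smooth_pd, SF | exists n; apply depends_pd, DF].
Qed.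

Lemma dom_dec p : {dom p} + {~ dom p}.
Proof.
  unfold dom; destruct (Req_EM_T (u 1 p) 0) as [E|N]; [right; tauto|].
  destruct (Rlt_dec 0 (Schw p)); [left | right]; tauto.
Qed.

(* Differential functions, normalised to 0 outside [dom] so that equality on [dom] is
   Leibniz equality. *)
Record dfun : Type := Dfun {
  val :> jet -> R;
  val_diff : diff_fun val;
  val_out : forall p, ~ dom p -> val p = 0 }.

Lemma dfun_eq (a b : dfun) : eq_dom a b -> a = b.
Proof.
  intro H; assert (E : val a = val b).
  { apply functional_extensionality; intro p; destruct (dom_dec p) as [Hp|Hp].
    - apply H, Hp.
    - rewrite !val_out by exact Hp; reflexivity. }
  destruct a as [F HF OF], b as [G HG OG]; simpl in E; subst G.
  f_equal; apply proof_irrelevance.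
Qed.

Definition restrict (F : jfun) : jfun := fun p => if dom_dec p then F p else 0.

Lemma restrict_in F : eq_dom F (restrict F).
Proof. intros p Hp; unfold restrict; destruct (dom_dec p); tauto. Qed.

Lemma restrict_out F p : ~ dom p -> restrict F p = 0.
Proof. intro Hp; unfold restrict; destruct (dom_dec p); tauto. Qed.

Definition mkdfun (F : jfun) (H : diff_fun F) : dfun :=
  Dfun (restrict F) (diff_fun_ext _ _ (restrict_in F) H) (restrict_out F).

Lemma mkdfun_val F H p : dom p -> mkdfun F H p = F p.
Proof. intro Hp; symmetry; apply restrict_in, Hp. Qed.

Definition Aconst (c : R) : dfun := mkdfun _ (diff_fun_const c).
Definition Aadd (a b : dfun) : dfun := mkdfun _ (diff_fun_plus _ _ (val_diff a) (val_diff b)).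
Definition Amul (a b : dfun) : dfun := mkdfun _ (diff_fun_mult _ _ (val_diff a) (val_diff b)).
Definition Aopp (a : dfun) : dfun := Amul (Aconst (-1)) a.
Definition Asub (a b : dfun) : dfun := Aadd a (Aopp b).
Definition Au (k : nat) : dfun := mkdfun _ (diff_fun_u k).
Definition Apd (v : jvar) (a : dfun) : dfun := mkdfun _ (diff_fun_pd v _ (val_diff a)).

Lemma Aconst_val c p : dom p -> Aconst c p = c.
Proof. apply mkdfun_val. Qed.
Lemma Aadd_val a b p : dom p -> Aadd a b p = a p + b p.
Proof. apply mkdfun_val. Qed.
Lemma Amul_val a b p : dom p -> Amul a b p = a p * b p.
Proof. apply mkdfun_val. Qed.
Lemma Aopp_val a p : dom p -> Aopp a p = - a p.
Proof. intro H; unfold Aopp; rewrite Amul_val, Aconst_val by exact H; ring. Qed.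
Lemma Asub_val a b p : dom p -> Asub a b p = a p - b p.
Proof. intro H; unfold Asub; rewrite Aadd_val, Aopp_val by exact H; ring. Qed.
Lemma Au_val k p : dom p -> Au k p = u k p.
Proof. apply mkdfun_val. Qed.
Lemma Apd_val v a p : dom p -> Apd v a p = pd v a p.
Proof. apply mkdfun_val. Qed.

Lemma A_ring_theory : ring_theory (Aconst 0) (Aconst 1) Aadd Amul Asub Aopp eq.
Proof.
  split; intros; apply dfun_eq; intros p Hp;
    rewrite ?Asub_val, ?Aopp_val, ?Aadd_val, ?Amul_val, ?Aadd_val, ?Amul_val, ?Aopp_val,
      ?Aconst_val by exact Hp; ring.
Qed.

Add Ring Aring : A_ring_theory.

Lemma dfun_ex_pd v (a : dfun) p : dom p -> ex_pd v a p.
Proof. intro Hp; exact (proj2 (proj1 (val_diff a) nil p Hp) v). Qed.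

Lemma Apd_add v a b : Apd v (Aadd a b) = Aadd (Apd v a) (Apd v b).
Proof.
  apply dfun_eq; intros p Hp; rewrite Aadd_val, !Apd_val by exact Hp.
  rewrite (pd_ext _ (fun q => a q + b q)) by (auto; intros q Hq; apply Aadd_val, Hq).
  apply pd_plus; apply dfun_ex_pd, Hp.
Qed.

Lemma Apd_mul v a b : Apd v (Amul a b) = Aadd (Amul (Apd v a) b) (Amul a (Apd v b)).
Proof.
  apply dfun_eq; intros p Hp; rewrite Aadd_val, !Amul_val, !Apd_val by exact Hp.
  rewrite (pd_ext _ (fun q => a q * b q)) by (auto; intros q Hq; apply Amul_val, Hq).
  apply pd_mult; apply dfun_ex_pd, Hp.
Qed.

Lemma Apd_const v c : Apd v (Aconst c) = Aconst 0.
Proof.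
  apply dfun_eq; intros p Hp; rewrite Apd_val, Aconst_val by exact Hp.
  rewrite (pd_ext _ (fun _ => c)) by (auto; intros q Hq; apply Aconst_val, Hq).
  apply pd_const.
Qed.

Lemma Apd_u v k : Apd v (Au k) = if jvar_eq_dec v (U k) then Aconst 1 else Aconst 0.
Proof.
  apply dfun_eq; intros p Hp; rewrite Apd_val by exact Hp.
  rewrite (pd_ext _ (u k)) by (auto; intros q Hq; apply Au_val, Hq).
  unfold u; rewrite pd_coord; destruct jvar_eq_dec; rewrite Aconst_val by exact Hp; reflexivity.
Qed.

Lemma Apd_comm v w a : Apd v (Apd w a) = Apd w (Apd v a).
Proof.
  apply dfun_eq; intros p Hp; rewrite !Apd_val by exact Hp.
  rewrite (pd_ext (Apd w a) (pd w a)) by (auto; intros q Hq; apply Apd_val, Hq).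
  rewrite (pd_ext (Apd v a) (pd v a)) by (auto; intros q Hq; apply Apd_val, Hq).
  apply pd_comm; [apply (val_diff a) | exact Hp].
Qed.

Lemma Apd_high n k a : depends_upto n (val a) -> (n < k)%nat -> Apd (U k) a = Aconst 0.
Proof.
  intros H L; apply dfun_eq; intros p Hp; rewrite Apd_val, Aconst_val by exact Hp.
  apply (depends_pd_high n); auto.
Qed.

Lemma depends_ext n F G : eq_dom F G -> depends_upto n F -> depends_upto n G.
Proof. intros E H p q Hp Hq E1 E2 E3; rewrite <- !E by assumption; apply H; auto. Qed.

(** A chosen bound rather than the exact order. [Ader_eq] and [frechet_eq] allow any other valid
    bound in its place. *)
Definition order (a : dfun) : nat :=
  proj1_sig (constructive_indefinite_description _ (proj2 (val_diff a))).

Lemma order_depends a : depends_upto (order a) a.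
Proof. unfold order; destruct constructive_indefinite_description; assumption. Qed.

Fixpoint Asum (n : nat) (f : nat -> dfun) : dfun :=
  match n with O => Aconst 0 | S m => Aadd (Asum m f) (f m) end.

Lemma Asum_ext n f g : (forall k, (k < n)%nat -> f k = g k) -> Asum n f = Asum n g.
Proof. intro H; induction n; simpl; f_equal; auto. Qed.

Lemma Asum_extend n m f : (n <= m)%nat -> (forall k, (n <= k)%nat -> f k = Aconst 0) ->
  Asum m f = Asum n f.
Proof.
  intros L H; induction L as [|m L IH]; [reflexivity|].
  simpl; rewrite IH, H by exact L; ring.
Qed.

Lemma Asum_add n f g : Asum n (fun k => Aadd (f k) (g k)) = Aadd (Asum n f) (Asum n g).
Proof. induction n as [|n IH]; simpl; [|rewrite IH]; ring. Qed.

Lemma Asum_mul n c f : Asum n (fun k => Amul c (f k)) = Amul c (Asum n f).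
Proof. induction n as [|n IH]; simpl; [|rewrite IH]; ring. Qed.

Lemma Apd_sum v n f : Apd v (Asum n f) = Asum n (fun k => Apd v (f k)).
Proof. induction n as [|n IH]; simpl; [apply Apd_const | rewrite Apd_add, IH; reflexivity]. Qed.

Lemma Asum_delta n (j : nat) (f : nat -> dfun) : (forall k, (n <= k)%nat -> f k = Aconst 0) ->
  Asum n (fun k => if Nat.eq_dec k j then f k else Aconst 0) = f j.
Proof.
  intro H.
  assert (E : forall m, Asum m (fun k => if Nat.eq_dec k j then f k else Aconst 0)
                = if lt_dec j m then f j else Aconst 0).
  { induction m as [|m IH]; simpl; [destruct (lt_dec j 0); [lia|reflexivity]|].
    rewrite IH; destruct (lt_dec j m), (Nat.eq_dec m j), (lt_dec j (S m)); try lia; subst; ring. }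
  rewrite E; destruct (lt_dec j n); [reflexivity | rewrite H by lia; reflexivity].
Qed.

Definition Ader_sum (n : nat) (a : dfun) : dfun :=
  Aadd (Apd X a) (Asum n (fun k => Amul (Au (k + 1)) (Apd (U k) a))).

Definition Ader (a : dfun) : dfun := Ader_sum (S (order a)) a.

Lemma Ader_eq n a : (forall k, (n <= k)%nat -> Apd (U k) a = Aconst 0) -> Ader a = Ader_sum n a.
Proof.
  intro H; unfold Ader, Ader_sum; f_equal.
  set (f := fun k => Amul (Au (k + 1)) (Apd (U k) a)).
  transitivity (Asum (Nat.max n (S (order a))) f).
  - symmetry; apply Asum_extend; [lia|]; intros k Hk; unfold f.
    rewrite (Apd_high (order a)) by (try apply order_depends; lia); ring.
  - apply Asum_extend; [lia|]; intros k Hk; unfold f; rewrite H by exact Hk; ring.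
Qed.

Lemma Apd_bounds a b : exists n, forall k, (n <= k)%nat ->
  Apd (U k) a = Aconst 0 /\ Apd (U k) b = Aconst 0.
Proof.
  exists (S (Nat.max (order a) (order b))); intros k Hk; split;
    [apply (Apd_high (order a)) | apply (Apd_high (order b))];
    try apply order_depends; lia.
Qed.

Lemma Ader_add a b : Ader (Aadd a b) = Aadd (Ader a) (Ader b).
Proof.
  destruct (Apd_bounds a b) as [n Hn].
  rewrite (Ader_eq n a), (Ader_eq n b), (Ader_eq n (Aadd a b)); try (intros; apply Hn; auto).
  - unfold Ader_sum; rewrite Apd_add.
    rewrite (Asum_ext n (fun k => Amul (Au (k + 1)) (Apd (U k) (Aadd a b)))
      (fun k => Aadd (Amul (Au (k + 1)) (Apd (U k) a)) (Amul (Au (k + 1)) (Apd (U k) b)))).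
    + rewrite Asum_add; ring.
    + intros; rewrite Apd_add; ring.
  - intros k Hk; rewrite Apd_add; destruct (Hn k Hk) as [-> ->]; ring.
Qed.

Lemma Ader_mul a b : Ader (Amul a b) = Aadd (Amul (Ader a) b) (Amul a (Ader b)).
Proof.
  destruct (Apd_bounds a b) as [n Hn].
  rewrite (Ader_eq n a), (Ader_eq n b), (Ader_eq n (Amul a b)); try (intros; apply Hn; auto).
  - unfold Ader_sum; rewrite Apd_mul.
    rewrite (Asum_ext n (fun k => Amul (Au (k + 1)) (Apd (U k) (Amul a b)))
      (fun k => Aadd (Amul b (Amul (Au (k + 1)) (Apd (U k) a)))
                     (Amul a (Amul (Au (k + 1)) (Apd (U k) b))))).
    + rewrite Asum_add, !Asum_mul; ring.
    + intros; rewrite Apd_mul; ring.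
  - intros k Hk; rewrite Apd_mul; destruct (Hn k Hk) as [-> ->]; ring.
Qed.

Definition A : dring.
Proof.
  refine (DRing dfun _ _ _ _ _ _ A_ring_theory (Aconst (/ 2)) _ Ader Ader_add Ader_mul).
  apply dfun_eq; intros p Hp; rewrite Aadd_val, !Aconst_val by exact Hp; field.
Defined.

Lemma Ader_const c : Ader (Aconst c) = Aconst 0.
Proof.
  rewrite (Ader_eq 0) by (intros; apply Apd_const).
  unfold Ader_sum; simpl; rewrite Apd_const; ring.
Qed.

Lemma Ader_u k : Ader (Au k) = Au (S k).
Proof.
  rewrite (Ader_eq (S k)).
  - unfold Ader_sum; rewrite Apd_u; destruct jvar_eq_dec as [E|_]; [discriminate|].
    rewrite (Asum_ext _ _ (fun i => if Nat.eq_dec i k then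
       (if lt_dec i (S k) then Au (i + 1) else Aconst 0) else Aconst 0)).
    + rewrite (Asum_delta _ k (fun i => if lt_dec i (S k) then Au (i + 1) else Aconst 0)).
      * destruct (lt_dec k (S k)); [|lia]. rewrite Nat.add_1_r; ring.
      * intros i Hi; destruct (lt_dec i (S k)); [lia|reflexivity].
    + intros i Hi; rewrite Apd_u; destruct (lt_dec i (S k)); [|lia].
      destruct (jvar_eq_dec (U i) (U k)), (Nat.eq_dec i k); try congruence; ring.
  - intros i Hi; rewrite Apd_u; destruct jvar_eq_dec as [E|_]; [|reflexivity].
    injection E; lia.
Qed.

(** The commutator of the partial derivative in [v] with D_x: it is the partial derivative in
    u_(k-1) when [v] is u_k with k > 0, and zero otherwise. *)
Definition Apd_pred (v : jvar) (a : dfun) : dfun :=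
  match v with U (S k) => Apd (U k) a | _ => Aconst 0 end.

Lemma Apd_Ader v a : Apd v (Ader a) = Aadd (Ader (Apd v a)) (Apd_pred v a).
Proof.
  destruct (Apd_bounds a (Apd v a)) as [n Hn].
  rewrite (Ader_eq n a), (Ader_eq n (Apd v a)); try (intros; apply Hn; auto).
  unfold Ader_sum; rewrite Apd_add, Apd_sum, (Apd_comm v X).
  rewrite (Asum_ext n _ (fun k => Aadd (Amul (Au (k + 1)) (Apd (U k) (Apd v a)))
     (Amul (Apd v (Au (k + 1))) (Apd (U k) a)))).
  2: { intros; rewrite Apd_mul, (Apd_comm v (U k)); ring. }
  rewrite Asum_add.
  assert (E : Asum n (fun k => Amul (Apd v (Au (k + 1))) (Apd (U k) a)) = Apd_pred v a).
  { assert (Z : (forall k, Apd v (Au (k + 1)) = Aconst 0) ->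
      Asum n (fun k => Amul (Apd v (Au (k + 1))) (Apd (U k) a)) = Aconst 0).
    { intro H0; rewrite (Asum_ext n _ (fun _ => Aconst 0)).
      - clear; induction n as [|n IH]; simpl; [|rewrite IH]; ring.
      - intros; rewrite H0; ring. }
    destruct v as [| |[|j]]; simpl.
    - apply Z; intro; rewrite Apd_u; destruct jvar_eq_dec; congruence.
    - apply Z; intro; rewrite Apd_u; destruct jvar_eq_dec; congruence.
    - apply Z; intro k; rewrite Apd_u; destruct jvar_eq_dec as [E|]; [injection E; lia|reflexivity].
    - rewrite <- (Asum_delta n j (fun k => Apd (U k) a)) by (intros; apply Hn; auto).
      apply Asum_ext; intros k Hk; rewrite Apd_u.
      destruct (jvar_eq_dec (U (S j)) (U (k + 1))) as [E|E], (Nat.eq_dec k j) as [E'|E'];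
        try ring; exfalso; [injection E; lia | apply E; f_equal; lia]. }
  rewrite E; ring.
Qed.

(** * From infinite series on the jet space to finite sums in the ring *)

Fixpoint rsum (n : nat) (f : nat -> R) : R :=
  match n with O => 0 | S m => rsum m f + f m end.

Lemma Series_finite n f : (forall k, (n <= k)%nat -> f k = 0) -> Series f = rsum n f.
Proof.
  intro H; unfold Series.
  rewrite (Lim_seq_ext_loc _ (fun _ => rsum n f)).
  - rewrite Lim_seq_const; reflexivity.
  - exists n; intros m Hm.
    assert (E : forall m, sum_n f m = rsum (S m) f).
    { induction m0 as [|j IH]; [rewrite sum_O; simpl; ring | rewrite sum_Sn, IH; reflexivity]. }
    rewrite E; assert (L : (n <= S m)%nat) by lia; clear E Hm.
    induction L as [|j L IH]; [reflexivity|]. simpl; rewrite IH, H by exact L; ring.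
Qed.

Lemma Asum_val n f p : dom p -> Asum n f p = rsum n (fun k => f k p).
Proof.
  intro Hp; induction n as [|n IH]; cbn [Asum rsum];
    rewrite ?Aadd_val, ?Aconst_val, ?IH by exact Hp; reflexivity.
Qed.

Lemma rsum_ext n f g : (forall k, (k < n)%nat -> f k = g k) -> rsum n f = rsum n g.
Proof. intro H; induction n; simpl; f_equal; auto. Qed.

Definition repr (F : jfun) (a : dfun) : Prop := eq_dom F a.

Lemma repr_pd v F a : repr F a -> repr (pd v F) (Apd v a).
Proof. intros H p Hp; rewrite Apd_val by exact Hp; apply pd_ext; auto. Qed.

Lemma repr_Dx F a : repr F a -> repr (Dx F) (Ader a).
Proof.
  intros H p Hp; unfold Dx, Ader, Ader_sum.
  rewrite Aadd_val, Asum_val by exact Hp; f_equal; [apply (repr_pd X F a H p Hp)|].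
  rewrite (Series_finite (S (order a))).
  - apply rsum_ext; intros k Hk; rewrite Amul_val, Au_val by exact Hp; f_equal.
    apply (repr_pd (U k) F a H p Hp).
  - intros k Hk; rewrite (repr_pd (U k) F a H p Hp).
    rewrite (Apd_high (order a)), Aconst_val by (auto using order_depends); ring.
Qed.

Fixpoint Adern (n : nat) (a : dfun) : dfun :=
  match n with O => a | S m => Ader (Adern m a) end.

Lemma repr_Dxn n F a : repr F a -> repr (Dxn n F) (Adern n a).
Proof. intro H; induction n as [|n IH]; [exact H | exact (repr_Dx _ _ IH)]. Qed.

Lemma diff_fun_repr F : diff_fun F -> exists a, repr F a.
Proof. intro H; exists (mkdfun F H); apply restrict_in. Qed.

Lemma repr_diff_fun F a : repr F a -> diff_fun F.
Proof.
  intro H; apply (diff_fun_ext a); [|apply val_diff].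
  intros p Hp; symmetry; apply H, Hp.
Qed.

(** * Frechet derivatives and the Schwarzian *)

Local Open Scope dring_scope.
Add Ring Adring : (dring_th A).

Definition pdA (v : jvar) (a : A) : A := Apd v a.

Definition uA (k : nat) : A := Au k.

Lemma pdA_add v (a b : A) : pdA v (a + b) = pdA v a + pdA v b.
Proof. apply Apd_add. Qed.

Lemma pdA_mul v (a b : A) : pdA v (a * b) = pdA v a * b + a * pdA v b.
Proof. apply Apd_mul. Qed.

Lemma pdA_const v c : pdA v (Aconst c) = 0.
Proof. apply Apd_const. Qed.

Lemma pdA_der v (a : A) : pdA v (der a) = der (pdA v a) + Apd_pred v a.
Proof. apply Apd_Ader. Qed.

Lemma pdA_opp v (a : A) : pdA v (- a) = - pdA v a.
Proof.
  transitivity (pdA v (- a + a) - pdA v a); [rewrite pdA_add; ring|].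
  replace (- a + a) with (0 : A) by ring.
  assert (H := pdA_const v (IZR 0)); change (pdA v (0 : A) = 0) in H; rewrite H; ring.
Qed.

Lemma pdA_sub v (a b : A) : pdA v (a - b) = pdA v a - pdA v b.
Proof.
  replace (a - b) with (a + - b) by ring; rewrite pdA_add, pdA_opp; ring.
Qed.

Lemma pdA_bounds (a b : A) : exists n, forall k, (n <= k)%nat ->
  pdA (U k) a = 0 /\ pdA (U k) b = 0.
Proof. apply Apd_bounds. Qed.

Section Frechet.
Variable E : dring.
Variable iota : dhom A E.
Add Ring Ering : (dring_th E).

Fixpoint dern (n : nat) (m : E) : E := match n with O => m | S k => der (dern k m) end.

Fixpoint dsum (n : nat) (f : nat -> E) : E :=
  match n with O => 0 | S m => dsum m f + f m end.

Lemma dsum_succ n f : dsum (S n) f = dsum n f + f n.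
Proof. reflexivity. Qed.

Lemma dsum_ext n f g : (forall k, (k < n)%nat -> f k = g k) -> dsum n f = dsum n g.
Proof. intro H; induction n; simpl; f_equal; auto. Qed.

Lemma dsum_extend n m f : (n <= m)%nat -> (forall k, (n <= k)%nat -> f k = 0) ->
  dsum m f = dsum n f.
Proof.
  intros L H; induction L as [|m L IH]; [reflexivity|].
  simpl; rewrite IH, H by exact L; ring.
Qed.

Lemma dsum_add n f g : dsum n (fun k => f k + g k) = dsum n f + dsum n g.
Proof. induction n as [|n IH]; simpl; [|rewrite IH]; ring. Qed.

Lemma dsum_mul n c f : dsum n (fun k => c * f k) = c * dsum n f.
Proof. induction n as [|n IH]; simpl; [|rewrite IH]; ring. Qed.

Lemma dsum_der n f : der (dsum n f) = dsum n (fun k => der (f k)).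
Proof. induction n as [|n IH]; simpl; [apply der0 | rewrite der_add, IH; reflexivity]. Qed.

Lemma dsum_shift n f : dsum (S n) f = f O + dsum n (fun k => f (S k)).
Proof.
  induction n as [|n IH]; [simpl; ring|].
  change (dsum (S (S n)) f) with (dsum (S n) f + f (S n)); rewrite IH; simpl; ring.
Qed.

Lemma dern_add k m n : dern k (m + n) = dern k m + dern k n.
Proof. induction k as [|k IH]; simpl; [|rewrite IH, der_add]; reflexivity. Qed.

(** The direction m lives in an arbitrary differential ring under A. Over A itself this is the usual
    Frechet derivative; for a pseudodifferential operator m it is the linearised operator composed
    with m. *)
Definition frechet_upto (n : nat) (a : A) (m : E) : E :=
  dsum n (fun k => iota (pdA (U k) a) * dern k m).

Definition frechet (a : A) (m : E) : E := frechet_upto (S (order a)) a m.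

Lemma frechet_eq n a m : (forall k, (n <= k)%nat -> pdA (U k) a = 0) ->
  frechet a m = frechet_upto n a m.
Proof.
  intro H; unfold frechet, frechet_upto.
  set (f := fun k => iota (pdA (U k) a) * dern k m).
  transitivity (dsum (Nat.max n (S (order a))) f).
  - symmetry; apply dsum_extend; [lia|]; intros k Hk; unfold f, pdA.
    rewrite (Apd_high (order a)) by (try apply order_depends; lia).
    change (Aconst 0) with (@dzero A); rewrite dmap_zero; ring.
  - apply dsum_extend; [lia|]; intros k Hk; unfold f; rewrite H by exact Hk.
    rewrite dmap_zero; ring.
Qed.

Lemma frechet_add a b m : frechet (a + b) m = frechet a m + frechet b m.
Proof.
  destruct (pdA_bounds a b) as [n Hn].
  rewrite (frechet_eq n a), (frechet_eq n b), (frechet_eq n (a + b)).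
  - unfold frechet_upto; rewrite <- dsum_add; apply dsum_ext; intros.
    rewrite pdA_add, dmap_add; ring.
  - intros k Hk; rewrite pdA_add; destruct (Hn k Hk) as [-> ->]; ring.
  - apply Hn.
  - apply Hn.
Qed.

Lemma frechet_mul a b m : frechet (a * b) m = frechet a m * iota b + iota a * frechet b m.
Proof.
  destruct (pdA_bounds a b) as [n Hn].
  rewrite (frechet_eq n a), (frechet_eq n b), (frechet_eq n (a * b)).
  - unfold frechet_upto.
    transitivity (iota b * dsum n (fun k => iota (pdA (U k) a) * dern k m)
                  + iota a * dsum n (fun k => iota (pdA (U k) b) * dern k m)); [|ring].
    rewrite <- !dsum_mul, <- dsum_add; apply dsum_ext; intros.
    rewrite pdA_mul, dmap_add, !dmap_mul; ring.
  - intros k Hk; rewrite pdA_mul; destruct (Hn k Hk) as [-> ->]; ring.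
  - apply Hn.
  - apply Hn.
Qed.

Lemma frechet_const c m : frechet (Aconst c) m = 0.
Proof. rewrite (frechet_eq 0) by (intros; apply pdA_const); reflexivity. Qed.

Lemma frechet_sub a b m : frechet (a - b) m = frechet a m - frechet b m.
Proof.
  transitivity (frechet (a - b) m + frechet b m - frechet b m); [ring|].
  rewrite <- frechet_add; f_equal; f_equal; ring.
Qed.

Lemma frechet_der a m : frechet (der a) m = der (frechet a m).
Proof.
  destruct (pdA_bounds a a) as [n Hn]. assert (Hz := fun k H => proj1 (Hn k H)); clear Hn.
  rewrite (frechet_eq n a m Hz), (frechet_eq (S n) (der a)).
  - unfold frechet_upto; rewrite dsum_der.
    transitivity (dsum (S n) (fun k => iota (der (pdA (U k) a)) * dern k m)
                  + dsum (S n) (fun k => iota (Apd_pred (U k) a) * dern k m)).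
    + rewrite <- dsum_add; apply dsum_ext; intros; rewrite pdA_der, dmap_add; ring.
    (* Each partial derivative in u_(k+1) of D_x a contributes the one in u_k of a, so shifting the
       index yields the half of the Leibniz rule in which D falls on m. The terms k = 0 here and k =
       n in the other sum vanish. *)
    + rewrite (dsum_shift n (fun k => iota (Apd_pred (U k) a) * dern k m)).
      cbn [Apd_pred dsum]. rewrite Hz, der0 by lia.
      change (Aconst (IZR 0)) with (@dzero A); rewrite !dmap_zero.
      transitivity (dsum n (fun k => iota (der (pdA (U k) a)) * dern k m)
                    + dsum n (fun k => iota (pdA (U k) a) * dern (S k) m));
        [unfold pdA; ring|].
      rewrite <- dsum_add; apply dsum_ext; intros.
      rewrite der_mul, dmap_der; reflexivity.
  - intros [|k] Hk; [lia|]; rewrite pdA_der, Hz by lia; rewrite der0.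
    change (Apd_pred (U (S k)) a) with (pdA (U k) a); rewrite Hz by lia; ring.
Qed.

Lemma frechet_u k m : frechet (uA k) m = dern k m.
Proof.
  rewrite (frechet_eq (S k)).
  - unfold frechet_upto; cbn [dsum].
    rewrite (dsum_ext k _ (fun _ => 0)).
    + assert (Z : dsum k (fun _ => 0) = 0) by (induction k as [|j IH]; simpl; [|rewrite IH]; ring).
      rewrite Z; unfold pdA, uA; rewrite Apd_u; destruct jvar_eq_dec; [|congruence].
      change (Aconst (IZR 1)) with (@done A); rewrite dmap_one; ring.
    + intros j Hj; unfold pdA, uA; rewrite Apd_u; destruct jvar_eq_dec as [e|_];
        [injection e; lia|].
      change (Aconst (IZR 0)) with (@dzero A); rewrite dmap_zero; ring.
  - intros j Hj; unfold pdA, uA; rewrite Apd_u; destruct jvar_eq_dec as [e|_];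
      [injection e; lia | reflexivity].
Qed.

Lemma frechet_add_r a m n : frechet a (m + n) = frechet a m + frechet a n.
Proof.
  unfold frechet, frechet_upto; rewrite <- dsum_add; apply dsum_ext; intros.
  rewrite dern_add; ring.
Qed.

(** Moving u by eps m is a homomorphism of differential rings, so that [chi_map] applies to it. *)
Definition frechet_hom (m : E) : dhom A (dual E).
Proof.
  refine (Dhom A (dual E) (fun a => (iota a, frechet a m)) _ _ _ _ _ _ _).
  - rewrite dmap_zero; change (@dzero A) with (Aconst 0); rewrite frechet_const; reflexivity.
  - rewrite dmap_one; change (@done A) with (Aconst 1); rewrite frechet_const; reflexivity.
  - intros a b; rewrite dmap_add, frechet_add; reflexivity.
  - intros a b; rewrite dmap_sub, frechet_sub; simpl; f_equal; ring.
  - intros a b; rewrite dmap_mul, frechet_mul; simpl; f_equal; ring.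
  - rewrite dmap_half; change (@half A) with (Aconst (/ 2)); rewrite frechet_const; reflexivity.
  - intro a; rewrite dmap_der, frechet_der; reflexivity.
Defined.

End Frechet.

Arguments dern {E}. Arguments dsum {E}. Arguments frechet {E}. Arguments frechet_upto {E}.

(** * The Schwarzian and its square root in the ring *)

Lemma u1_neq0 p : dom p -> (u 1 p <> 0)%R.
Proof. intros [H _]; exact H. Qed.

Lemma schw_pos p : dom p -> (0 < Schw p)%R.
Proof. intros [_ H]; exact H. Qed.

Lemma diff_fun_schw : diff_fun Schw.
Proof.
  apply (diff_fun_ext (fun p => u 3 p * / u 1 p + (- (3 / 2)) * (u 2 p * u 2 p * (/ u 1 p * / u 1 p)))%R).
  - intros p Hp; unfold Schw; field; apply u1_neq0, Hp.
  - assert (Hi := diff_fun_inv (u 1) u1_neq0 (diff_fun_u 1)).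
    exact (diff_fun_plus _ _ (diff_fun_mult _ _ (diff_fun_u 3) Hi)
      (diff_fun_mult _ _ (diff_fun_const _)
        (diff_fun_mult _ _ (diff_fun_mult _ _ (diff_fun_u 2) (diff_fun_u 2))
          (diff_fun_mult _ _ Hi Hi)))).
Qed.

Definition u1A : A := uA 1.
Definition vA : A := mkdfun _ (diff_fun_inv (u 1) u1_neq0 (diff_fun_u 1)).
Definition hA : A := uA 2 * vA.
Definition SA : A := mkdfun _ diff_fun_schw.
Definition rA : A := mkdfun _ (diff_fun_sqrt Schw schw_pos diff_fun_schw).

Lemma sqrt_schw_neq0 p : dom p -> (sqrt (Schw p) <> 0)%R.
Proof. intro H; apply Rgt_not_eq, sqrt_lt_R0, schw_pos, H. Qed.

Definition sA : A := mkdfun _ (diff_fun_inv _ sqrt_schw_neq0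
  (diff_fun_sqrt Schw schw_pos diff_fun_schw)).

Lemma u1A_val p : dom p -> u1A p = u 1 p.
Proof. apply mkdfun_val. Qed.
Lemma vA_val p : dom p -> vA p = (/ u 1 p)%R.
Proof. apply mkdfun_val. Qed.
Lemma SA_val p : dom p -> SA p = Schw p.
Proof. apply mkdfun_val. Qed.
Lemma rA_val p : dom p -> rA p = sqrt (Schw p).
Proof. apply mkdfun_val. Qed.
Lemma sA_val p : dom p -> sA p = (/ sqrt (Schw p))%R.
Proof. apply mkdfun_val. Qed.

Lemma val_add (a b : A) p : dom p -> val (a + b) p = (val a p + val b p)%R.
Proof. apply Aadd_val. Qed.
Lemma val_mul (a b : A) p : dom p -> val (a * b) p = (val a p * val b p)%R.
Proof. apply Amul_val. Qed.
Lemma val_sub (a b : A) p : dom p -> val (a - b) p = (val a p - val b p)%R.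
Proof. apply Asub_val. Qed.
Lemma val_opp (a : A) p : dom p -> val (- a) p = (- val a p)%R.
Proof. apply Aopp_val. Qed.
Lemma val_zero p : dom p -> val (0 : A) p = 0%R.
Proof. apply Aconst_val. Qed.
Lemma val_one p : dom p -> val (1 : A) p = 1%R.
Proof. apply Aconst_val. Qed.
Lemma val_half p : dom p -> val (half : A) p = (/ 2)%R.
Proof. apply Aconst_val. Qed.

Lemma u1A_vA : u1A * vA = 1.
Proof.
  apply dfun_eq; intros p Hp; rewrite val_mul, u1A_val, vA_val, val_one by exact Hp.
  field; apply u1_neq0, Hp.
Qed.

Lemma rA_sA : rA * sA = 1.
Proof.
  apply dfun_eq; intros p Hp; rewrite val_mul, rA_val, sA_val, val_one by exact Hp.
  field; apply sqrt_schw_neq0, Hp.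
Qed.

Lemma rA_rA : rA * rA = SA.
Proof.
  apply dfun_eq; intros p Hp; rewrite val_mul, rA_val, SA_val by exact Hp.
  apply sqrt_sqrt, Rlt_le, schw_pos, Hp.
Qed.

Lemma der_u k : der (uA k) = uA (S k).
Proof. apply Ader_u. Qed.

Lemma der_u1A : der u1A = hA * u1A.
Proof.
  unfold u1A at 1; rewrite der_u; unfold hA.
  transitivity (uA 2 * (u1A * vA)); [rewrite u1A_vA; ring | ring].
Qed.

Lemma der_const c : der (Aconst c : A) = 0.
Proof. apply Ader_const. Qed.

Lemma SA_riccati : SA = der hA - half * hA * hA.
Proof.
  unfold hA; rewrite der_mul, der_u, (der_v A u1A vA hA u1A_vA der_u1A); unfold hA.
  apply dfun_eq; intros p Hp.
  rewrite val_sub, val_add, !val_mul, val_half, val_opp, !val_mul, SA_val, vA_val by exact Hp.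
  change (val (uA 2) p) with (Au 2 p); change (val (uA 3) p) with (Au 3 p).
  rewrite !Au_val by exact Hp; unfold Schw; field; apply u1_neq0, Hp.
Qed.

Section FrechetFlow.
Variable E : dring.
Variable iota : dhom A E.
Add Ring Ering : (dring_th E).

Notation u1 := (iota u1A). Notation v := (iota vA). Notation h := (iota hA).
Notation r := (iota rA). Notation s := (iota sA).

Lemma iota_uv : u1 * v = 1.
Proof. rewrite <- dmap_mul, u1A_vA; apply dmap_one. Qed.

Lemma iota_rs : r * s = 1.
Proof. rewrite <- dmap_mul, rA_sA; apply dmap_one. Qed.

Lemma iota_u1 : der u1 = h * u1.
Proof. rewrite <- dmap_der, der_u1A, dmap_mul; reflexivity. Qed.

Lemma iota_riccati : r * r = der h - half * h * h.
Proof.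
  rewrite <- !dmap_mul, rA_rA, SA_riccati, dmap_sub, !dmap_mul, dmap_der, dmap_half; reflexivity.
Qed.

(** The infinitesimal cocycle property of the Schwarzian: the change of variable with vector field f
    moves S by f S_x + 2 f_x S + f_xxx. It is computed through h = u_xx / u_x, which moves by D (h f
    + f_x). *)
Lemma frechet_schwarzian f : frechet iota SA (u1 * f) = theta E r f.
Proof.
  set (m := u1 * f).
  assert (F1 : frechet iota u1A m = der m) by apply (frechet_u E iota 1).
  assert (F2 : frechet iota (uA 2) m = der (der m)) by apply (frechet_u E iota 2).
  assert (Fv : frechet iota vA m = - (v * v * der m)).
  { assert (H : frechet iota (u1A * vA) m = 0)
      by (rewrite u1A_vA; apply (frechet_const E iota (IZR 1))).
    rewrite frechet_mul, F1 in H.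
    transitivity (v * (der m * v + u1 * frechet iota vA m) - v * v * der m
                  + (1 - u1 * v) * frechet iota vA m); [ring|].
    rewrite H, iota_uv; ring. }
  assert (Fh : frechet iota hA m = der (h * f + der f)).
  { unfold hA at 1; rewrite frechet_mul, F2, Fv.
    assert (E2 : iota (uA 2) = h * u1).
    { rewrite <- iota_u1; unfold u1A; rewrite <- dmap_der, der_u; reflexivity. }
    rewrite E2; unfold m; dsimp; rewrite iota_u1; dsimp; rewrite iota_u1.
    transitivity ((u1 * v) * (der h * f + h * h * f + h * der f + h * der f + der (der f))
       - (u1 * v) * (u1 * v) * (h * (h * f + der f))); [ring|].
    rewrite iota_uv; ring. }
  rewrite SA_riccati, frechet_sub, frechet_der, !frechet_mul, Fh.
  change (@half A) with (Aconst (/ 2)); rewrite frechet_const.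
  change (Aconst (/ 2)) with (half : A). rewrite dmap_mul, dmap_half.
  unfold theta, ham1, ham2; rewrite iota_riccati; dsimp.
  set (h' := der h). set (h'' := der h').
  match goal with |- ?a = ?b => transitivity
    (b - (half + half - 1) * (h * der (der f))) end.
  - ring.
  - rewrite half_half; ring.
Qed.

Lemma frechet_rA m : frechet iota rA m = half * s * frechet iota SA m.
Proof.
  rewrite <- rA_rA, frechet_mul; set (x := frechet iota rA m).
  transitivity ((half + half) * (r * s) * x); [rewrite half_half, iota_rs|]; ring.
Qed.

Lemma frechet_sA m : frechet iota sA m = - (half * s * s * s * frechet iota SA m).
Proof.
  assert (H : frechet iota (rA * sA) m = 0)
    by (rewrite rA_sA; apply (frechet_const E iota (IZR 1))).
  rewrite frechet_mul, frechet_rA in H; set (x := frechet iota SA m) in *.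
  transitivity (s * (half * s * x * s + r * frechet iota sA m) - half * s * s * s * x
    + (1 - r * s) * frechet iota sA m); [ring | rewrite H, iota_rs; ring].
Qed.

(** The homomorphism that moves u by eps u_x f sends [rA] and [sA] to [dual_r] and [dual_s] in the
    direction theta f; naturality of [chi] does the rest. *)
Lemma frechet_chi n f :
  frechet iota (chi A rA sA n) (u1 * f) = lin E r s (theta E r f) n.
Proof.
  assert (Er : frechet_hom E iota (u1 * f) rA = dual_r E r s (theta E r f)).
  { unfold dual_r; rewrite <- frechet_schwarzian, <- frechet_rA; reflexivity. }
  assert (Es : frechet_hom E iota (u1 * f) sA = dual_s E s (theta E r f)).
  { unfold dual_s; rewrite <- frechet_schwarzian, <- frechet_sA; reflexivity. }
  assert (H := chi_map A (dual E) (frechet_hom E iota (u1 * f)) rA sA n).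
  rewrite Er, Es in H; exact (f_equal snd H).
Qed.

Lemma frechet_table (lam c k : R) j i f :
  frechet iota (table A (Aconst lam) (Aconst c) (Aconst k) (chi A rA sA) j i) (u1 * f)
  = table E (iota (Aconst lam)) (iota (Aconst c)) (iota (Aconst k))
      (lin E r s (theta E r f)) j i.
Proof.
  revert i; induction j as [|j IH]; intro i; simpl.
  - rewrite frechet_mul, frechet_const, frechet_chi; ring.
  - rewrite frechet_sub, !frechet_mul, !frechet_const, !IH; ring.
Qed.

Lemma iota_table (lam c k : A) j i :
  iota (table A lam c k (chi A rA sA) j i)
  = table E (iota lam) (iota c) (iota k) (chi E r s) j i.
Proof.
  revert i; induction j as [|j IH]; intro i; simpl.
  - rewrite dmap_mul, chi_map; reflexivity.
  - rewrite dmap_sub, !dmap_mul, !IH; reflexivity.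
Qed.

End FrechetFlow.

(** * Flows of the hierarchy *)

Definition idA : dhom A A.
Proof. refine (Dhom A A (fun a => a) _ _ _ _ _ _ _); reflexivity. Defined.

Definition ddt (w a : A) : A := pdA T a + frechet idA a w.

Lemma ddt_add w a b : ddt w (a + b) = ddt w a + ddt w b.
Proof. unfold ddt; rewrite pdA_add, frechet_add; ring. Qed.

Lemma ddt_mul w a b : ddt w (a * b) = ddt w a * b + a * ddt w b.
Proof. unfold ddt; rewrite pdA_mul, frechet_mul; simpl; ring. Qed.

Lemma ddt_der w a : ddt w (der a) = der (ddt w a).
Proof.
  unfold ddt; rewrite pdA_der, frechet_der, der_add; f_equal.
  change (Apd_pred T a) with (@dzero A); ring.
Qed.

Lemma ddt_const w c : ddt w (Aconst c) = 0.
Proof. unfold ddt; rewrite pdA_const, frechet_const; ring. Qed.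

Definition autonomous (a : A) : Prop := forall w, w = X \/ w = T -> pdA w a = 0.

Lemma autonomous_const e : autonomous (Aconst e).
Proof. intros w _; apply pdA_const. Qed.

Lemma autonomous_add a b : autonomous a -> autonomous b -> autonomous (a + b).
Proof. intros Ha Hb w Hw; rewrite pdA_add, Ha, Hb by exact Hw; ring. Qed.

Lemma autonomous_sub a b : autonomous a -> autonomous b -> autonomous (a - b).
Proof. intros Ha Hb w Hw; rewrite pdA_sub, Ha, Hb by exact Hw; ring. Qed.

Lemma autonomous_mul a b : autonomous a -> autonomous b -> autonomous (a * b).
Proof. intros Ha Hb w Hw; rewrite pdA_mul, Ha, Hb by exact Hw; ring. Qed.

Lemma autonomous_der a : autonomous a -> autonomous (der a).
Proof.
  intros Ha w Hw; rewrite pdA_der, Ha, der0 by exact Hw.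
  assert (E : Apd_pred w a = @dzero A) by (destruct Hw; subst; reflexivity).
  rewrite E; ring.
Qed.

Lemma autonomous_u k : autonomous (uA k).
Proof.
  intros w [->| ->]; unfold pdA, uA; rewrite Apd_u; destruct jvar_eq_dec;
    (discriminate || reflexivity).
Qed.

Lemma pdA_inv w a b : a * b = 1 -> pdA w b = - (b * b * pdA w a).
Proof.
  intro E; assert (F : pdA w (a * b) = 0) by (rewrite E; apply (pdA_const w (IZR 1))).
  rewrite pdA_mul in F.
  transitivity (b * (pdA w a * b + a * pdA w b) - b * b * pdA w a + (1 - a * b) * pdA w b);
    [ring | rewrite F, E; ring].
Qed.

Lemma autonomous_inv a b : a * b = 1 -> autonomous a -> autonomous b.
Proof. intros E Ha w Hw; rewrite (pdA_inv w a b E), Ha by exact Hw; ring. Qed.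

Lemma autonomous_hA : autonomous hA.
Proof.
  apply autonomous_mul; [apply autonomous_u|].
  exact (autonomous_inv _ _ u1A_vA (autonomous_u 1)).
Qed.

Lemma autonomous_SA : autonomous SA.
Proof.
  rewrite SA_riccati; apply autonomous_sub; [apply autonomous_der, autonomous_hA|].
  exact (autonomous_mul _ _ (autonomous_mul _ _ (autonomous_const (/ 2)) autonomous_hA) autonomous_hA).
Qed.

Lemma pdA_rA v : pdA v rA = half * sA * pdA v SA.
Proof.
  rewrite <- rA_rA, pdA_mul.
  transitivity ((half + half) * (rA * sA) * pdA v rA); [rewrite half_half, rA_sA|]; ring.
Qed.

Lemma autonomous_rA : autonomous rA.
Proof. intros w Hw; rewrite pdA_rA, autonomous_SA by exact Hw; ring. Qed.

Lemma autonomous_sA : autonomous sA.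
Proof. exact (autonomous_inv _ _ rA_sA autonomous_rA). Qed.

Lemma autonomous_chi n : autonomous (chi A rA sA n).
Proof.
  apply chi_closed; auto using autonomous_rA, autonomous_sA, autonomous_add, autonomous_sub,
    autonomous_mul, autonomous_der; apply autonomous_const.
Qed.

Section Hierarchy.
Variables lam c k : R.

Definition psiA (j i : nat) : A :=
  table A (Aconst lam) (Aconst c) (Aconst k) (chi A rA sA) j i.

Definition QA (j : nat) : A := u1A * psiA j 0.

Lemma psiA_closed (P : A -> Prop) : (forall a, P (Aconst a)) ->
  (forall a b, P a -> P b -> P (a - b)) -> (forall a b, P a -> P b -> P (a * b)) ->
  forall j i0, (forall i, (i0 <= i)%nat -> P (chi A rA sA i)) -> P (psiA j i0).
Proof.
  intros Hc Hs Hm; induction j as [|j IH]; intros i0 H; unfold psiA; simpl.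
  - apply Hm; auto.
  - apply Hs; apply Hm; auto; apply IH; intros; apply H; lia.
Qed.

Lemma autonomous_psiA j i : autonomous (psiA j i).
Proof.
  apply psiA_closed; auto using autonomous_const, autonomous_sub, autonomous_mul, autonomous_chi.
Qed.

Lemma autonomous_QA j : autonomous (QA j).
Proof. apply autonomous_mul; [apply autonomous_u | apply autonomous_psiA]. Qed.

Variable j : nat.
Variable E : dring.
Variable iota : dhom A E.
Variable Dt : E -> E.
Hypotheses (Dt_add : forall a b, Dt (a + b) = Dt a + Dt b)
  (Dt_mul : forall a b, Dt (a * b) = Dt a * b + a * Dt b)
  (Dt_der : forall a, Dt (der a) = der (Dt a))
  (Dt_iota : forall a, Dt (iota a) = iota (ddt (QA j) a)).
Add Ring Ering : (dring_th E).

Notation u1 := (iota u1A). Notation v := (iota vA). Notation h := (iota hA).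
Notation r := (iota rA). Notation s := (iota sA).
Notation psi := (iota (psiA j 0)).

Definition linearized (m : E) : E := Dt m - frechet iota (QA j) m.

Definition psi_lin (x : E) : E :=
  table E (iota (Aconst lam)) (iota (Aconst c)) (iota (Aconst k)) (lin E r s x) j 0.

Lemma iota_const_der a : der (iota (Aconst a)) = 0.
Proof. rewrite <- dmap_der, der_const; apply dmap_zero. Qed.

Lemma iota_theta x : iota (theta A rA x) = theta E r (iota x).
Proof.
  unfold theta, ham1, ham2.
  rewrite !dmap_add, !dmap_mul, !dmap_add, !dmap_der, !dmap_mul; reflexivity.
Qed.

Lemma ddt_SA : ddt (QA j) SA = theta A rA (psiA j 0).
Proof.
  unfold ddt; rewrite autonomous_SA by auto.
  assert (H : frechet idA SA (QA j) = theta A rA (psiA j 0))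
    by exact (frechet_schwarzian A idA (psiA j 0)).
  rewrite H; ring.
Qed.

Lemma Dt_rr : Dt (r * r) = theta E r psi.
Proof. rewrite <- dmap_mul, rA_rA, Dt_iota, ddt_SA; apply iota_theta. Qed.

Lemma Dt_u1 : Dt u1 = der (u1 * psi).
Proof.
  rewrite Dt_iota, <- dmap_mul, <- dmap_der; f_equal; unfold ddt.
  assert (H1 : pdA T u1A = 0) by (apply (autonomous_u 1); auto).
  assert (H2 : frechet idA u1A (QA j) = der (QA j)) by exact (frechet_u A idA 1 (QA j)).
  rewrite H1, H2; unfold QA; ring.
Qed.

(** Writing the direction as u_x f, the dependence of psi on u enters only through S, by theta f.
    This is what makes the intertwining property, a statement about S alone, applicable to the
    equation for u. *)
Lemma linearized_conj f :
  v * linearized (u1 * f) = flow_lin E r Dt psi psi_lin f.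
Proof.
  unfold linearized, flow_lin, QA at 1.
  assert (F : frechet iota (psiA j 0) (u1 * f) = psi_lin (theta E r f))
    by apply frechet_table.
  rewrite frechet_mul, Dt_mul, Dt_u1, F.
  assert (F1 : frechet iota u1A (u1 * f) = der (u1 * f)) by apply (frechet_u E iota 1).
  rewrite F1, !der_mul.
  transitivity ((u1 * v) * (Dt f + der psi * f - psi * der f - psi_lin (theta E r f))).
  - ring.
  - rewrite iota_uv; ring.
Qed.

(** The commutation of R with the linearised flow in inverse-free form. To get rid of P2, D has to
    be cancelled: operators have no kernel under D, while for functions the constant must be
    determined separately. *)
Lemma linearized_preimage kap m n : der kap = 0 ->
  kap * der n = half * der (der (der s)) * (v * m) ->
  ham2 E r (v * linearized (u1 * rec_preimage E s v kap m n)) = ham1 E (v * linearized m).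
Proof.
  intros Hkap H.
  assert (Em : m = u1 * (v * m)).
  { transitivity ((u1 * v) * m); [rewrite iota_uv|]; ring. }
  rewrite Em at 2; rewrite !linearized_conj.
  apply flow_lin_pencil; auto using Dt_rr.
  - assert (HI := intertwines_table E r s (iota_rs E iota) _ _ _ (iota_const_der lam)
      (iota_const_der c) (iota_const_der k) j 0).
    rewrite <- iota_table in HI; exact HI.
  - apply rec_preimage_pencil; auto using iota_rs.
Qed.

Lemma dern_mul_const n a m : der a = 0 -> dern n (a * m) = a * dern (E := E) n m.
Proof.
  intro H; induction n as [|n IH]; simpl; [reflexivity|].
  rewrite IH, der_mul, H; ring.
Qed.

Lemma frechet_scal a b m : der b = 0 -> frechet iota a (b * m) = b * frechet iota a m.
Proof.
  intro H; unfold frechet, frechet_upto; rewrite <- dsum_mul; apply dsum_ext; intros.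
  rewrite dern_mul_const by exact H; ring.
Qed.

Lemma linearized_comb a b m n :
  linearized (iota (Aconst a) * m - iota (Aconst b) * n)
  = iota (Aconst a) * linearized m - iota (Aconst b) * linearized n.
Proof.
  assert (Ec : forall e, Dt (iota (Aconst e)) = 0)
    by (intro e; rewrite Dt_iota, ddt_const; apply dmap_zero).
  replace (iota (Aconst a) * m - iota (Aconst b) * n)
    with (iota (Aconst a) * m + iota (Aconst b) * ((- (1)) * n)) by ring.
  unfold linearized; rewrite Dt_add, !Dt_mul, !Ec, frechet_add_r,
    !(frechet_scal _ _ _ (iota_const_der _)).
  rewrite frechet_scal by (dsimp; ring).
  assert (E1 : Dt (- (1)) = 0).
  { assert (Z := Ec (IZR 0)); change (Dt (iota (@dzero A)) = 0) in Z; rewrite dmap_zero in Z.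
    assert (O := Ec (IZR 1)); change (Dt (iota (@done A)) = 0) in O; rewrite dmap_one in O.
    transitivity (Dt (- (1)) + Dt 1); [rewrite O; ring|].
    rewrite <- Dt_add; transitivity (Dt 0); [f_equal; ring | exact Z]. }
  rewrite E1; ring.
Qed.

End Hierarchy.

(** * Stationary jets and integration constants *)

(** The algebraic counterpart of [depends_upto], stable under ring operations by the Leibniz rule.
    From m = 3 on it implies [depends_upto]. *)
Definition order_le (m : nat) (a : A) : Prop := forall i, (m < i)%nat -> pdA (U i) a = 0.

Lemma order_le_weaken m n a : (m <= n)%nat -> order_le m a -> order_le n a.
Proof. intros L H i Hi; apply H; lia. Qed.

Lemma order_le_order a : order_le (order a) a.
Proof. intros i Hi; exact (Apd_high (order a) i a (order_depends a) Hi). Qed.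

Lemma order_le_const m c : order_le m (Aconst c).
Proof. intros i _; apply pdA_const. Qed.

Lemma order_le_sub m a b : order_le m a -> order_le m b -> order_le m (a - b).
Proof. intros Ha Hb i Hi; rewrite pdA_sub, Ha, Hb by exact Hi; ring. Qed.

Lemma order_le_mul m a b : order_le m a -> order_le m b -> order_le m (a * b).
Proof. intros Ha Hb i Hi; rewrite pdA_mul, Ha, Hb by exact Hi; ring. Qed.

Lemma order_le_u m k : (k <= m)%nat -> order_le m (uA k).
Proof.
  intros L i Hi; unfold pdA, uA; rewrite Apd_u; destruct jvar_eq_dec as [E|]; [|reflexivity].
  injection E; lia.
Qed.

Lemma order_le_v m : (1 <= m)%nat -> order_le m vA.
Proof.
  intros L i Hi; rewrite (pdA_inv _ _ _ u1A_vA), (order_le_u 1 1) by lia; ring.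
Qed.

Lemma order_le_h : order_le 2 hA.
Proof. apply order_le_mul; [apply order_le_u | apply order_le_v]; lia. Qed.

Lemma pdA_der_succ i a : pdA (U (S i)) (der a) = der (pdA (U (S i)) a) + pdA (U i) a.
Proof. apply pdA_der. Qed.

Lemma order_le_der m a : order_le m a -> order_le (S m) (der a).
Proof.
  intros H [|i] Hi; [lia|]; rewrite pdA_der_succ, !H, der0 by lia; ring.
Qed.

Lemma lead_der m a : order_le m a -> pdA (U (S m)) (der a) = pdA (U m) a.
Proof. intro H; rewrite pdA_der_succ, H, der0 by lia; ring. Qed.

Lemma order_le_SA : order_le 3 SA.
Proof.
  assert (H := order_le_weaken 2 3 hA ltac:(lia) order_le_h).
  rewrite SA_riccati; apply order_le_sub; [apply order_le_der, order_le_h|].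
  exact (order_le_mul _ _ _ (order_le_mul _ _ _ (order_le_const 3 (/ 2)) H) H).
Qed.

Lemma order_le_step m a : pdA (U (S m)) a = 0 -> order_le (S m) a -> order_le m a.
Proof.
  intros H0 H i Hi; destruct (Nat.eq_dec i (S m)) as [->|N]; [exact H0 | apply H; lia].
Qed.

Lemma depends_order_le m (a : A) : (3 <= m)%nat -> order_le m a -> depends_upto m a.
Proof.
  intros L H.
  assert (F : forall d, depends_upto (m + d) a -> depends_upto m a).
  { induction d as [|d IH]; intro D; [rewrite Nat.add_0_r in D; exact D|].
    rewrite Nat.add_succ_r in D.
    apply IH, depends_lower; [lia | apply (val_diff a) | exact D |].
    intros p Hp; rewrite <- Apd_val by exact Hp.
    change (val (pdA (U (S (m + d))) a) p = 0%R); rewrite H by lia; apply val_zero, Hp. }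
  apply (F (order a)), (depends_le (order a)); [lia | apply order_depends].
Qed.

(** If W has order at most m + 1, the derivative of D W in u_(m+2) is that of W in u_(m+1); it
    vanishes, so the bound drops, down to 3. The kernel is larger than the real constants: it
    contains functions of t and of the sign of u_x. *)
Lemma der_kernel (W : A) : der W = 0 -> depends_upto 3 W.
Proof.
  intro H; apply depends_order_le; [lia|].
  assert (F : forall d, order_le (3 + d) W -> order_le 3 W).
  { induction d as [|d IH]; intro D; [exact D|]; apply IH, order_le_step; [|exact D].
    rewrite <- (lead_der (S (3 + d)) W D), H; apply (pdA_const _ (IZR 0)). }
  apply (F (order W)), (order_le_weaken (order W)); [lia | apply order_le_order].
Qed.

Lemma dern_succ (E : dring) n (a : E) : dern (S n) a = dern n (der a).
Proof. induction n as [|n IH]; [reflexivity|]. simpl in *; rewrite IH; reflexivity. Qed.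

Lemma Adern_dern n (a : A) : Adern n a = dern n a.
Proof. induction n as [|n IH]; simpl; [|rewrite IH]; reflexivity. Qed.

(* The jets at which the Schwarzian is stationary; the integration constants of D_x^(-1)
   are fixed there. *)
Definition stationary (p : jet) : Prop :=
  dom p /\ forall k, (1 <= k)%nat -> val (dern k SA) p = 0%R.

(** Vanishing together with all x-derivatives makes this a differential ideal. It contains S_x,
    hence the derivative of s, and serves as the ideal J of the reduction above. *)
Definition flat (a : A) : Prop := forall n p, stationary p -> val (dern n a) p = 0%R.

Lemma flat_zero : flat 0.
Proof.
  intros n p [Hp _].
  assert (E : dern n (@dzero A) = 0) by (induction n as [|n IH]; [|cbn [dern]; rewrite IH, der0]; reflexivity).
  rewrite E; apply val_zero, Hp.
Qed.

Lemma flat_add a b : flat a -> flat b -> flat (a + b).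
Proof.
  intros Ha Hb n p Hp; rewrite dern_add, val_add, Ha, Hb by (apply Hp || exact Hp).
  apply Rplus_0_r.
Qed.

Lemma flat_der a : flat a -> flat (der a).
Proof. intros Ha n p Hp; rewrite <- dern_succ; apply Ha, Hp. Qed.

Lemma flat_mul a b : flat b -> flat (a * b).
Proof.
  intros Hb n; revert a b Hb; induction n as [|n IH]; intros a b Hb p Hp.
  - change (val (a * b) p = 0%R); rewrite val_mul by apply Hp.
    assert (H0 : val b p = 0%R) by exact (Hb O p Hp); rewrite H0; apply Rmult_0_r.
  - rewrite dern_succ, der_mul, dern_add, val_add, !IH by auto using flat_der || apply Hp.
    apply Rplus_0_r.
Qed.

Lemma flat_der_SA : flat (der SA).
Proof. intros n p Hp; rewrite <- dern_succ; apply Hp; lia. Qed.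

Lemma der_sA : der sA = - (half * sA * sA * sA) * der SA.
Proof.
  rewrite <- rA_rA, der_mul, (der_r A rA sA rA_sA).
  transitivity ((half + half) * (rA * sA) * (rA * sA) * (rA * sA) * der sA);
    [rewrite half_half, rA_sA|]; ring.
Qed.

Lemma flat_der_sA : flat (der sA).
Proof. rewrite der_sA; apply flat_mul, flat_der_SA. Qed.

Lemma flat_der_rA : flat (der rA).
Proof.
  rewrite (der_r A rA sA rA_sA).
  replace (- (rA * rA * der sA)) with ((- (rA * rA)) * der sA) by ring.
  apply flat_mul, flat_der_sA.
Qed.

Lemma flat_sub a b : flat a -> flat b -> flat (a - b).
Proof. exact (Jsub A flat flat_add flat_mul a b). Qed.

Lemma flat_opp a : flat a -> flat (- a).
Proof. exact (Jopp A flat flat_mul a). Qed.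

Lemma flat_mul_l a b : flat a -> flat (a * b).
Proof. exact (Jmul_l A flat flat_mul a b). Qed.

Lemma flat_val a p : flat a -> stationary p -> val a p = 0%R.
Proof. intro H; exact (H O p). Qed.

Lemma flat_der_const c : flat (der (Aconst c : A)).
Proof. rewrite der_const; apply flat_zero. Qed.

Lemma flat_der_mul a b : flat (der a) -> flat (der b) -> flat (der (a * b)).
Proof. intros; rewrite der_mul; apply flat_add; [apply flat_mul_l | apply flat_mul]; auto. Qed.

Lemma flat_der_chi n : flat (der (chi A rA sA n)).
Proof.
  apply (chi_closed A rA sA (fun a => flat (der a))).
  - apply (flat_der_const 0).
  - apply (flat_der_const 1).
  - apply (flat_der_const (/ 2)).
  - apply flat_der_rA.
  - apply flat_der_sA.
  - intros; rewrite der_add; apply flat_add; auto.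
  - intros; rewrite der_sub; apply flat_sub; auto.
  - apply flat_der_mul.
  - intros; apply flat_der; auto.
Qed.

Lemma dern_mul_flat n a b : flat (der a) -> flat (dern n (a * b) - a * dern n b).
Proof.
  intro H; induction n as [|n IH].
  - change (flat (a * b - a * b)).
    replace (a * b - a * b) with (@dzero A) by ring; apply flat_zero.
  - change (flat (der (dern n (a * b)) - a * der (dern n b))).
    replace (der (dern n (a * b)) - a * der (dern n b))
      with (der (dern n (a * b) - a * dern n b) + der a * dern n b)
      by (rewrite der_sub, der_mul; ring).
    apply flat_add; [apply flat_der, IH | apply flat_mul_l, H].
Qed.

Lemma autonomous_dern n a : autonomous a -> autonomous (dern n a).
Proof. intro H; induction n as [|n IH]; [exact H | apply autonomous_der, IH]. Qed.

Lemma autonomous_shift (a : A) v p t : (v = X \/ v = T) -> autonomous a -> dom p ->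
  a (upd p v t) = a p.
Proof.
  intros Hv Ha Hp; apply constant_along.
  - apply (val_diff a).
  - intro x; apply dom_upd; auto; destruct Hv; subst; discriminate.
  - intros q Hq; rewrite <- Apd_val by exact Hq.
    change (val (pdA v a) q = 0%R); rewrite Ha by exact Hv; apply val_zero, Hq.
Qed.

(** S does not involve x or t, so translating a stationary jet in x or t gives stationary jets, and
    the function is zero along the whole line. *)
Lemma flat_pd v (a : A) p : (v = X \/ v = T) -> flat a -> stationary p -> val (pdA v a) p = 0%R.
Proof.
  intros Hv Ha [Hp HS]; unfold pdA; rewrite Apd_val by exact Hp.
  unfold pd; rewrite (Derive_ext _ (fun _ => 0%R)); [apply Derive_const|].
  intro t; apply (Ha O); split.
  - apply dom_upd; auto; destruct Hv; subst; discriminate.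
  - intros k Hk; rewrite (autonomous_shift (dern k SA) v p t Hv); auto.
    apply autonomous_dern, autonomous_SA.
Qed.

(* At stationary jets the flow of u1 * psi with psi constant along x is psi times the
   translation flow in x. *)
Lemma flat_ddt (a psi : A) p : flat a -> flat (der psi) -> stationary p ->
  val (ddt (u1A * psi) a) p = 0%R.
Proof.
  intros Ha Hpsi Hp; assert (Hd := proj1 Hp).
  unfold ddt; rewrite val_add by exact Hd.
  rewrite (flat_pd T a p) by auto.
  destruct (pdA_bounds a a) as [n Hn]; assert (Hz := fun k H => proj1 (Hn k H)); clear Hn.
  rewrite (frechet_eq A idA n a (u1A * psi) Hz).
  assert (D : der a = pdA X a + dsum n (fun k => uA (k + 1) * pdA (U k) a)).
  { exact (Ader_eq n a Hz). }
  (* Modulo flat functions psi commutes with D, so D^k (u_x psi) is psi u_(k+1). *)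
  assert (F : flat (frechet_upto idA n a (u1A * psi)
                    - psi * dsum n (fun k => uA (k + 1) * pdA (U k) a))).
  { unfold frechet_upto; clear D Hz; induction n as [|n IH]; cbn [dsum].
    - change (flat (0 - psi * 0)); replace (0 - psi * 0) with (@dzero A) by ring; apply flat_zero.
    - assert (E : dern n u1A = uA (n + 1)).
      { clear; induction n as [|n IH]; [reflexivity|]. cbn [dern]; rewrite IH; apply der_u. }
      set (x := dsum n (fun k => idA (pdA (U k) a) * dern k (u1A * psi))) in *.
      set (z := dsum n (fun k => uA (k + 1) * pdA (U k) a)) in *.
      change (flat (x + pdA (U n) a * dern n (u1A * psi)
                    - psi * (z + uA (n + 1) * pdA (U n) a))).
      replace (x + _ - _) with ((x - psi * z)
         + pdA (U n) a * (dern n (u1A * psi) - psi * uA (n + 1))) by ring.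
      apply flat_add; [exact IH|]; apply flat_mul.
      rewrite <- E; replace (u1A * psi) with (psi * u1A) by ring.
      apply dern_mul_flat, Hpsi. }
  apply flat_val with (p := p) in F; [|exact Hp].
  rewrite val_sub, val_mul in F by exact Hd.
  (* Both D_x a and its explicit x-derivative vanish at p, hence so does the remaining sum. *)
  assert (Z : val (dsum n (fun k => uA (k + 1) * pdA (U k) a)) p = 0%R).
  { assert (Z1 := Ha 1%nat p Hp); cbn [dern] in Z1; rewrite D, val_add in Z1 by exact Hd.
    rewrite (flat_pd X a p) in Z1 by auto.
    rewrite Rplus_0_l in Z1; exact Z1. }
  rewrite Z in F; rewrite Rplus_0_l; rewrite Rmult_0_r, Rminus_0_r in F; exact F.
Qed.

(** S_kx is u_(k+3) / u_x plus terms of order at most k + 2. The equation S_kx = 0 can therefore be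
    solved for u_(k+3). *)
Definition schw_rest (k : nat) : A := dern k SA - uA (k + 3) * vA.

Lemma schw_rest_order k : order_le (k + 2) (schw_rest k).
Proof.
  assert (Hv : der vA = - (uA 2 * vA * vA)).
  { rewrite (der_v A u1A vA hA u1A_vA der_u1A); reflexivity. }
  induction k as [|k IH]; unfold schw_rest.
  - assert (Hh := order_le_h).
    replace (dern 0 SA - uA (0 + 3) * vA) with (0 - hA * hA - half * hA * hA).
    + apply order_le_sub; [apply order_le_sub; [apply (order_le_const _ 0) |
        apply order_le_mul; exact Hh]|].
      exact (order_le_mul _ _ _ (order_le_mul _ _ _ (order_le_const 2 (/ 2)) Hh) Hh).
    + assert (Eh : der hA = uA 3 * vA + uA 2 * der vA)
        by (unfold hA; rewrite der_mul, der_u; reflexivity).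
      change (dern 0 SA) with SA; change (uA (0 + 3)) with (uA 3).
      rewrite SA_riccati, Eh, Hv; unfold hA; ring.
  - assert (V := order_le_v (S k + 2) ltac:(lia)).
    assert (U2 := order_le_u (S k + 2) 2 ltac:(lia)).
    replace (dern (S k) SA - uA (S k + 3) * vA)
      with (der (schw_rest k) - uA (k + 3) * (uA 2 * vA * vA)).
    + apply order_le_sub; [apply (order_le_der (k + 2)), IH|].
      apply order_le_mul; [apply order_le_u; lia|].
      exact (order_le_mul _ _ _ (order_le_mul _ _ _ U2 V) V).
    + unfold schw_rest; rewrite der_sub, der_mul, der_u, Hv; cbn [dern Nat.add]; ring.
Qed.

Section StationaryJet.
Variable q : jet.
Hypothesis Hq : dom q.

(** Step m chooses u_(m+4) so that the derivative of S of order m + 1 vanishes, and leaves the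
    coordinates up to u_(m+3) alone. The jet wanted is the coordinatewise limit [stat_jet]. *)
Fixpoint stat_approx (n : nat) : jet :=
  match n with
  | O => q
  | S m => upd (stat_approx m) (U (m + 4)) (- (val (schw_rest (m + 1)) (stat_approx m) * u 1 q))%R
  end.

Definition stat_jet : jet := fun v => match v with U k => stat_approx k v | _ => q v end.

Lemma stat_approx_dom n : dom (stat_approx n).
Proof.
  induction n as [|n IH]; simpl; [exact Hq|].
  apply dom_upd; auto; injection; lia.
Qed.

Lemma stat_approx_other n v : (forall k, (4 <= k)%nat -> v <> U k) -> stat_approx n v = q v.
Proof.
  intro H; induction n as [|n IH]; simpl; [reflexivity|].
  rewrite upd_other; [exact IH|]; intro E; apply (H (n + 4)%nat); [lia | auto].
Qed.

Lemma stat_approx_stable n m k : (k <= n + 3)%nat -> (n <= m)%nat ->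
  stat_approx m (U k) = stat_approx n (U k).
Proof.
  intros Hk L; induction L as [|m L IH]; [reflexivity|].
  simpl; rewrite upd_other; [exact IH | injection; lia].
Qed.

Lemma stat_jet_u n k : (k <= n + 3)%nat -> stat_jet (U k) = stat_approx n (U k).
Proof.
  intro Hk; unfold stat_jet; destruct (Nat.le_gt_cases n k).
  - apply stat_approx_stable; lia.
  - symmetry; apply stat_approx_stable; lia.
Qed.

Lemma stat_jet_base v : (forall k, (4 <= k)%nat -> v <> U k) -> stat_jet v = q v.
Proof.
  intro H; destruct v as [| |k]; try reflexivity; apply stat_approx_other, H.
Qed.

Lemma stat_jet_dom : dom stat_jet.
Proof.
  destruct Hq as [H1 H2]; unfold dom, Schw, u in *.
  rewrite !stat_jet_base by (intros k Hk; injection; lia); auto.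
Qed.

Lemma stat_jet_stationary : stationary stat_jet.
Proof.
  split; [apply stat_jet_dom|]; intros [|m] Hm; [lia|].
  assert (Hd := stat_jet_dom).
  replace (dern (S m) SA) with (uA (m + 4) * vA + schw_rest (m + 1)).
  2: { unfold schw_rest; replace (m + 1)%nat with (S m) by lia.
       replace (S m + 3)%nat with (m + 4)%nat by lia; ring. }
  rewrite val_add, val_mul, vA_val by exact Hd.
  change (val (uA (m + 4)) stat_jet) with (Au (m + 4) stat_jet).
  rewrite Au_val by exact Hd; unfold u.
  rewrite (stat_jet_u (S m) (m + 4)) by lia.
  cbn [stat_approx]; rewrite upd_same.
  rewrite (stat_jet_base (U 1)) by (intros k Hk; injection; lia).
  rewrite (depends_order_le (m + 1 + 2) _ ltac:(lia) (schw_rest_order (m + 1)) stat_jet (stat_approx m));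
    auto using stat_approx_dom.
  - unfold u; field; apply Hq.
  - symmetry; apply stat_approx_other; discriminate.
  - symmetry; apply stat_approx_other; discriminate.
  - intros k Hk; apply stat_jet_u; lia.
Qed.

End StationaryJet.

Lemma der_zero_stationary (W : A) : der W = 0 ->
  (forall p, stationary p -> val W p = 0%R) -> W = 0.
Proof.
  intros H HV; apply dfun_eq; intros p Hp.
  transitivity 0%R; [|symmetry; apply val_zero, Hp].
  rewrite <- (HV _ (stat_jet_stationary p Hp)).
  apply (der_kernel W H); auto using stat_jet_dom.
  intros k Hk; symmetry; apply stat_jet_base; intros i Hi; injection; lia.
Qed.

(** * Action on characteristics *)

Lemma Aconst_mul a b : (Aconst a : A) * Aconst b = Aconst (Rmult a b).
Proof.
  apply dfun_eq; intros p Hp; rewrite val_mul by exact Hp.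
  rewrite !Aconst_val by exact Hp; reflexivity.
Qed.

Section CharacteristicMap.
Variables lam c k : R.
Hypotheses (Hlam : lam <> 0%R) (Hk : k <> 0%R).
Variable j : nat.

Notation psi := (psiA lam c k j 0).
Notation Dt := (ddt (QA lam c k j)).
Notation LE := (linearized lam c k j A idA Dt).
Notation Y := (psi_lin lam c k j A idA).
Notation fcong := (cong A flat).
Notation fcc := (constant_coef A flat).

Definition kapA : A := Aconst (lam / k)%R.
Definition LambdaA : A := (Aconst (k / (2 * lam))%R : A) * (vA * der (der (der sA))).
Definition G2A : A := - ((Aconst k : A) * half * sA * sA).
Definition G1A : A := (Aconst k : A) * half * ((hA + hA) * sA * sA + sA * der sA).
Definition G0A : A := (Aconst c : A) - (Aconst k : A) * half *
  (sA * sA * (hA * hA - der hA) + sA * der sA * hA + sA * der (der sA)).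
Definition PhiA : A := (Aconst lam : A) * u1A * sA.

Lemma k_kap : (Aconst k : A) * kapA = Aconst lam.
Proof. unfold kapA; rewrite Aconst_mul; f_equal; field; exact Hk. Qed.

Lemma kap_Lambda : kapA * LambdaA = half * (vA * der (der (der sA))).
Proof.
  unfold kapA, LambdaA.
  transitivity (((Aconst (lam / k)%R : A) * Aconst (k / (2 * lam))%R) * (vA * der (der (der sA)))).
  - ring.
  - rewrite Aconst_mul; f_equal; change (@half A) with (Aconst (/ 2)); f_equal; field; auto.
Qed.

Lemma flat_der_psi : flat (der psi).
Proof.
  apply (psiA_closed lam c k (fun a => flat (der a))).
  - apply flat_der_const.
  - intros; rewrite der_sub; apply flat_sub; auto.
  - apply flat_der_mul.
  - intros; apply flat_der_chi.
Qed.

Lemma flat_theta_psi : flat (theta A rA psi).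
Proof.
  unfold theta, ham1, ham2; rewrite rA_rA.
  apply flat_add; [apply flat_der, flat_der, flat_der_psi|].
  apply flat_add; [apply flat_mul, flat_der_psi | apply flat_mul_l, flat_der_SA].
Qed.

(** S moves by theta psi, which is flat because both psi_x and S_x are. *)
Lemma flat_Dt_sA : flat (Dt sA).
Proof.
  assert (E : Dt SA = theta A rA psi) by apply ddt_SA.
  assert (Er : Dt SA = Dt rA * rA + rA * Dt rA) by (rewrite <- rA_rA; apply ddt_mul).
  assert (E1 : Dt rA * sA + rA * Dt sA = 0).
  { rewrite <- ddt_mul, rA_sA; apply (ddt_const _ (IZR 1)). }
  replace (Dt sA) with (- (half * sA * sA * sA) * Dt SA).
  - rewrite E; apply flat_mul, flat_theta_psi.
  - rewrite Er.
    transitivity (Dt sA - sA * (Dt rA * sA + rA * Dt sA)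
      - ((half + half) * (rA * sA) - 1) * (Dt rA * sA * sA) + (rA * sA - 1) * Dt sA);
      [ring|].
    rewrite E1, half_half, rA_sA; ring.
Qed.

Lemma constant_coef_compose F G : fcc F -> fcc G -> fcc (fun x => F (G x)).
Proof.
  intros [Fi Fa Fd Fm] [Gi Ga Gd Gm].
  assert (Fc : forall x y, fcong x y -> fcong (F x) (F y)).
  { intros x y H; unfold cong.
    replace x with (y + (x - y)) by ring; rewrite Fa.
    replace (F y + F (x - y) - F y) with (F (x - y)) by ring; apply Fi, H. }
  split.
  - intros x H; apply Fi, Gi, H.
  - intros x y; rewrite Ga, Fa; reflexivity.
  - intro x; apply (cong_trans A flat flat_add _ (F (der (G x)))); auto.
  - intros a x H; apply (cong_trans A flat flat_add _ (F (a * G x))); auto.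
Qed.

Lemma constant_coef_theta : fcc (theta A rA).
Proof.
  unfold theta, ham1, ham2; split; intros; unfold cong; rewrite ?rA_rA.
  - apply flat_add; [do 3 apply flat_der; assumption|].
    apply flat_add; [apply flat_mul, flat_der | apply flat_mul]; assumption.
  - dsimp; ring.
  - match goal with |- flat ?e => replace e with
      (- (((der x + der x) * der SA) + der (der SA) * x)) by (dsimp; ring) end.
    apply flat_opp, flat_add; [apply flat_mul | apply flat_mul_l, flat_der]; apply flat_der_SA.
  - match goal with |- flat ?e => replace e with
      (der (der a) * (der x + der x + der x)
       + der (der (der a)) * x + der a * (der (der x) + der (der x) + der (der x))
       + (SA + SA) * x * der a) by (dsimp; ring) end.
    repeat apply flat_add; try solve [apply flat_mul_l; auto using flat_der].
    apply flat_mul; assumption.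
Qed.

Lemma constant_coef_Y : fcc Y.
Proof.
  apply (table_constant_coef A rA sA rA_sA flat flat_zero flat_add flat_mul flat_der flat_der_sA);
    apply der_const.
Qed.

Definition flow_rest (x : A) : A := der psi * x - psi * der x - Y (theta A rA x).

Lemma constant_coef_flow_rest : fcc flow_rest.
Proof.
  assert (HY := constant_coef_compose _ _ constant_coef_Y constant_coef_theta).
  assert (H1 : flat (der (@done A))) by apply (flat_der_const 1).
  assert (H0 : fcc (fun x => 1 * (der psi * x - psi * der x) - 1 * Y (theta A rA x))).
  { apply (constant_coef_comb A flat flat_add flat_mul); auto; clear HY.
    assert (Hp := flat_der_psi); split; intros; unfold cong.
    - apply flat_sub; apply flat_mul; [|apply flat_der]; assumption.
    - dsimp; ring.
    - dsimp. replace (_ - _) with (der psi * der x - der (der psi) * x) by ring.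
      apply flat_sub; apply flat_mul_l; auto using flat_der.
    - dsimp. replace (_ - _) with (- (psi * x) * der a) by ring.
      apply flat_mul; assumption. }
  assert (E : flow_rest = fun x => 1 * (der psi * x - psi * der x) - 1 * Y (theta A rA x)).
  { apply functional_extensionality; intro x; unfold flow_rest; ring. }
  rewrite E; exact H0.
Qed.

Lemma LE_conj f : vA * LE (u1A * f) = Dt f + flow_rest f.
Proof.
  assert (H := linearized_conj lam c k j A idA Dt (ddt_mul _) (fun a => eq_refl) f).
  etransitivity; [exact H|]; unfold flow_lin, flow_rest; simpl; ring.
Qed.

(** Modulo flat functions s is constant and n drops out, so the preimage of f = v m is a D^2 f with
    a = s^2 / 2. D_t and [flow_rest] commute with a D^2 to this precision, and the result is a D^2
    applied to D_t f + flow_rest f = v LE m = 0. *)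
Lemma preimage_stationary m n p : flat n -> LE m = 0 -> stationary p ->
  val (vA * LE (u1A * rec_preimage A sA vA kapA m n)) p = 0%R.
Proof.
  intros Hn Hm Hp; assert (Hd := proj1 Hp).
  set (f := vA * m).
  assert (Hf : Dt f + flow_rest f = 0).
  { rewrite <- LE_conj; unfold f.
    replace (u1A * (vA * m)) with m; [rewrite Hm; ring|].
    transitivity ((u1A * vA) * m); [rewrite u1A_vA|]; ring. }
  rewrite LE_conj.
  set (g := rec_preimage A sA vA kapA m n).
  set (a := half * sA * sA).
  assert (Ha : flat (der a)).
  { unfold a; apply flat_der_mul; [apply flat_der_mul|]; try apply flat_der_sA.
    apply (flat_der_const (/ 2)). }
  assert (Hs := flat_der_sA).
  assert (G1 : fcong g (a * der (der f))).
  { unfold cong, g, rec_preimage, local_part; fold f.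
    match goal with |- flat ?e => replace e with
      (half * sA * (f * der (der sA) - der f * der sA) - kapA * sA * n)
      by (unfold a; ring) end.
    apply flat_sub; [|apply flat_mul, Hn]. apply flat_mul, flat_sub; apply flat_mul; auto using flat_der. }
  assert (G2 : fcong (flow_rest g) (a * der (der (flow_rest f)))).
  { destruct constant_coef_flow_rest as [Fi Fa Fd Fm].
    assert (Fc : forall x y, fcong x y -> fcong (flow_rest x) (flow_rest y)).
    { intros x y H; unfold cong.
      replace x with (y + (x - y)) by ring; rewrite Fa.
      replace (_ - _) with (flow_rest (x - y)) by ring; apply Fi, H. }
    eapply (cong_trans A flat flat_add); [apply Fc, G1|].
    eapply (cong_trans A flat flat_add); [apply Fm, Ha|].
    apply (cong_mul A flat flat_mul).
    eapply (cong_trans A flat flat_add); [apply Fd|].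
    apply (cong_der A flat flat_der), Fd. }
  assert (G3 : flat (Dt g - (a * der (der (Dt f)) - kapA * sA * Dt n))).
  { unfold g, rec_preimage, local_part; fold f.
    assert (Ec : forall e, Dt (Aconst e) = 0) by apply ddt_const.
    assert (Eh : Dt half = 0) by apply (Ec (/ 2)%R).
    assert (Ek : Dt kapA = 0) by apply Ec.
    assert (Esub : forall x y, Dt (x - y) = Dt x - Dt y).
    { intros x y. transitivity (Dt (x - y) + Dt y - Dt y); [ring|].
      rewrite <- ddt_add; f_equal; f_equal; ring. }
    assert (Eder : forall x, Dt (der x) = der (Dt x)) by apply ddt_der.
    rewrite Esub, !ddt_mul, ddt_add, Esub, !ddt_mul, !Eder, Eh, Ek.
    assert (Ht := flat_Dt_sA).
    match goal with |- flat ?e => replace e with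
      ((half * (sA + sA) * der (der f) + half * (der (der sA) * f - der sA * der f) - kapA * n) * Dt sA
       - half * sA * der f * der (Dt sA) + half * sA * f * der (der (Dt sA))
       + half * sA * (der (der sA) * Dt f - der sA * der (Dt f)))
      by (unfold a; ring) end.
    apply flat_add; [apply flat_add; [apply flat_sub|]; apply flat_mul; auto using flat_der|].
    apply flat_mul, flat_sub; apply flat_mul_l; auto using flat_der. }
  unfold cong in G2; assert (G4 := flat_add _ _ G2 G3).
  assert (G5 : flat (Dt g + flow_rest g + kapA * sA * Dt n)).
  { match type of G4 with flat ?e => replace (_ + _) with
      (e + a * der (der (Dt f + flow_rest f))) by (dsimp; ring) end.
    rewrite Hf, !der0; apply flat_add; [exact G4 | apply flat_mul, flat_zero]. }
  apply flat_val with (p := p) in G5; [|exact Hp].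
  (* The term with D_t n is the only one not absorbed into a flat function so far; its value at p is
     zero because at stationary jets the flow is a multiple of the translation in x. *)
  assert (Zn : val (Dt n) p = 0%R) by (apply flat_ddt; auto using flat_der_psi).
  rewrite (val_add _ (kapA * sA * Dt n)), (val_mul _ (Dt n)), Zn, Rmult_0_r, Rplus_0_r in G5 by exact Hd.
  exact G5.
Qed.

Lemma flat_Lambda : flat LambdaA.
Proof. do 2 apply flat_mul; do 2 apply flat_der; apply flat_der_sA. Qed.

(* [n] is D_x^(-1) (Lambda m), so that [m'] is R m. *)
Lemma characteristic_map (m n m' : A) : LE m = 0 -> der n = LambdaA * m ->
  (forall p, stationary p -> val n p = 0%R) ->
  m' = G2A * der (der m) + G1A * der m + G0A * m + PhiA * n -> LE m' = 0.
Proof.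
  intros Hm Hn Hv ->.
  (* The values of n at stationary jets vanish by the normalisation of D_x^(-1); its x-derivatives
     vanish there because Lambda contains the factor s_xxx. *)
  assert (Fn : flat n).
  { intros [|i] p Hp; [exact (Hv p Hp)|].
    rewrite dern_succ, Hn; apply flat_mul_l; auto using flat_Lambda. }
  unfold PhiA.
  rewrite (rec_split A sA u1A vA hA (Aconst lam) (Aconst c) (Aconst k) kapA
    u1A_vA der_u1A k_kap G2A G1A G0A m n eq_refl eq_refl eq_refl).
  set (g := rec_preimage A sA vA kapA m n).
  assert (Kn : kapA * der n = half * der (der (der sA)) * (vA * m)).
  { rewrite Hn; transitivity ((kapA * LambdaA) * m); [ring | rewrite kap_Lambda; ring]. }
  (* With LE m = 0 the pencil relation gives P2 W = 0 for W = v LE (u_x g), that is D (r W) = 0. The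
     function r W vanishes at stationary jets, so it is zero. *)
  assert (E : LE (u1A * g) = 0).
  { assert (H := linearized_preimage lam c k j A idA Dt (ddt_add _) (ddt_mul _) (ddt_der _)
      (fun a => eq_refl) kapA m n (der_const _) Kn).
    change (ham2 A rA (vA * LE (u1A * g)) = ham1 A (vA * LE m)) in H.
    rewrite Hm in H.
    assert (Z : ham1 A (vA * 0) = 0).
    { unfold ham1; replace (vA * 0) with (@dzero A) by ring; rewrite !der0; reflexivity. }
    rewrite Z, (ham2_rDr A rA) in H.
    set (W := vA * LE (u1A * g)) in *.
    assert (D : der (rA * W) = 0).
    { transitivity (half * sA * ((rA + rA) * der (rA * W))).
      - transitivity ((half + half) * (rA * sA) * der (rA * W));
          [rewrite half_half, rA_sA|]; ring.
      - rewrite H; ring. }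
    apply der_zero_stationary in D.
    - transitivity ((u1A * vA) * (rA * sA) * LE (u1A * g)); [rewrite u1A_vA, rA_sA; ring|].
      transitivity (u1A * sA * (rA * W)); [unfold W; ring | rewrite D; ring].
    - intros p Hp; rewrite val_mul by apply Hp.
      unfold W, g; rewrite preimage_stationary by auto; apply Rmult_0_r. }
  assert (C := linearized_comb lam c k j A idA Dt (ddt_add _) (ddt_mul _)
    (fun a => eq_refl) c k m (u1A * g)).
  change (LE ((Aconst c : A) * m - (Aconst k : A) * (u1A * g)) = (Aconst c : A) * LE m - (Aconst k : A) * LE (u1A * g)) in C.
  rewrite Hm, E in C.
  transitivity (LE ((Aconst c : A) * m - (Aconst k : A) * (u1A * g))).
  - f_equal. transitivity ((Aconst c : A) * ((u1A * vA) * m) - (Aconst k : A) * (u1A * g));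
      [ring | rewrite u1A_vA; ring].
  - rewrite C; ring.
Qed.

End CharacteristicMap.

(** * Formal pseudodifferential operators *)

Local Close Scope dring_scope.

(** The absorption identity for binomial coefficients, valid also for negative upper index; Pascal's
    rule is derived from it. *)
Lemma gbinom_absorb a k : gbinom (a + 1) (S k) * INR (S k) = (IZR a + 1) * gbinom a k.
Proof.
  assert (H : forall n, INR (S n) <> 0) by (intro; apply not_0_INR; lia).
  induction k as [|k IH].
  - simpl; rewrite plus_IZR; field.
  - change (gbinom (a + 1) (S (S k))) with
      (gbinom (a + 1) (S k) * (IZR (a + 1) - INR (S k)) / INR (S (S k))).
    change (gbinom a (S k)) with (gbinom a k * (IZR a - INR k) / INR (S k)).
    transitivity (gbinom (a + 1) (S k) * (IZR (a + 1) - INR (S k))); [field; apply H|].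
    replace (gbinom (a + 1) (S k)) with ((IZR a + 1) * gbinom a k / INR (S k))
      by (rewrite <- IH; field; apply H).
    rewrite plus_IZR, (S_INR k); field. rewrite <- S_INR; apply H.
Qed.

Lemma gbinom_pascal a k : gbinom (a + 1) (S k) = gbinom a (S k) + gbinom a k.
Proof.
  assert (H : INR (S k) <> 0) by (apply not_0_INR; lia).
  apply (Rmult_eq_reg_r (INR (S k))); [|exact H]. rewrite gbinom_absorb.
  change (gbinom a (S k)) with (gbinom a k * (IZR a - INR k) / INR (S k)).
  transitivity (gbinom a k * (IZR a - INR k) + gbinom a k * INR (S k)); [rewrite S_INR; ring|].
  field; exact H.
Qed.


Local Open Scope dring_scope.

Definition above (N : Z) (f : Z -> A) : Prop := forall n, (N < n)%Z -> f n = 0.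

Definition dcoef (a : Z) (l : nat) : A := Aconst (gbinom a l).

Lemma dcoef_0 a : dcoef a 0 = 1.
Proof. reflexivity. Qed.

Lemma dcoef_pascal a l : dcoef (a + 1) (S l) = dcoef a (S l) + dcoef a l.
Proof.
  apply dfun_eq; intros p Hp; rewrite val_add by exact Hp; unfold dcoef.
  rewrite !Aconst_val by exact Hp; apply gbinom_pascal.
Qed.

Lemma dern_zero l : dern l (@dzero A) = 0.
Proof. induction l as [|l IH]; [|cbn [dern]; rewrite IH, der0]; reflexivity. Qed.

Notation sumA := (@dsum A).

Lemma sumA_zero n f : (forall k, (k < n)%nat -> f k = 0) -> sumA n f = 0.
Proof.
  intro H; rewrite (dsum_ext A n f (fun _ => 0) H); clear H.
  induction n as [|n IH]; cbn [dsum]; [|rewrite IH; ring]; reflexivity.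
Qed.

(* The generalised Leibniz rule truncated to K terms in both indices; [N] bounds the
   degree of [f]. *)
Definition leibniz (N : Z) (K : nat) (f g : Z -> A) (n : Z) : A :=
  sumA K (fun i => sumA K (fun l =>
    dcoef (N - Z.of_nat i) l * f (N - Z.of_nat i)%Z
    * dern l (g (n - N + Z.of_nat i + Z.of_nat l)%Z))).

(** Terms with i + l > N + M - n involve coefficients of g above M, hence vanish. Beyond that point
    the truncation is immaterial. *)
Lemma leibniz_grow N M K f g n : above M g -> (N + M - n < Z.of_nat K)%Z ->
  leibniz N (S K) f g n = leibniz N K f g n.
Proof.
  intros Hg HK; unfold leibniz.
  assert (Z0 : forall i l, (K <= i \/ K <= l)%nat ->
    dcoef (N - Z.of_nat i) l * f (N - Z.of_nat i)%Z
      * dern l (g (n - N + Z.of_nat i + Z.of_nat l)%Z) = 0).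
  { intros i l Hil; rewrite Hg by lia; rewrite dern_zero; ring. }
  rewrite (dsum_succ A K).
  rewrite (sumA_zero (S K)) by (intros; apply Z0; lia).
  match goal with |- ?x + 0 = _ => transitivity x; [ring|] end.
  apply dsum_ext; intros i _; rewrite (dsum_succ A K), Z0 by lia; ring.
Qed.

Lemma leibniz_indep N M K K' f g n : above M g -> (N + M - n < Z.of_nat K)%Z -> (K <= K')%nat ->
  leibniz N K' f g n = leibniz N K f g n.
Proof.
  intros Hg HK L; induction L as [|K' L IH]; [reflexivity|].
  rewrite (leibniz_grow N M); [exact IH | exact Hg | lia].
Qed.

Lemma leibniz_shift N M K f g n : above M g -> (N + M - n < Z.of_nat K)%Z ->
  f (N + 1)%Z = 0 -> leibniz (N + 1) (S K) f g n = leibniz N K f g n.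
Proof.
  intros Hg HK Hf; rewrite <- (leibniz_grow N M K f g n Hg HK); unfold leibniz.
  rewrite (dsum_shift A K).
  rewrite (sumA_zero (S K)).
  2: { intros l _; replace (N + 1 - Z.of_nat 0)%Z with (N + 1)%Z by lia; rewrite Hf; ring. }
  rewrite (dsum_succ A K).
  rewrite (sumA_zero (S K) (fun l => dcoef (N - Z.of_nat K) l * f (N - Z.of_nat K)%Z
      * dern l (g (n - N + Z.of_nat K + Z.of_nat l)%Z)))
    by (intros l _; rewrite Hg by lia; rewrite dern_zero; ring).
  match goal with |- 0 + ?x = ?y + 0 => transitivity x; [ring|]; transitivity y; [|ring] end.
  apply dsum_ext; intros i _; apply dsum_ext; intros l _.
  replace (N + 1 - Z.of_nat (S i))%Z with (N - Z.of_nat i)%Z by lia.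
  replace (n - (N + 1) + Z.of_nat (S i) + Z.of_nat l)%Z
    with (n - N + Z.of_nat i + Z.of_nat l)%Z by lia; reflexivity.
Qed.

Definition zder (f : Z -> A) (n : Z) : A := der (f n) + f (n - 1)%Z.

(* D_x o (f o g) = (D_x o f) o g, by Pascal's rule. *)
Lemma leibniz_zder N M K f g n : above N f -> above M g -> (N + M - n + 1 < Z.of_nat K)%Z ->
  leibniz (N + 1) (S K) (zder f) g n
  = der (leibniz N K f g n) + leibniz N K f g (n - 1).
Proof.
  intros Hf Hg HK.
  set (f' := fun n => der (f n)).
  set (t := fun i l => dcoef (N - Z.of_nat i) l * f (N - Z.of_nat i)%Z
     * dern l (g (n - 1 - N + Z.of_nat i + Z.of_nat l)%Z)).
  set (w := fun i l => dcoef (N - Z.of_nat i) l * f (N - Z.of_nat i)%Z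
     * dern (S l) (g (n - N + Z.of_nat i + Z.of_nat l)%Z)).
  assert (P1 : leibniz (N + 1) (S K) f' g n = leibniz N K f' g n).
  { apply (leibniz_shift N M); auto; [lia|]. unfold f'; rewrite Hf by lia; apply der0. }
  assert (P2 : leibniz (N + 1) (S K) (zder f) g n
    = leibniz (N + 1) (S K) f' g n
      + sumA (S K) (fun i => sumA (S K) (fun l =>
          dcoef (N - Z.of_nat i + 1) l * f (N - Z.of_nat i)%Z
          * dern l (g (n - 1 - N + Z.of_nat i + Z.of_nat l)%Z)))).
  { unfold leibniz; rewrite <- dsum_add; apply dsum_ext; intros i _.
    rewrite <- dsum_add; apply dsum_ext; intros l _; unfold zder, f'.
    replace (N + 1 - Z.of_nat i - 1)%Z with (N - Z.of_nat i)%Z by lia.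
    replace (N - Z.of_nat i + 1)%Z with (N + 1 - Z.of_nat i)%Z by lia.
    replace (n - (N + 1) + Z.of_nat i + Z.of_nat l)%Z
      with (n - 1 - N + Z.of_nat i + Z.of_nat l)%Z by lia; ring. }
  (* Pascal's rule splits the sum: in [t] the extra D stays on the right as a power of D, in [w] it
     falls on the coefficient of g. *)
  assert (P3 : forall i, sumA (S K) (fun l =>
          dcoef (N - Z.of_nat i + 1) l * f (N - Z.of_nat i)%Z
          * dern l (g (n - 1 - N + Z.of_nat i + Z.of_nat l)%Z))
     = sumA (S K) (t i) + sumA K (w i)).
  { intro i; rewrite !(dsum_shift A K).
    transitivity (t i O + (sumA K (fun l => t i (S l)) + sumA K (w i))); [|ring].
    rewrite <- dsum_add; f_equal.
    apply dsum_ext; intros l _; rewrite dcoef_pascal; unfold t, w.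
    replace (n - 1 - N + Z.of_nat i + Z.of_nat (S l))%Z
      with (n - N + Z.of_nat i + Z.of_nat l)%Z by lia; ring. }
  assert (P4 : sumA (S K) (fun i => sumA (S K) (t i)) = leibniz N K f g (n - 1)).
  { rewrite <- (leibniz_grow N M K f g (n - 1) Hg) by lia; reflexivity. }
  assert (P5 : sumA (S K) (fun i => sumA K (w i)) = sumA K (fun i => sumA K (w i))).
  { rewrite (dsum_succ A K), (sumA_zero K (w K)); [ring|].
    intros l _; unfold w; rewrite Hg by lia; rewrite dern_zero; ring. }
  assert (P6 : der (leibniz N K f g n) = leibniz N K f' g n + sumA K (fun i => sumA K (w i))).
  { unfold leibniz; rewrite dsum_der, <- dsum_add; apply dsum_ext; intros i _.
    rewrite dsum_der, <- dsum_add; apply dsum_ext; intros l _; unfold w, f'.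
    rewrite !der_mul; cbn [dern].
    assert (E : der (dcoef (N - Z.of_nat i) l) = 0) by apply der_const.
    rewrite E; ring. }
  rewrite P2, P1, (dsum_ext A (S K) _ (fun i => sumA (S K) (t i) + sumA K (w i)))
    by (intros; apply P3).
  rewrite dsum_add, P4, P5, P6; ring.
Qed.

(** * Pseudodifferential operators as a left module *)

Record psm := Psm { pc :> Z -> A; pc_above : exists N, above N pc }.

Lemma psm_eq (f g : psm) : (forall n, f n = g n) -> f = g.
Proof.
  intro H; assert (E : pc f = pc g) by (apply functional_extensionality, H).
  destruct f as [f Hf], g as [g Hg]; simpl in E; subst g; f_equal; apply proof_irrelevance.
Qed.

Definition psm_zero : psm.
Proof. exists (fun _ => 0); exists 0%Z; intros n _; reflexivity. Defined.

Definition psm_add (f g : psm) : psm.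
Proof.
  exists (fun n => f n + g n); destruct (pc_above f) as [N HN], (pc_above g) as [M HM].
  exists (Z.max N M); intros n Hn; rewrite HN, HM by lia; ring.
Defined.

Definition psm_opp (f : psm) : psm.
Proof.
  exists (fun n => - f n); destruct (pc_above f) as [N HN].
  exists N; intros n Hn; rewrite HN by lia; ring.
Defined.

Definition psm_scal (a : A) (f : psm) : psm.
Proof.
  exists (fun n => a * f n); destruct (pc_above f) as [N HN].
  exists N; intros n Hn; rewrite HN by lia; ring.
Defined.

Lemma above_zder N f : above N f -> above (N + 1) (zder f).
Proof. intros H n Hn; unfold zder; rewrite !H by lia; rewrite der0; ring. Qed.

Definition psm_der (f : psm) : psm.
Proof.
  exists (zder f); destruct (pc_above f) as [N HN]; exists (N + 1)%Z; apply above_zder, HN.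
Defined.

(** Operators form a module under left multiplication by functions, and the derivation is left
    composition with D. Their noncommutative product stays outside, so the extension by this module
    is commutative and the abstract identities apply. *)
Definition psmod : dmodule A.
Proof.
  refine (DModule A psm psm_zero psm_add psm_opp psm_scal psm_der _ _ _ _ _ _ _ _ _ _ _ _);
    intros; apply psm_eq; intro i; cbn [pc psm_zero psm_add psm_opp psm_scal psm_der];
    unfold zder; cbn [pc psm_add psm_scal]; dsimp; ring.
Defined.

Definition bound (f : psm) : Z := proj1_sig (constructive_indefinite_description _ (pc_above f)).

Lemma bound_above f : above (bound f) f.
Proof. unfold bound; destruct constructive_indefinite_description; assumption. Qed.

Definition star_fun (f g : psm) (n : Z) : A :=
  leibniz (bound f) (Z.to_nat (bound f + bound g - n + 1)) f g n.

Lemma leibniz_top N N' M K K' f g n : above N f -> above M g -> (N <= N')%Z ->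
  (N + M - n < Z.of_nat K)%Z -> (N' + M - n < Z.of_nat K')%Z ->
  leibniz N' K' f g n = leibniz N K f g n.
Proof.
  intros Hf Hg L HK HK'.
  assert (F : forall d : nat, leibniz (N + Z.of_nat d) (K + d) f g n = leibniz N K f g n).
  { induction d as [|d IH].
    - replace (N + Z.of_nat 0)%Z with N by lia; replace (K + 0)%nat with K by lia; reflexivity.
    - replace (N + Z.of_nat (S d))%Z with (N + Z.of_nat d + 1)%Z by lia.
      replace (K + S d)%nat with (S (K + d)) by lia.
      rewrite (leibniz_shift (N + Z.of_nat d) M); auto; [lia|]. apply Hf; lia. }
  rewrite <- (F (Z.to_nat (N' - N))).
  replace (N + Z.of_nat (Z.to_nat (N' - N)))%Z with N' by lia.
  set (L1 := (K + Z.to_nat (N' - N))%nat).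
  rewrite <- (leibniz_indep N' M L1 (Nat.max L1 K')) by (auto; lia).
  symmetry; apply (leibniz_indep N' M); auto; lia.
Qed.

Lemma star_fun_eq (f g : psm) N M K n : above N f -> above M g ->
  (N + M - n < Z.of_nat K)%Z -> star_fun f g n = leibniz N K f g n.
Proof.
  intros Hf Hg HK; unfold star_fun.
  set (B := bound f); set (C := bound g).
  assert (HB : above B f) by apply bound_above; assert (HC : above C g) by apply bound_above.
  set (N' := Z.max N B).
  set (K' := Z.to_nat (N' + Z.max M C - n + 1)).
  assert (HM : above (Z.max M C) g) by (intros i Hi; apply Hg; lia).
  transitivity (leibniz N' K' f g n).
  - symmetry; apply (leibniz_top B N' C); auto; lia.
  - apply (leibniz_top N N' M); auto; lia.
Qed.

Definition star (f g : psm) : psm.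
Proof.
  exists (star_fun f g); exists (bound f + bound g)%Z; intros n Hn; unfold star_fun.
  replace (Z.to_nat (bound f + bound g - n + 1)) with O by lia; reflexivity.
Defined.

(** In place of associativity it is enough that composition with g on the right is linear over
    functions, commutes with composition by D on the left, and sends the identity to g. *)
Lemma star_add_l f1 f2 g : star (psm_add f1 f2) g = psm_add (star f1 g) (star f2 g).
Proof.
  apply psm_eq; intro n.
  change (star_fun (psm_add f1 f2) g n = star_fun f1 g n + star_fun f2 g n).
  set (N := Z.max (bound f1) (bound f2)).
  assert (H1 : above N f1) by (intros i Hi; apply (bound_above f1); lia).
  assert (H2 : above N f2) by (intros i Hi; apply (bound_above f2); lia).
  assert (H : above N (psm_add f1 f2)).
  { intros i Hi; cbn [pc psm_add]; rewrite H1, H2 by lia; ring. }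
  set (K := Z.to_nat (N + bound g - n + 1)).
  assert (Hg := bound_above g).
  rewrite !(star_fun_eq _ g N (bound g) K) by (auto; lia).
  unfold leibniz; rewrite <- dsum_add; apply dsum_ext; intros i _.
  rewrite <- dsum_add; apply dsum_ext; intros l _; cbn [pc psm_add]; ring.
Qed.

Lemma star_scal_l a f g : star (psm_scal a f) g = psm_scal a (star f g).
Proof.
  apply psm_eq; intro n.
  change (star_fun (psm_scal a f) g n = a * star_fun f g n).
  assert (Hf := bound_above f); assert (Hg := bound_above g).
  assert (H : above (bound f) (psm_scal a f)).
  { intros i Hi; cbn [pc psm_scal]; rewrite Hf by lia; ring. }
  set (K := Z.to_nat (bound f + bound g - n + 1)).
  rewrite !(star_fun_eq _ g (bound f) (bound g) K) by (auto; lia).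
  unfold leibniz; rewrite <- dsum_mul; apply dsum_ext; intros i _.
  rewrite <- dsum_mul; apply dsum_ext; intros l _; cbn [pc psm_scal]; ring.
Qed.

Lemma star_der f g : star (psm_der f) g = psm_der (star f g).
Proof.
  apply psm_eq; intro n.
  change (star_fun (psm_der f) g n = der (star_fun f g n) + star_fun f g (n - 1)).
  assert (Hf := bound_above f); assert (Hg := bound_above g).
  set (K := Z.to_nat (bound f + bound g - n + 2)).
  rewrite !(star_fun_eq f g (bound f) (bound g) K) by (auto; lia).
  rewrite (star_fun_eq (psm_der f) g (bound f + 1) (bound g) (S K))
    by (auto; try apply above_zder; auto; lia).
  apply (leibniz_zder (bound f) (bound g)); auto; lia.
Qed.

Definition monomial (i : Z) : psm.
Proof.
  exists (fun n => if Z.eq_dec n i then 1 else 0); exists i.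
  intros n Hn; destruct (Z.eq_dec n i); [lia | reflexivity].
Defined.

Lemma monomial_der i : psm_der (monomial i) = monomial (i + 1).
Proof.
  apply psm_eq; intro n; cbn [pc monomial psm_der]; unfold zder; cbn [pc monomial].
  destruct (Z.eq_dec n i), (Z.eq_dec (n - 1) i), (Z.eq_dec n (i + 1)); try lia;
    rewrite ?der0, ?der1; ring.
Qed.

Lemma star_one_l g : star (monomial 0) g = g.
Proof.
  apply psm_eq; intro n. change (star_fun (monomial 0) g n = g n).
  assert (H0 : above 0 (monomial 0)).
  { intros i Hi; simpl; destruct (Z.eq_dec i 0); [lia|reflexivity]. }
  set (K := Z.to_nat (bound g - n + 1)).
  rewrite (star_fun_eq _ g 0 (bound g) (S K)) by (auto using bound_above; lia).
  unfold leibniz; rewrite (dsum_shift A K), (dsum_shift A K).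
  rewrite (sumA_zero K), (sumA_zero K).
  - cbn [pc monomial]; destruct (Z.eq_dec (0 - Z.of_nat 0) 0); [|lia].
    rewrite dcoef_0; cbn [dern]. replace (n - 0 + Z.of_nat 0 + Z.of_nat 0)%Z with n by lia; ring.
  - intros k _; apply sumA_zero; intros l _; cbn [pc monomial].
    destruct (Z.eq_dec _ 0); [lia|ring].
  - intros l _. replace (0 - Z.of_nat 0)%Z with 0%Z by lia.
    assert (E : dcoef 0 (S l) = 0).
    { assert (G : forall m, gbinom 0 (S m) = 0%R).
      { induction m as [|m IH]; [simpl; field|].
        change (gbinom 0 (S m) * (IZR 0 - INR (S m)) / INR (S (S m)) = 0)%R.
        rewrite IH; unfold Rdiv; ring. }
      unfold dcoef; rewrite G; reflexivity. }
    rewrite E; ring.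
Qed.

(** The coefficient of index m + 1 of D f is the derivative of f_(m+1) plus f_m, so the coefficients
    vanish from the top downwards. Unlike for functions, there are no integration constants. *)
Lemma psm_der_injective f : psm_der f = psm_zero -> f = psm_zero.
Proof.
  intro H; apply psm_eq; intro n.
  destruct (pc_above f) as [N HN].
  assert (F : forall d : nat, forall m, (N - Z.of_nat d < m)%Z -> f m = 0).
  { induction d as [|d IH]; intros m Hm; [apply HN; lia|].
    assert (E := f_equal (fun g : psm => g (m + 1)%Z) H); cbn [pc psm_der psm_zero] in E; unfold zder in E.
    replace (m + 1 - 1)%Z with m in E by lia.
    rewrite (IH (m + 1)%Z) in E by lia. rewrite der0 in E.
    transitivity (@dzero A + f m); [ring | exact E]. }
  apply (F (Z.to_nat (N - n + 1))); lia.
Qed.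

(** * The commutator *)

Definition Epsm : dring := extension A psmod.
Add Ring Ering : (dring_th Epsm).

Lemma psm_add_zero (f : psm) : psm_add f psm_zero = f.
Proof. apply psm_eq; intro n; cbn [pc psm_add psm_zero]; ring. Qed.

Lemma psm_scal_zero a : psm_scal a psm_zero = psm_zero.
Proof. apply psm_eq; intro n; cbn [pc psm_scal psm_zero]; ring. Qed.

Lemma psm_der_zero : psm_der psm_zero = psm_zero.
Proof.
  apply psm_eq; intro n; cbn [pc psm_der]; unfold zder; cbn [pc psm_zero].
  rewrite der0; ring.
Qed.

Definition iotaE : dhom A Epsm.
Proof.
  refine (Dhom A Epsm (fun a => (a, psm_zero)) _ _ _ _ _ _ _); try reflexivity.
  - intros a b; simpl; f_equal; symmetry; apply psm_add_zero.
  - intros a b; simpl; f_equal; apply psm_eq; intro n.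
    cbn [pc psm_add psm_opp psm_zero]; ring.
  - intros a b; simpl; f_equal; rewrite !psm_scal_zero; symmetry; apply psm_add_zero.
  - intro a; simpl; f_equal; symmetry; apply psm_der_zero.
Defined.

Definition emb (f : psm) : Epsm := (@dzero A, f).

Lemma emb_add f g : emb f + emb g = emb (psm_add f g).
Proof. unfold emb; simpl; f_equal; apply (Radd_0_l (dring_th A)). Qed.

Lemma emb_scal a f : iotaE a * emb f = emb (psm_scal a f).
Proof.
  unfold emb; simpl; f_equal.
  - change (a * (@dzero A) = 0); ring.
  - apply psm_eq; intro n; cbn [pc psm_add psm_scal psm_zero]; ring.
Qed.

Lemma emb_der f : der (emb f) = emb (psm_der f).
Proof. unfold emb; simpl; f_equal; exact (der0 A). Qed.

(** Membership in the square-zero ideal, that is, being a pure operator; injectivity of [der] holds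
    only there. *)
Definition null (x : Epsm) : Prop := fst x = @dzero A.

Lemma null_of_emb f : null (emb f).
Proof. reflexivity. Qed.

Lemma null_emb x : null x -> x = emb (snd x).
Proof. destruct x as [a f]; unfold null; simpl; intros ->; reflexivity. Qed.

Lemma null_add x y : null x -> null y -> null (x + y).
Proof.
  unfold null; intros Hx Hy; change (fst x + fst y = @dzero A); rewrite Hx, Hy; ring.
Qed.

Lemma null_mul x y : null y -> null (x * y).
Proof.
  unfold null; intros Hy; change (fst x * fst y = @dzero A); rewrite Hy; ring.
Qed.

Lemma null_sub x y : null x -> null y -> null (x - y).
Proof.
  unfold null; intros Hx Hy; change (fst x - fst y = @dzero A); rewrite Hx, Hy; ring.
Qed.

Lemma null_der x : null x -> null (der x).
Proof. unfold null; intros Hx; change (der (fst x) = @dzero A); rewrite Hx; apply der0. Qed.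

Lemma null_frechet a x : null x -> null (frechet iotaE a x).
Proof.
  intro H; unfold frechet, frechet_upto; generalize (S (order a)); induction n as [|n IH].
  - reflexivity.
  - rewrite (dsum_succ Epsm n); apply null_add; [exact IH|]; apply null_mul.
    clear IH; induction n as [|n IH]; [exact H | apply null_der, IH].
Qed.

Lemma null_der_injective x : null x -> der x = 0 -> x = 0.
Proof.
  intros H E; rewrite (null_emb x H) in E |- *; rewrite emb_der in E.
  unfold emb in *; simpl in *; f_equal; apply psm_der_injective; congruence.
Qed.

Section Commutator.
Variables lam c k : R.
Hypotheses (Hlam : lam <> 0%R) (Hk : k <> 0%R).
Variable j : nat.
Notation Q := (QA lam c k j).

Definition psm_ddt (f : psm) : psm.
Proof.
  exists (fun n => ddt Q (f n)); destruct (pc_above f) as [N HN].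
  exists N; intros n Hn; rewrite HN by lia; apply (ddt_const Q (IZR 0)).
Defined.

Definition DtE (x : Epsm) : Epsm := (ddt Q (fst x), psm_ddt (snd x)).

Lemma DtE_add x y : DtE (x + y) = DtE x + DtE y.
Proof.
  unfold DtE; simpl; f_equal; [apply ddt_add|].
  apply psm_eq; intro n; apply ddt_add.
Qed.

Lemma DtE_mul x y : DtE (x * y) = DtE x * y + x * DtE y.
Proof.
  unfold DtE; simpl; f_equal; [apply ddt_mul|].
  apply psm_eq; intro n; cbn [pc psm_add psm_scal psm_ddt].
  rewrite ddt_add, !ddt_mul; ring.
Qed.

Lemma DtE_der x : DtE (der x) = der (DtE x).
Proof.
  unfold DtE; simpl; f_equal; [apply ddt_der|].
  apply psm_eq; intro n; cbn [pc psm_der psm_ddt]; unfold zder; cbn [pc psm_ddt].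
  rewrite ddt_add, ddt_der; ring.
Qed.

Lemma DtE_iota a : DtE (iotaE a) = iotaE (ddt Q a).
Proof.
  unfold DtE; simpl; f_equal; apply psm_eq; intro n; apply (ddt_const Q (IZR 0)).
Qed.

Notation LE := (linearized lam c k j Epsm iotaE DtE).
Notation v := (iotaE vA). Notation u1 := (iotaE u1A).
Notation r := (iotaE rA). Notation s := (iotaE sA). Notation kap := (iotaE (kapA lam k)).

Lemma null_LE x : null x -> null (LE x).
Proof.
  intro H; apply null_sub; [|apply null_frechet, H].
  unfold null in *; change (ddt Q (fst x) = @dzero A); rewrite H; apply (ddt_const Q (IZR 0)).
Qed.

Lemma null_preimage m n : null m -> null n -> null (rec_preimage Epsm s v kap m n).
Proof.
  intros Hm Hn; unfold rec_preimage, local_part.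
  apply null_sub; [|apply null_mul, Hn]; apply null_mul.
  apply null_add; [apply null_sub|];
    repeat first [ apply null_der, null_der, null_mul, Hm
                 | apply null_der, null_mul, Hm | exact Hm | apply null_mul ].
Qed.

Definition apply_R (x n : Epsm) : Epsm :=
  iotaE (G2A k) * der (der x) + iotaE (G1A k) * der x + iotaE (G0A c k) * x
  + iotaE (PhiA lam) * n.

Lemma apply_R_split x n : apply_R x n
  = iotaE (Aconst c) * x - iotaE (Aconst k) * (u1 * rec_preimage Epsm s v kap x n).
Proof.
  assert (Huv := iota_uv Epsm iotaE).
  assert (H := rec_split Epsm s u1 v (iotaE hA) (iotaE (Aconst lam)) (iotaE (Aconst c))
    (iotaE (Aconst k)) kap Huv (iota_u1 Epsm iotaE)).
  rewrite <- dmap_mul, (k_kap lam k Hk) in H.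
  specialize (H eq_refl (iotaE (G2A k)) (iotaE (G1A k)) (iotaE (G0A c k)) x n).
  unfold apply_R, PhiA; rewrite !dmap_mul, H.
  - transitivity (iotaE (Aconst c) * ((u1 * v) * x)
      - iotaE (Aconst k) * (u1 * rec_preimage Epsm s v kap x n)); [ring|].
    rewrite Huv; ring.
  - unfold G2A.
    transitivity (iotaE (0 - (Aconst k : A) * half * sA * sA)); [f_equal; ring|].
    rewrite dmap_sub, !dmap_mul, dmap_half, dmap_zero; ring.
  - unfold G1A. rewrite !dmap_mul, dmap_add, !dmap_mul, dmap_add, dmap_half, dmap_der; reflexivity.
  - unfold G0A.
    rewrite dmap_sub, !dmap_mul, !dmap_add, !dmap_mul, dmap_sub, !dmap_mul, dmap_half, !dmap_der.
    reflexivity.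
Qed.

Lemma kap_der x n : der n = iotaE (LambdaA lam k) * x ->
  kap * der n = half * der (der (der s)) * (v * x).
Proof.
  intro H; rewrite H.
  transitivity (iotaE (kapA lam k * LambdaA lam k) * x); [rewrite dmap_mul; ring|].
  rewrite (kap_Lambda lam k Hlam Hk), !dmap_mul, dmap_half, !dmap_der; ring.
Qed.

(* This is [LE, R] = 0, with n and n' standing for D_x^(-1) Lambda x and
   D_x^(-1) Lambda (LE x). *)
Lemma LE_apply_R x n n' : null x -> null n -> null n' ->
  der n = iotaE (LambdaA lam k) * x -> der n' = iotaE (LambdaA lam k) * LE x ->
  LE (apply_R x n) = apply_R (LE x) n'.
Proof.
  intros Hx Hn Hn' Dn Dn'.
  assert (Hkap : der kap = 0) by apply iota_const_der.
  rewrite !apply_R_split.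
  rewrite (linearized_comb lam c k j Epsm iotaE DtE DtE_add DtE_mul DtE_iota).
  set (g := rec_preimage Epsm s v kap x n).
  set (g' := rec_preimage Epsm s v kap (LE x) n').
  assert (E : LE (u1 * g) = u1 * g').
  { assert (H1 := linearized_preimage lam c k j Epsm iotaE DtE DtE_add DtE_mul DtE_der DtE_iota
      kap x n Hkap (kap_der x n Dn)).
    fold g in H1.
    assert (H2 := rec_preimage_pencil Epsm r s v kap (iota_rs Epsm iotaE) Hkap
      (LE x) n' (kap_der _ _ Dn')).
    fold g' in H2; rewrite <- H2 in H1; clear H2.
    (* Both terms have the same image under P2 = 2 r D r, and r and D are cancellable on
       operators. *)
    assert (Hd : v * LE (u1 * g) - g' = 0).
    { set (y := v * LE (u1 * g) - g').
      assert (Ny : null y).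
      { unfold y; apply null_sub; [apply null_mul, null_LE, null_mul |];
          apply null_preimage; auto using null_LE. }
      assert (P : ham2 Epsm r y = 0).
      { unfold y; replace (v * LE (u1 * g) - g') with (v * LE (u1 * g) + (- (1)) * g') by ring.
        rewrite ham2_add, (ham2_const Epsm r (- (1)) g'), H1 by apply der_minus_one. ring. }
      rewrite ham2_rDr in P.
      assert (Rs := iota_rs Epsm iotaE).
      assert (Z : r * y = 0).
      { apply null_der_injective; [apply null_mul, Ny|].
        transitivity (half * s * ((r + r) * der (r * y))).
        - transitivity ((half + half) * (r * s) * der (r * y)); [rewrite half_half, Rs|]; ring.
        - rewrite P; ring. }
      transitivity ((r * s) * y); [rewrite Rs; ring|].
      transitivity (s * (r * y)); [ring | rewrite Z; ring]. }
    transitivity ((u1 * v) * LE (u1 * g)); [rewrite (iota_uv Epsm iotaE); ring|].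
    transitivity (u1 * (v * LE (u1 * g) - g') + u1 * g'); [ring | rewrite Hd; ring]. }
  rewrite E; reflexivity.
Qed.

Fixpoint psm_sum (n : nat) (f : nat -> psm) : psm :=
  match n with O => psm_zero | S m => psm_add (psm_sum m f) (f m) end.

Definition Fpsm (q : nat) : psm :=
  psm_sum (S q) (fun i => psm_scal (pdA (U i) Q) (monomial (Z.of_nat i))).

Lemma star_zero_l g : star psm_zero g = psm_zero.
Proof.
  assert (E : psm_zero = psm_scal 0 psm_zero) by (symmetry; apply psm_scal_zero).
  rewrite E at 1; rewrite star_scal_l; apply psm_eq; intro n; cbn [pc psm_scal psm_zero]; ring.
Qed.

Fixpoint psm_dern (n : nat) (f : psm) : psm :=
  match n with O => f | S m => psm_der (psm_dern m f) end.

Lemma star_monomial i g : star (monomial (Z.of_nat i)) g = psm_dern i g.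
Proof.
  induction i as [|i IH]; [apply star_one_l|].
  replace (Z.of_nat (S i)) with (Z.of_nat i + 1)%Z by lia.
  rewrite <- monomial_der, star_der, IH; reflexivity.
Qed.

Lemma emb_dern n f : dern n (emb f) = emb (psm_dern n f).
Proof. induction n as [|n IH]; [reflexivity|]. cbn [dern psm_dern]; rewrite IH; apply emb_der. Qed.

Lemma frechet_emb q f : (forall i, (q < i)%nat -> pdA (U i) Q = 0) ->
  frechet iotaE Q (emb f) = emb (star (Fpsm q) f).
Proof.
  intro H; rewrite (frechet_eq Epsm iotaE (S q)) by (intros; apply H; lia).
  unfold frechet_upto, Fpsm; generalize (S q) as n; induction n as [|n IH].
  - cbn [psm_sum]; rewrite star_zero_l; reflexivity.
  - rewrite (dsum_succ Epsm n), IH; cbn [psm_sum].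
    rewrite star_add_l, star_scal_l, star_monomial, emb_dern, emb_scal, emb_add; reflexivity.
Qed.

Definition Npsm : psm := star (monomial (-1)) (psm_scal (LambdaA lam k) (monomial 0)).

Lemma Npsm_der : psm_der Npsm = psm_scal (LambdaA lam k) (monomial 0).
Proof. unfold Npsm; rewrite <- star_der, monomial_der; apply star_one_l. Qed.

Definition Rpsm : psm :=
  psm_add (psm_add (psm_add (psm_scal (G2A k) (monomial 2)) (psm_scal (G1A k) (monomial 1)))
    (psm_scal (G0A c k) (monomial 0))) (psm_scal (PhiA lam) Npsm).

Lemma star_Rpsm g : emb (star Rpsm g) = apply_R (emb g) (emb (star Npsm g)).
Proof.
  unfold Rpsm, apply_R; rewrite !star_add_l, !star_scal_l, !emb_der, !emb_scal, !emb_add.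
  rewrite star_one_l, (star_monomial 1), (star_monomial 2); reflexivity.
Qed.

(** [LE_apply_R] is used at the identity operator. D_t kills the identity, so LE sends it to -F,
    where F is the linearised right-hand side; hence D_t(R) - F R = LE(R) = R(-F) = -R F. *)
Lemma psm_commutator q n : (forall i, (q < i)%nat -> pdA (U i) Q = 0) ->
  ddt Q (Rpsm n) - (star (Fpsm q) Rpsm n - star Rpsm (Fpsm q) n) = 0.
Proof.
  intro Hq.
  set (one := emb (monomial 0)).
  assert (S1 : star (Fpsm q) (monomial 0) = Fpsm q).
  { unfold Fpsm; generalize (S q) as m; induction m as [|m IH]; cbn [psm_sum].
    - apply star_zero_l.
    - rewrite star_add_l, IH, star_scal_l, star_monomial; f_equal; f_equal.
      clear; induction m as [|m IH]; [reflexivity|]. cbn [psm_dern]; rewrite IH, monomial_der.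
      f_equal; lia. }
  assert (L1 : LE one = - (1) * emb (Fpsm q)).
  { unfold linearized, one; rewrite (frechet_emb q _ Hq), S1.
    assert (Z : DtE (emb (monomial 0)) = 0).
    { unfold DtE, emb; simpl; f_equal; [apply (ddt_const Q (IZR 0))|].
      apply psm_eq; intro i; cbn [pc psm_ddt monomial psm_zero].
      destruct (Z.eq_dec i 0); [apply (ddt_const Q (IZR 1)) | apply (ddt_const Q (IZR 0))]. }
    rewrite Z; ring. }
  assert (R1 : emb Rpsm = apply_R one (emb Npsm)).
  { unfold Rpsm, apply_R, one; rewrite !emb_der, !monomial_der, !emb_scal, !emb_add; reflexivity. }
  (* [Npsm] is D^(-1) Lambda, which serves as the primitive for the identity; composed with -F it
     serves for the image of the identity under LE. *)
  assert (C := LE_apply_R one (emb Npsm) (- (1) * emb (star Npsm (Fpsm q)))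
    (null_of_emb _) (null_of_emb _) (null_mul _ _ (null_of_emb _))).
  rewrite <- R1, L1 in C.
  assert (C' : LE (emb Rpsm) = - (1) * emb (star Rpsm (Fpsm q))).
  { rewrite C.
    - rewrite star_Rpsm; unfold apply_R; dsimp; ring.
    - unfold one; rewrite emb_der, Npsm_der, emb_scal; reflexivity.
    - rewrite der_mul, der_opp, der1, emb_der, <- star_der, Npsm_der, star_scal_l, star_one_l,
        <- emb_scal; ring. }
  unfold linearized in C'; rewrite (frechet_emb q _ Hq) in C'.
  assert (F : DtE (emb Rpsm) - emb (star (Fpsm q) Rpsm) + emb (star Rpsm (Fpsm q)) = 0)
    by (rewrite C'; ring).
  apply (f_equal (fun x : Epsm => pc (snd x) n)) in F.
  change (ddt Q (Rpsm n) + - (star (Fpsm q) Rpsm n) + star Rpsm (Fpsm q) n = @dzero A) in F.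
  rewrite <- F; ring.
Qed.

End Commutator.

(** * Comparison with the jet-space operations *)

Ltac valsimp Hp := repeat first
  [ rewrite val_add by exact Hp | rewrite val_sub by exact Hp | rewrite val_mul by exact Hp
  | rewrite val_opp by exact Hp | rewrite val_half by exact Hp | rewrite val_one by exact Hp
  | rewrite val_zero by exact Hp | rewrite Aconst_val by exact Hp
  | rewrite vA_val by exact Hp | rewrite u1A_val by exact Hp | rewrite sA_val by exact Hp
  | rewrite rA_val by exact Hp | rewrite SA_val by exact Hp ].

Lemma val_dsum n (f : nat -> A) p : dom p -> val (dsum n f) p = rsum n (fun k => val (f k) p).
Proof.
  intro Hp; induction n as [|n IH]; [apply val_zero, Hp|].
  rewrite (dsum_succ A n), val_add, IH by exact Hp; reflexivity.
Qed.

Lemma repr_dern n F (a : A) : repr F a -> repr (Dxn n F) (dern n a).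
Proof. intro H; rewrite <- Adern_dern; apply repr_Dxn, H. Qed.

Lemma repr_frechet F a G b : repr F a -> repr G b ->
  repr (fun p => Series (fun k => Dxn k G p * pd (U k) F p)%R) (frechet idA a b).
Proof.
  intros HF HG p Hp; rewrite (Series_finite (S (order a))).
  - unfold frechet, frechet_upto; rewrite val_dsum by exact Hp.
    apply rsum_ext; intros i _; rewrite val_mul by exact Hp.
    rewrite (repr_dern i G b HG p Hp), (repr_pd (U i) F a HF p Hp); apply Rmult_comm.
  - intros i Hi; rewrite (repr_pd (U i) F a HF p Hp).
    rewrite (Apd_high (order a)), Aconst_val by (auto using order_depends); ring.
Qed.

Lemma repr_Dt Phi w F a : repr Phi w -> repr F a -> repr (Dt Phi F) (ddt w a).
Proof.
  intros Hw HF p Hp; unfold Dt, ddt; rewrite val_add by exact Hp; f_equal.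
  - apply repr_pd; assumption.
  - exact (repr_frechet F a Phi w HF Hw p Hp).
Qed.

Lemma repr_L_E Phi w F a : repr Phi w -> repr F a ->
  repr (L_E Phi F) (ddt w a - frechet idA w a).
Proof.
  intros Hw HF p Hp; unfold L_E; rewrite val_sub by exact Hp; f_equal.
  - apply repr_Dt; assumption.
  - rewrite <- (repr_frechet Phi w F a Hw HF p Hp).
    apply Series_ext; intro i; apply Rmult_comm.
Qed.

Lemma repr_val (a : A) : repr a a.
Proof. intros p _; reflexivity. Qed.

Lemma stationaryP p : stationary p <->
  dom p /\ forall k, (1 <= k)%nat -> Dxn k Schw p = 0%R.
Proof.
  assert (HS : repr Schw SA) by (intros q Hq; symmetry; apply SA_val, Hq).
  split; intros [Hp H]; (split; [exact Hp|]); intros k Hk; specialize (H k Hk).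
  - rewrite (repr_dern k Schw SA HS p Hp); exact H.
  - rewrite <- (repr_dern k Schw SA HS p Hp); exact H.
Qed.

Definition prepr (P : psdo) (f : Z -> A) : Prop := forall n, repr (coef P n) (f n).

Lemma prepr_ext P f g : (forall n, f n = g n) -> prepr P f -> prepr P g.
Proof. intros E H n; rewrite <- E; apply H. Qed.

Lemma prepr_above P f : prepr P f -> above (pdeg P) f.
Proof.
  intros H n Hn; apply dfun_eq; intros p Hp; rewrite val_zero by exact Hp.
  rewrite <- (H n p Hp); unfold coef; destruct (Z.leb_spec n (pdeg P)); [lia | reflexivity].
Qed.

Lemma coef_le P n : (n <= pdeg P)%Z -> coef P n = pcf P (Z.to_nat (pdeg P - n)).
Proof. intro H; unfold coef; destruct (Z.leb_spec n (pdeg P)); [reflexivity | lia]. Qed.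

Lemma coef_gt P n : (pdeg P < n)%Z -> coef P n = fun _ => 0%R.
Proof. intro H; unfold coef; destruct (Z.leb_spec n (pdeg P)); [lia | reflexivity]. Qed.

Lemma prepr_pcf P f i : prepr P f -> repr (pcf P i) (f (pdeg P - Z.of_nat i)%Z).
Proof.
  intro H; specialize (H (pdeg P - Z.of_nat i)%Z); rewrite coef_le in H by lia.
  replace (Z.to_nat (pdeg P - (pdeg P - Z.of_nat i))) with i in H by lia; exact H.
Qed.

Lemma prepr_intro d c f : above d f ->
  (forall i, repr (c i) (f (d - Z.of_nat i)%Z)) -> prepr (Psdo d c) f.
Proof.
  intros Ha H n; destruct (Z.le_gt_cases n d) as [L|L].
  - rewrite coef_le by exact L; simpl.
    replace n with (d - Z.of_nat (Z.to_nat (d - n)))%Z at 2 by lia; apply H.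
  - rewrite coef_gt by exact L; rewrite Ha by exact L.
    intros p Hp; symmetry; apply val_zero, Hp.
Qed.

Lemma prepr_padd P Q f g : prepr P f -> prepr Q g -> prepr (padd P Q) (fun n => f n + g n).
Proof.
  intros Hf Hg; apply prepr_intro.
  - intros n Hn; rewrite (prepr_above P f Hf), (prepr_above Q g Hg) by lia; ring.
  - intros i p Hp; rewrite val_add by exact Hp; f_equal; [apply Hf | apply Hg]; exact Hp.
Qed.

Lemma prepr_popp P f : prepr P f -> prepr (popp P) (fun n => - f n).
Proof.
  intros Hf; apply prepr_intro.
  - intros n Hn; rewrite (prepr_above P f Hf) by lia; ring.
  - intros i p Hp; rewrite val_opp by exact Hp; f_equal; apply prepr_pcf; assumption.
Qed.

Lemma prepr_Dt Phi w P f : repr Phi w -> prepr P f ->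
  prepr (Psdo (pdeg P) (fun m => Dt Phi (pcf P m))) (fun n => ddt w (f n)).
Proof.
  intros Hw Hf; apply prepr_intro.
  - intros n Hn; rewrite (prepr_above P f Hf) by lia; apply (ddt_const w (IZR 0)).
  - intros i; apply repr_Dt; [exact Hw | apply prepr_pcf, Hf].
Qed.

Lemma sum_f_R0_rsum f n : sum_f_R0 f n = rsum (S n) f.
Proof. induction n as [|n IH]; simpl in *; [ring | rewrite IH; reflexivity]. Qed.

Lemma rsum_extend n m f : (n <= m)%nat -> (forall k, (n <= k)%nat -> f k = 0%R) ->
  rsum m f = rsum n f.
Proof.
  intros L H; induction L as [|m L IH]; [reflexivity|].
  simpl; rewrite IH, H by exact L; apply Rplus_0_r.
Qed.

Lemma prepr_pmul P Q (f g : psm) : prepr P f -> prepr Q g -> prepr (pmul P Q) (star f g).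
Proof.
  intros Hf Hg; assert (Af := prepr_above P f Hf); assert (Ag := prepr_above Q g Hg).
  apply prepr_intro.
  - intros n Hn; change (star_fun f g n = 0).
    rewrite (star_fun_eq f g (pdeg P) (pdeg Q) 0) by (auto; lia); reflexivity.
  - intros m p Hp; change (val (star f g ?n) p) with (val (star_fun f g n) p).
    rewrite (star_fun_eq f g (pdeg P) (pdeg Q) (S m)) by (auto; lia).
    unfold leibniz; rewrite val_dsum, sum_f_R0_rsum by exact Hp.
    apply rsum_ext; intros i Hi; rewrite val_dsum, sum_f_R0_rsum by exact Hp.
    (* [pmul] stops the inner sum at m - i, the truncated Leibniz rule at m; the terms in between
       meet coefficients of g above its degree. *)
    symmetry; rewrite (rsum_extend (S (m - i)) (S m)).
    + apply rsum_ext; intros l Hl; unfold dcoef; valsimp Hp.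
      rewrite (prepr_pcf P f i Hf p Hp); f_equal; symmetry.
      apply repr_dern; [|exact Hp].
      replace (pdeg P + pdeg Q - Z.of_nat m - pdeg P + Z.of_nat i + Z.of_nat l)%Z
        with (pdeg Q - Z.of_nat (m - i - l))%Z by lia.
      apply prepr_pcf, Hg.
    + lia.
    + intros l Hl; rewrite Ag by lia; rewrite dern_zero.
      rewrite val_mul, val_zero by exact Hp; apply Rmult_0_r.
Qed.

Lemma psm_sum_monomial n (a : nat -> A) z :
  psm_sum n (fun i => psm_scal (a i) (monomial (Z.of_nat i))) z
  = if Z_le_dec 0 z then if Z_lt_dec z (Z.of_nat n) then a (Z.to_nat z) else 0 else 0.
Proof.
  induction n as [|n IH].
  - cbn [psm_sum pc psm_zero]; destruct (Z_le_dec 0 z), (Z_lt_dec z (Z.of_nat 0)); try lia; reflexivity.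
  - cbn [psm_sum pc psm_add psm_scal monomial]; rewrite IH.
    destruct (Z.eq_dec z (Z.of_nat n)) as [->|N].
    + destruct (Z_le_dec 0 (Z.of_nat n)), (Z_lt_dec (Z.of_nat n) (Z.of_nat n)),
        (Z_lt_dec (Z.of_nat n) (Z.of_nat (S n))); try lia.
      rewrite Nat2Z.id; ring.
    + destruct (Z_le_dec 0 z), (Z_lt_dec z (Z.of_nat n)), (Z_lt_dec z (Z.of_nat (S n)));
        try lia; ring.
Qed.

Lemma prepr_pdiffop n (c : nat -> jfun) (a : nat -> A) :
  (forall i, (i <= n)%nat -> repr (c i) (a i)) ->
  prepr (pdiffop n c) (psm_sum (S n) (fun i => psm_scal (a i) (monomial (Z.of_nat i)))).
Proof.
  intro H; apply prepr_intro.
  - intros z Hz; rewrite psm_sum_monomial.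
    destruct (Z_le_dec 0 z), (Z_lt_dec z (Z.of_nat (S n))); try lia; reflexivity.
  - intro i; rewrite psm_sum_monomial; destruct (Nat.leb_spec i n) as [L|L].
    + destruct (Z_le_dec 0 (Z.of_nat n - Z.of_nat i)),
        (Z_lt_dec (Z.of_nat n - Z.of_nat i) (Z.of_nat (S n))); try lia.
      replace (Z.to_nat (Z.of_nat n - Z.of_nat i)) with (n - i)%nat by lia; apply H; lia.
    + destruct (Z_le_dec 0 (Z.of_nat n - Z.of_nat i)); [lia|].
      intros p Hp; symmetry; apply val_zero, Hp.
Qed.

Lemma prepr_pfun c a : repr c a -> prepr (pfun c) (psm_scal a (monomial 0)).
Proof.
  intro H; eapply prepr_ext; [|apply (prepr_pdiffop 0 (fun _ => c) (fun _ => a)); auto].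
  intro n; cbn [psm_sum pc psm_add psm_zero]; change (Z.of_nat 0) with 0%Z; ring.
Qed.

Lemma prepr_pDinv : prepr pDinv (monomial (-1)).
Proof.
  apply prepr_intro.
  - intros n Hn; cbn [pc monomial]; destruct (Z.eq_dec n (-1)); [lia | reflexivity].
  - intros [|i] p Hp; cbn [pc monomial]; destruct (Z.eq_dec _ (-1)); try lia; valsimp Hp; reflexivity.
Qed.

Section Hierarchy.
Variables lam k1 k2 : R.
Hypotheses (Hlam : lam <> 0%R) (Hk : k2 <> 0%R).

(** The missing k2/2 of the constant k1 + k2 in [G0] is produced inside [G0A]: h_x = S + h^2 / 2,
    and the summand S cancels against the factor s^2 = 1/S. *)
Definition cst_c : R := (k1 + k2 / 2)%R.

Notation Q := (QA lam cst_c k2).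
Notation psi := (psiA lam cst_c k2).

Lemma Rpower_half_pow x n : (0 < x)%R -> Rpower x (INR n / 2) = (sqrt x ^ n)%R.
Proof.
  intro H; rewrite <- Rpower_pow by (apply sqrt_lt_R0, H).
  rewrite <- (Rpower_sqrt x H), Rpower_mult; f_equal; field.
Qed.

Lemma repr_Schw : repr Schw SA.
Proof. intros q Hq; symmetry; apply SA_val, Hq. Qed.

Lemma repr_Sx n : repr (Sx n) (dern n SA).
Proof. apply repr_dern, repr_Schw. Qed.

Lemma Sx_val n p : dom p -> val (dern n SA) p = Sx n p.
Proof. intro Hp; symmetry; apply repr_Sx, Hp. Qed.

Lemma repr_Phi : repr (Phi_S lam) (PhiA lam).
Proof. intros p Hp; unfold Phi_S, PhiA; valsimp Hp; unfold Rdiv; ring. Qed.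

Lemma PhiA_Q0 : PhiA lam = Q 0.
Proof.
  unfold PhiA, QA, psiA; cbn [table]; rewrite chi_0; ring.
Qed.

Lemma repr_G2 : repr (G2 k2) (G2A k2).
Proof.
  intros p Hp; unfold G2, G2A; valsimp Hp.
  assert (HS := schw_pos p Hp).
  rewrite <- (sqrt_sqrt (Schw p)) at 1 by (apply Rlt_le, HS).
  field; apply sqrt_schw_neq0, Hp.
Qed.

Lemma hA_val p : dom p -> val hA p = (u 2 p / u 1 p)%R.
Proof.
  intro Hp; unfold hA; valsimp Hp.
  change (val (uA 2) p) with (Au 2 p); rewrite Au_val by exact Hp; reflexivity.
Qed.

Lemma der_hA : der hA = SA + half * hA * hA.
Proof. rewrite SA_riccati; ring. Qed.

Lemma sA_der1 : der sA = - (half * sA * sA * sA) * dern 1 SA.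
Proof. exact der_sA. Qed.

Lemma sA_der2 : der (der sA) =
  - (half * sA * sA * sA) * dern 2 SA
  + half * half * (1 + 1 + 1) * sA * sA * sA * sA * sA * dern 1 SA * dern 1 SA.
Proof.
  rewrite sA_der1; change (dern 2 SA) with (der (dern 1 SA)); set (S1 := dern 1 SA).
  dsimp; rewrite der_sA; change (der SA) with S1; ring.
Qed.

(** The coefficients -1/2, 9/4, -15/8 are -1/2 times the coefficients 1, -9/2, 15/4 in [Lambda]. *)
Lemma sA_der3 : der (der (der sA)) =
  - (half * sA * sA * sA) * dern 3 SA
  + half * half * (1 + 1 + 1) * (1 + 1 + 1) * sA * sA * sA * sA * sA * dern 1 SA * dern 2 SA
  - half * half * half * (1 + 1 + 1) * (1 + 1 + 1 + 1 + 1)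
      * sA * sA * sA * sA * sA * sA * sA * dern 1 SA * dern 1 SA * dern 1 SA.
Proof.
  rewrite sA_der2; change (dern 3 SA) with (der (dern 2 SA)).
  change (dern 2 SA) with (der (dern 1 SA)); set (S1 := dern 1 SA).
  dsimp; rewrite der_sA; change (der SA) with S1; ring.
Qed.

Lemma repr_G1 : repr (G1 k2) (G1A k2).
Proof.
  intros p Hp; unfold G1, G1A; rewrite sA_der1; valsimp Hp.
  rewrite hA_val, Sx_val by exact Hp.
  assert (HS := schw_pos p Hp); assert (Ht := sqrt_schw_neq0 p Hp).
  rewrite <- (sqrt_sqrt (Schw p)) at 1 2 by (apply Rlt_le, HS).
  field; split; [exact Ht | apply u1_neq0, Hp].
Qed.

Lemma repr_G0 : repr (G0 k1 k2) (G0A cst_c k2).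
Proof.
  intros p Hp; unfold G0, G0A, cst_c; rewrite sA_der2, der_hA, sA_der1; valsimp Hp.
  rewrite hA_val, !Sx_val by exact Hp.
  assert (HS := schw_pos p Hp); assert (Ht := sqrt_schw_neq0 p Hp).
  assert (E : Schw p = (sqrt (Schw p) * sqrt (Schw p))%R)
    by (symmetry; apply sqrt_sqrt, Rlt_le, HS).
  set (t := sqrt (Schw p)) in *; rewrite E.
  field; split; [exact Ht | apply u1_neq0, Hp].
Qed.

Lemma repr_Lambda : repr (Lambda lam k2) (LambdaA lam k2).
Proof.
  intros p Hp; unfold Lambda, LambdaA; rewrite sA_der3; valsimp Hp.
  rewrite !Sx_val by exact Hp.
  assert (HS := schw_pos p Hp); assert (Ht := sqrt_schw_neq0 p Hp).
  assert (E3 := Rpower_half_pow (Schw p) 3 HS); assert (E5 := Rpower_half_pow (Schw p) 5 HS).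
  assert (E7 := Rpower_half_pow (Schw p) 7 HS).
  replace (INR 3) with 3%R in E3 by (simpl; ring).
  replace (INR 5) with 5%R in E5 by (simpl; ring).
  replace (INR 7) with 7%R in E7 by (simpl; ring).
  rewrite E3, E5, E7; set (t := sqrt (Schw p)) in *.
  field; repeat split; auto; apply u1_neq0, Hp.
Qed.

Lemma prepr_R : prepr (psdo_of (R_S lam k1 k2)) (Rpsm lam cst_c k2).
Proof.
  unfold psdo_of, Rpsm, R_S; cbn [iod_order iod_loc iod_left iod_right].
  eapply prepr_ext; [|apply prepr_padd].
  3: { apply (prepr_pmul _ _ (psm_scal (PhiA lam) (monomial 0)) (Npsm lam k2)).
       - apply prepr_pfun, repr_Phi.
       - apply (prepr_pmul _ _ (monomial (-1)) (psm_scal (LambdaA lam k2) (monomial 0))).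
         + apply prepr_pDinv.
         + apply prepr_pfun, repr_Lambda. }
  2: { apply (prepr_pdiffop 2 _ (fun i => match i with O => G0A cst_c k2 | 1%nat => G1A k2
         | _ => G2A k2 end)).
       intros [|[|[|i]]] Hi; [apply repr_G0 | apply repr_G1 | apply repr_G2 | lia]. }
  intro n; rewrite star_scal_l, star_one_l.
  cbn [psm_sum pc psm_add psm_scal psm_zero].
  change (Z.of_nat 0) with 0%Z; change (Z.of_nat 1) with 1%Z; change (Z.of_nat 2) with 2%Z; ring.
Qed.

Lemma commutator_vanishes q j Phi : repr Phi (Q j) ->
  (forall i, (q < i)%nat -> pdA (U i) (Q j) = 0) ->
  forall n, eq_dom (coef (L_E_commutator q Phi (psdo_of (R_S lam k1 k2))) n) (fun _ => 0%R).
Proof.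
  intros HP Hq n p Hp.
  assert (HF : prepr (pdiffop q (fun i => pd (U i) Phi)) (Fpsm lam cst_c k2 j q))
    by (apply (prepr_pdiffop q (fun i => pd (U i) Phi) (fun i => pdA (U i) (Q j)));
        intros; apply repr_pd, HP).
  assert (HR := prepr_R).
  assert (H := prepr_padd _ _ _ _ (prepr_Dt Phi _ _ _ HP HR)
    (prepr_popp _ _ (prepr_padd _ _ _ _ (prepr_pmul _ _ _ _ HF HR)
       (prepr_popp _ _ (prepr_pmul _ _ _ _ HR HF))))).
  etransitivity; [exact (H n p Hp)|].
  assert (C := psm_commutator lam cst_c k2 Hlam Hk j q n Hq).
  transitivity (val (@dzero A) p); [|apply val_zero, Hp].
  f_equal; rewrite <- C; ring.
Qed.

End Hierarchy.

(** * Orders, dependence on the Schwarzian, and the theorem *)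

Definition has_lead (m : nat) (a : A) : Prop :=
  order_le m a /\ forall p, dom p -> val (pdA (U m) a) p <> 0%R.

Lemma pdA_sA w : pdA w sA = - (half * sA * sA * sA * pdA w SA).
Proof.
  rewrite (pdA_inv w rA sA rA_sA), pdA_rA; set (x := pdA w SA).
  transitivity (- (sA * (half * sA * x * sA))); ring.
Qed.

Lemma pdA_SA3 : pdA (U 3) SA = vA.
Proof.
  assert (E : SA = schw_rest 0 + uA 3 * vA) by (unfold schw_rest; cbn [dern Nat.add]; ring).
  rewrite E, pdA_add, pdA_mul, (schw_rest_order 0), (order_le_v 1) by lia.
  assert (F : pdA (U 3) (uA 3) = 1).
  { unfold pdA, uA; rewrite Apd_u; destruct jvar_eq_dec; [reflexivity | congruence]. }
  rewrite F; ring.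
Qed.

(** In P2 chi_(n+1) = P1 chi_n the left side is of first order in D and the right side of third, so
    the order rises by 2, and the leading coefficient is divided by 2 S. *)
Lemma chi_lead n : has_lead (2 * n + 3) (chi A rA sA n).
Proof.
  assert (OS := order_le_SA).
  induction n as [|n [IHo IHl]].
  - rewrite chi_0; split.
    + intros i Hi; rewrite pdA_sA, OS by lia; ring.
    + intros p Hp. replace (2 * 0 + 3)%nat with 3%nat by lia.
      rewrite pdA_sA, pdA_SA3; valsimp Hp.
      assert (H1 := sqrt_schw_neq0 p Hp); assert (H2 := u1_neq0 p Hp).
      apply Ropp_neq_0_compat.
      repeat apply Rmult_integral_contrapositive_currified;
        apply Rinv_neq_0_compat; auto; lra.
  - set (w := chi A rA sA (S n)).
    assert (E : (SA + SA) * der w + der SA * w = der (der (der (chi A rA sA n)))).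
    { assert (H := chi_rec A rA sA rA_sA (S n)); rewrite rA_rA in H; exact H. }
    assert (Step : forall m, (4 <= m)%nat -> order_le m w -> order_le (m - 2) (chi A rA sA n) ->
      (SA + SA) * pdA (U m) w = pdA (U (m - 2)) (chi A rA sA n)).
    { intros m Hm Hw Hc.
      assert (L : pdA (U (S m)) ((SA + SA) * der w + der SA * w) = (SA + SA) * pdA (U m) w).
      { rewrite pdA_add, !pdA_mul, pdA_add, OS by lia.
        rewrite (order_le_der 3 SA OS) by lia.
        rewrite (lead_der m w Hw), (Hw (S m)) by lia; ring. }
      rewrite <- L, E.
      replace (S m) with (S (S (S (m - 2)))) by lia.
      rewrite (lead_der (S (S (m - 2)))) by (do 2 apply order_le_der; exact Hc).
      rewrite (lead_der (S (m - 2))) by (apply order_le_der; exact Hc).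
      apply lead_der, Hc. }
    assert (U2 : (half * sA * sA) * (SA + SA) = 1).
    { rewrite <- rA_rA; transitivity ((half + half) * (rA * sA) * (rA * sA)); [ring|].
      rewrite half_half, rA_sA; ring. }
    assert (Ow : order_le (2 * S n + 3) w).
    (* At first chi_(n+1) is only known to have some finite order. As long as the bound exceeds 2 n
       + 5, comparing top coefficients lowers it by one. *)
    { assert (D : forall d, order_le (2 * S n + 3 + d) w -> order_le (2 * S n + 3) w).
      { induction d as [|d IH]; intro H; [rewrite Nat.add_0_r in H; exact H|].
        apply IH, order_le_step; rewrite <- Nat.add_succ_r; [|exact H].
        set (m := (2 * S n + 3 + S d)%nat) in *.
        assert (Z := Step m ltac:(lia) H (fun i Hi => IHo i ltac:(lia))).
        rewrite IHo in Z by lia.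
        transitivity ((half * sA * sA) * (SA + SA) * pdA (U m) w); [rewrite U2; ring|].
        transitivity ((half * sA * sA) * ((SA + SA) * pdA (U m) w)); [ring|].
        rewrite Z; ring. }
      apply (D (order w)), (order_le_weaken (order w)); [lia | apply order_le_order]. }
    split; [exact Ow|]; intros p Hp H0.
    assert (Z := Step (2 * S n + 3)%nat ltac:(lia) Ow (fun i Hi => IHo i ltac:(lia))).
    replace (2 * S n + 3 - 2)%nat with (2 * n + 3)%nat in Z by lia.
    apply (IHl p Hp); rewrite <- Z, val_mul, H0 by exact Hp; apply Rmult_0_r.
Qed.

(** Being a function of finitely many S_kx is not visibly preserved by D_x; membership in this ring
    with explicit generators is. *)
Inductive schwarzian_fun : A -> Prop :=
  | sf_const c : schwarzian_fun (Aconst c)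
  | sf_r : schwarzian_fun rA
  | sf_s : schwarzian_fun sA
  | sf_S n : schwarzian_fun (dern n SA)
  | sf_add a b : schwarzian_fun a -> schwarzian_fun b -> schwarzian_fun (a + b)
  | sf_sub a b : schwarzian_fun a -> schwarzian_fun b -> schwarzian_fun (a - b)
  | sf_mul a b : schwarzian_fun a -> schwarzian_fun b -> schwarzian_fun (a * b).

Lemma schwarzian_fun_der a : schwarzian_fun a -> schwarzian_fun (der a).
Proof.
  assert (Ho : schwarzian_fun (- (1))).
  { replace (- (1)) with (@dzero A - 1) by ring.
    apply sf_sub; [apply (sf_const (IZR 0)) | apply (sf_const (IZR 1))]. }
  assert (Hs : schwarzian_fun (der sA)).
  { rewrite der_sA.
    replace (- (half * sA * sA * sA) * der SA)
      with ((- (1)) * half * sA * sA * sA * dern 1 SA) by (cbn [dern]; ring).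
    exact (sf_mul _ _ (sf_mul _ _ (sf_mul _ _ (sf_mul _ _ (sf_mul _ _ Ho (sf_const (/ 2)))
      sf_s) sf_s) sf_s) (sf_S 1)). }
  induction 1; dsimp; auto using sf_add, sf_sub, sf_mul.
  - rewrite der_const; apply (sf_const (IZR 0)).
  - rewrite (der_r A rA sA rA_sA).
    replace (- (rA * rA * der sA)) with ((- (1)) * rA * rA * der sA) by ring.
    exact (sf_mul _ _ (sf_mul _ _ (sf_mul _ _ Ho sf_r) sf_r) Hs).
  - apply (sf_S (S n)).
Qed.

Lemma schwarzian_fun_depends a : schwarzian_fun a -> exists n, forall p q, dom p -> dom q ->
  (forall i, (i <= n)%nat -> Sx i p = Sx i q) -> val a p = val a q.
Proof.
  induction 1 as [c| | |n|a b _ [n Hn] _ [m Hm]|a b _ [n Hn] _ [m Hm]|a b _ [n Hn] _ [m Hm]].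
  1: exists 0%nat; intros p q Hp Hq _; rewrite !Aconst_val by assumption; reflexivity.
  1: { exists 0%nat; intros p q Hp Hq H; specialize (H 0%nat (le_n _)).
       change (Schw p = Schw q) in H; rewrite !rA_val, H by assumption; reflexivity. }
  1: { exists 0%nat; intros p q Hp Hq H; specialize (H 0%nat (le_n _)).
       change (Schw p = Schw q) in H; rewrite !sA_val, H by assumption; reflexivity. }
  1: { exists n; intros p q Hp Hq H; rewrite !Sx_val by assumption; apply H, le_n. }
  all: exists (Nat.max n m); intros p q Hp Hq H;
    rewrite ?val_add, ?val_sub, ?val_mul by assumption;
    rewrite (Hn p q), (Hm p q); auto; intros; apply H; lia.
Qed.

Lemma schwarzian_fun_list a : schwarzian_fun a -> exists (n : nat) (Psi : list R -> R),
  forall p, dom p -> val a p = Psi (map (fun i => Sx i p) (seq 0 (n + 1))).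
Proof.
  intro H; destruct (schwarzian_fun_depends a H) as [n Hn]; exists n.
  (* Psi is read off at an arbitrary jet of [dom] with the prescribed S_kx; lists that no such jet
     realises get the value 0. *)
  exists (fun l => match excluded_middle_informative
            (exists p, dom p /\ map (fun i => Sx i p) (seq 0 (n + 1)) = l) with
          | left e => val a (proj1_sig (constructive_indefinite_description _ e))
          | right _ => 0%R end).
  intros p Hp; destruct excluded_middle_informative as [e|e].
  - destruct (constructive_indefinite_description _ e) as [q [Hq E]]; simpl.
    apply Hn; auto; intros i Hi.
    symmetry; apply (proj1 map_ext_in_iff E i), in_seq; lia.
  - exfalso; apply e; exists p; auto.
Qed.

(** * Commuting flows and the hierarchy *)

Section Main.
Variables lam k1 k2 : R.
Hypotheses (Hlam : lam <> 0%R) (Hk : k2 <> 0%R).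

Notation c := (cst_c k1 k2).
Notation Q := (QA lam c k2).
Notation psi := (psiA lam c k2).
Notation R_op := (R_S lam k1 k2).

Lemma psi_succ j i : psi (S j) i = (Aconst c : A) * psi j i - (Aconst k2 : A) * psi j (S i).
Proof. reflexivity. Qed.

Lemma pdA_const_mul w (e : R) (a : A) : pdA w ((Aconst e : A) * a) = (Aconst e : A) * pdA w a.
Proof. rewrite pdA_mul, pdA_const; ring. Qed.

(** The shifted term of the preceding row has order two higher than the unshifted one and alone
    determines the leading derivative; its coefficient -k2 is nonzero. *)
Lemma psi_lead j i : has_lead (2 * (j + i) + 3) (psi j i).
Proof.
  revert i; induction j as [|j IH]; intro i.
  - destruct (chi_lead i) as [Ho Hl].
    change (psi 0 i) with ((Aconst lam : A) * chi A rA sA i); split.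
    + intros m Hm; rewrite pdA_const_mul, Ho by lia; ring.
    + intros p Hp; rewrite pdA_const_mul, val_mul by exact Hp.
      rewrite Aconst_val by exact Hp.
      apply Rmult_integral_contrapositive_currified; [exact Hlam | apply Hl, Hp].
  - destruct (IH i) as [Ho _], (IH (S i)) as [Ho' Hl']; rewrite psi_succ.
    replace (2 * (S j + i) + 3)%nat with (2 * (j + S i) + 3)%nat by lia; split.
    + intros m Hm; rewrite pdA_sub, !pdA_const_mul, Ho, Ho' by lia; ring.
    + intros p Hp; rewrite pdA_sub, !pdA_const_mul, Ho by lia.
      rewrite val_sub, !val_mul, val_zero, !Aconst_val by exact Hp.
      rewrite Rmult_0_r, Rminus_0_l; apply Ropp_neq_0_compat.
      apply Rmult_integral_contrapositive_currified; [exact Hk | apply Hl', Hp].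
Qed.

Lemma Q_lead j : has_lead (2 * j + 3) (Q j).
Proof.
  destruct (psi_lead j 0) as [Ho Hl]; replace (2 * (j + 0) + 3)%nat with (2 * j + 3)%nat in * by lia.
  unfold QA; split.
  - intros m Hm; rewrite pdA_mul, Ho, (order_le_u 1 1) by lia; ring.
  - intros p Hp; rewrite pdA_mul, (order_le_u 1 1) by lia.
    rewrite val_add, !val_mul, val_zero, u1A_val by exact Hp.
    rewrite Rmult_0_l, Rplus_0_l.
    apply Rmult_integral_contrapositive_currified; [apply u1_neq0, Hp | apply Hl, Hp].
Qed.

Definition base_jet : jet := fun w => match w with U 1 => 1%R | U 3 => 1%R | _ => 0%R end.

Lemma base_jet_dom : dom base_jet.
Proof. unfold dom, Schw, u, base_jet; split; lra. Qed.

Lemma Q_has_order j F : repr F (Q j) -> has_order (2 * j + 3) F.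
Proof.
  intro HF; destruct (Q_lead j) as [Ho Hl]; split.
  - apply (depends_ext _ (Q j)); [intros p Hp; symmetry; apply HF, Hp|].
    apply depends_order_le; [lia | exact Ho].
  - exists base_jet; split; [exact base_jet_dom|].
    rewrite (repr_pd (U (2 * j + 3)) F (Q j) HF) by exact base_jet_dom.
    apply Hl, base_jet_dom.
Qed.

Lemma Q_evolution j F : repr F (Q j) -> evolution_equation (2 * j + 3) F.
Proof. intro HF; split; [apply (repr_diff_fun F (Q j) HF) | apply Q_has_order, HF]. Qed.

Lemma characteristicP Phi w F a : repr Phi w -> repr F a ->
  (characteristic Phi F <-> ddt w a - frechet idA w a = 0).
Proof.
  intros HP HF; assert (HL := repr_L_E Phi w F a HP HF); split.
  - intros [_ H]; apply dfun_eq; intros p Hp; rewrite val_zero, <- HL by exact Hp; apply H, Hp.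
  - intro H; split; [exact (repr_diff_fun F a HF)|].
    intros p Hp; rewrite (HL p Hp), H; apply val_zero, Hp.
Qed.

(** Obtained by solving [rec_preimage (Q j) n = psi j 1] for n: the preimage of psi_(j,0) under the
    pencil is already known as the shifted table entry, so D^(-1) (Lambda Q_j) is local. The factor
    k2/lam is the inverse of [kapA]. *)
Definition Dx_inv_Q (j : nat) : A := (Aconst (k2 / lam)%R : A) *
  (half * (sA * der (der (psi j 0)) - der sA * der (psi j 0) + der (der sA) * psi j 0)
   - rA * psi j 1).

Lemma vA_Q j : vA * Q j = psi j 0.
Proof.
  unfold QA; transitivity ((u1A * vA) * psi j 0); [ring | rewrite u1A_vA; ring].
Qed.

(** Each summand contains a derivative of psi or of s, or the entry psi_(j,1), which lies in the
    ideal because it is built from chi_i with i > 0. So this primitive is the one with zero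
    integration constant. *)
Lemma Dx_inv_Q_flat j p : stationary p -> val (Dx_inv_Q j) p = 0%R.
Proof.
  intro Hp; apply (flat_val (Dx_inv_Q j)); [|exact Hp].
  assert (H1 : flat (psi j 1)) by (apply (table_ideal A rA sA rA_sA flat flat_zero flat_add flat_mul
    flat_der flat_der_sA)).
  assert (H2 : flat (der (psi j 0))) by apply flat_der_psi.
  assert (H3 := flat_der_sA).
  apply flat_mul, flat_sub; [|apply flat_mul, H1]; apply flat_mul, flat_add; [apply flat_sub|].
  - apply flat_mul, flat_der, H2.
  - apply flat_mul, H2.
  - apply flat_mul_l, flat_der, H3.
Qed.

Lemma ham2_psi j : (rA + rA) * der (rA * psi j 1) = der (der (der (psi j 0))).
Proof.
  assert (H := table_pencil A rA sA rA_sA (Aconst lam) (Aconst c) (Aconst k2)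
    (der_const _) (der_const _) (der_const _) j 0).
  rewrite (ham2_rDr A rA) in H; exact H.
Qed.

Lemma Dx_inv_Q_der j : der (Dx_inv_Q j) = LambdaA lam k2 * Q j.
Proof.
  unfold Dx_inv_Q, LambdaA.
  assert (H : der (rA * psi j 1) = half * sA * der (der (der (psi j 0)))).
  { rewrite <- ham2_psi; set (x := der (rA * psi j 1)).
    transitivity ((half + half) * (rA * sA) * x); [rewrite half_half, rA_sA|]; ring. }
  rewrite der_mul, der_const, der_sub, H.
  transitivity (((Aconst (k2 / lam)%R : A) * half) * (der (der (der sA)) * (vA * Q j))).
  - rewrite vA_Q; dsimp; ring.
  - change (@half A) with (Aconst (/ 2)); rewrite Aconst_mul.
    replace (k2 / lam * / 2)%R with (k2 / (2 * lam))%R by (field; exact Hlam); ring.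
Qed.

Lemma R_Q j : G2A k2 * der (der (Q j)) + G1A k2 * der (Q j) + G0A c k2 * Q j
  + PhiA lam * Dx_inv_Q j = Q (S j).
Proof.
  unfold PhiA.
  rewrite (rec_split A sA u1A vA hA (Aconst lam) (Aconst c) (Aconst k2) (kapA lam k2)
    u1A_vA der_u1A (k_kap lam k2 Hk) (G2A k2) (G1A k2) (G0A c k2) (Q j) (Dx_inv_Q j)
    eq_refl eq_refl eq_refl).
  change (Q (S j)) with (u1A * psi (S j) 0).
  rewrite psi_succ, vA_Q; f_equal; f_equal; f_equal.
  unfold rec_preimage, local_part, Dx_inv_Q; rewrite vA_Q.
  assert (Ek : kapA lam k2 * (Aconst (k2 / lam)%R : A) = 1).
  { unfold kapA; rewrite Aconst_mul; change (@done A) with (Aconst (IZR 1)); f_equal.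
    field; auto. }
  match goal with |- ?a - _ * _ * (_ * ?b) = _ =>
    transitivity (a - (kapA lam k2 * (Aconst (k2 / lam)%R : A)) * sA * b); [ring|] end.
  rewrite Ek. transitivity ((rA * sA) * psi j 1); [ring | rewrite rA_sA; ring].
Qed.

Lemma repr_R_apply F (a : A) G (n : A) : repr F a -> repr G n ->
  repr (fun p => (sum_f_R0 (fun i => iod_loc R_op i p * Dxn i F p) (iod_order R_op)
                  + iod_left R_op p * G p)%R)
    (G2A k2 * der (der a) + G1A k2 * der a + G0A c k2 * a + PhiA lam * n).
Proof.
  intros HF HG p Hp; unfold R_S; cbn [iod_order iod_loc iod_left sum_f_R0].
  rewrite !val_add, !val_mul by exact Hp.
  rewrite (repr_Phi lam p Hp), (repr_G2 k2 p Hp), (repr_G1 k2 p Hp), (repr_G0 k1 k2 p Hp),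
    (HG p Hp).
  rewrite (repr_dern 2 F a HF p Hp), (repr_dern 1 F a HF p Hp), (repr_dern 0 F a HF p Hp).
  cbn [dern]; ring.
Qed.

Lemma maps_to_Q j : maps_to R_op (Q j) (Q (S j)).
Proof.
  exists (val (Dx_inv_Q j)); split.
  2: { intros p Hp; rewrite <- R_Q; symmetry.
       apply (repr_R_apply (Q j) (Q j) _ (Dx_inv_Q j)); auto using repr_val. }
  split; [apply (val_diff (Dx_inv_Q j)) | split].
  - intros p Hp; etransitivity; [exact (repr_dern 1 _ (Dx_inv_Q j) (repr_val _) p Hp)|].
    cbn [dern]; rewrite Dx_inv_Q_der, val_mul by exact Hp.
    unfold R_S; cbn [iod_right].
    rewrite (repr_Lambda lam k2 Hlam p Hp); reflexivity.
  - intros p Hp H; apply Dx_inv_Q_flat, stationaryP; auto.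
Qed.

Lemma characteristic_maps_to j Phi F F' : repr Phi (Q j) ->
  characteristic Phi F -> maps_to R_op F F' -> diff_fun F' -> characteristic Phi F'.
Proof.
  intros HP HF [P [[HP1 [HP2 HP3]] HM]] HD'.
  destruct (diff_fun_repr F (proj1 HF)) as [a Ha], (diff_fun_repr P HP1) as [n Hn],
    (diff_fun_repr F' HD') as [a' Ha'].
  apply (characteristicP Phi (Q j) F a HP Ha) in HF.
  apply (characteristicP Phi (Q j) F' a' HP Ha').
  apply (characteristic_map lam c k2 Hlam Hk j a n a' HF).
  - apply dfun_eq; intros p Hp; rewrite val_mul by exact Hp.
    rewrite <- (repr_Lambda lam k2 Hlam p Hp), <- (Ha p Hp).
    transitivity (Dx P p); [symmetry; exact (repr_dern 1 P n Hn p Hp) | exact (HP2 p Hp)].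
  - intros p Hp; rewrite <- (Hn p (proj1 Hp)).
    apply HP3; [apply Hp | apply stationaryP, Hp].
  - apply dfun_eq; intros p Hp; rewrite <- (Ha' p Hp), (HM p Hp).
    apply repr_R_apply; assumption.
Qed.

Lemma recursion_operator_Q j Phi : repr Phi (Q j) -> recursion_operator (2 * j + 3) Phi R_op.
Proof.
  intro HP; split; [apply Q_evolution, HP | split].
  - apply (commutator_vanishes lam k1 k2 Hlam Hk _ j); [exact HP | apply Q_lead].
  - intros F F'; apply (characteristic_maps_to j), HP.
Qed.

(** Without explicit t, the symmetry condition is the vanishing of the commutator of two
    evolutionary fields, which is antisymmetric. *)
Lemma characteristic_anti i j : ddt (Q i) (Q j) - frechet idA (Q i) (Q j) = 0 ->
  ddt (Q j) (Q i) - frechet idA (Q j) (Q i) = 0.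
Proof.
  unfold ddt; rewrite !autonomous_QA by auto; intro H.
  transitivity (- (0 + frechet idA (Q j) (Q i) - frechet idA (Q i) (Q j))); [ring|].
  rewrite H; ring.
Qed.

Lemma characteristic_next i j : characteristic (Q i) (Q 0) -> characteristic (Q i) (Q j).
Proof.
  intro H0; induction j as [|j IH]; [exact H0|].
  apply (characteristic_maps_to i _ (Q j)); [apply repr_val | exact IH | apply maps_to_Q |].
  apply (val_diff (Q (S j))).
Qed.

(** Q_0 is a symmetry of its own equation, and R carries it to every Q_i. By antisymmetry Q_0 is
    then a symmetry of the flow of Q_i, and R, which is a recursion operator of that flow too,
    carries it to Q_j. *)
Lemma characteristic_Q i j : characteristic (Q i) (Q j).
Proof.
  apply characteristic_next, (characteristicP _ (Q i) _ (Q 0)); try apply repr_val.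
  apply characteristic_anti, (characteristicP (Q 0) _ (Q i)); try apply repr_val.
  apply characteristic_next, (characteristicP (Q 0) (Q 0) _ (Q 0)); try apply repr_val.
  unfold ddt; rewrite autonomous_QA by auto; ring.
Qed.

Lemma repr_Phi_Q : repr (Phi_S lam) (Q 0).
Proof. rewrite <- PhiA_Q0; apply repr_Phi. Qed.

Lemma symmetry_Q j Phi i : repr Phi (Q j) -> LB_symmetry (2 * i + 3) Phi (Q i).
Proof.
  intro HP; split; [|apply Q_has_order, repr_val].
  apply (characteristicP Phi (Q j) _ (Q i)); [exact HP | apply repr_val |].
  apply (characteristicP (Q j) (Q j) (Q i) (Q i)); try apply repr_val; apply characteristic_Q.
Qed.

Lemma schwarzian_fun_psi j i : schwarzian_fun (psi j i).
Proof.
  apply psiA_closed; auto using sf_const, sf_sub, sf_mul; intros m _.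
  apply chi_closed; auto using sf_r, sf_s, sf_add, sf_sub, sf_mul, schwarzian_fun_der;
    [apply (sf_const (IZR 0)) | apply (sf_const (IZR 1)) | apply (sf_const (/ 2))].
Qed.

Definition line_jet (y : R) : jet := fun w => match w with U 1 => 1%R | U 3 => y | _ => 0%R end.

Lemma line_jet_schw y : Schw (line_jet y) = y.
Proof. unfold Schw, u, line_jet; field. Qed.

Lemma line_jet_dom y : (0 < y)%R -> dom (line_jet y).
Proof. intro H; split; [unfold u, line_jet; lra | rewrite line_jet_schw; exact H]. Qed.

Lemma Phi_S_not_affine (a b : jfun) : depends_upto 2 a -> depends_upto 2 b ->
  ~ eq_dom (Phi_S lam) (fun p => a p * u 3 p + b p)%R.
Proof.
  intros Ha Hb H.
  assert (E : forall y, (0 < y)%R ->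
    (lam * / sqrt y = a (line_jet 1) * y + b (line_jet 1))%R).
  { intros y Hy; assert (Hd := line_jet_dom y Hy); assert (H1 := line_jet_dom 1 Rlt_0_1).
    assert (L : forall i, (i <= 2)%nat -> line_jet 1 (U i) = line_jet y (U i)).
    { intros [|[|[|[|i]]]] Hi; try reflexivity; lia. }
    rewrite (Ha (line_jet 1) (line_jet y)), (Hb (line_jet 1) (line_jet y)) by auto.
    specialize (H _ Hd); cbv beta in H; unfold Phi_S in H; rewrite line_jet_schw in H.
    change (u 1 (line_jet y)) with 1%R in H; change (u 3 (line_jet y)) with y in H.
    rewrite <- H; unfold Rdiv; ring. }
  (* With u_x = 1 and u_xx = 0 the Schwarzian equals u_3 = y, so y -> lam / sqrt y would be affine.
     The values lam, lam/2, lam/4 at y = 1, 4, 16 exclude this. *)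
  assert (S4 : sqrt 4 = 2%R) by (replace 4%R with (2 * 2)%R by ring; apply sqrt_square; lra).
  assert (S16 : sqrt 16 = 4%R) by (replace 16%R with (4 * 4)%R by ring; apply sqrt_square; lra).
  assert (E1 := E 1%R ltac:(lra)); assert (E4 := E 4%R ltac:(lra)); assert (E16 := E 16%R ltac:(lra)).
  rewrite sqrt_1 in E1; rewrite S4 in E4; rewrite S16 in E16.
  apply Hlam; lra.
Qed.

Lemma Phi_S_fully_nonlinear : fully_nonlinear 3 (Phi_S lam).
Proof.
  split; [lia | split; [apply (Q_evolution 0), repr_Phi_Q|]].
  intros (a & b & Ha & Hb & H); exact (Phi_S_not_affine a b Ha Hb H).
Qed.

End Main.


Local Close Scope dring_scope.

Theorem proposition1 (lambda k1 k2 : R) (Hlambda : lambda <> 0) (Hk2 : k2 <> 0) :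
  fully_nonlinear 3 (Phi_S lambda) /\
  recursion_operator 3 (Phi_S lambda) (R_S lambda k1 k2) /\
  exists Q : nat -> jfun,
    hierarchy (R_S lambda k1 k2) (Phi_S lambda) Q /\
    (forall j, exists n, LB_symmetry n (Phi_S lambda) (Q j)) /\
    (forall j, exists q, symmetry_integrable q (Q j) (R_S lambda k1 k2)) /\
    (forall j, exists (n : nat) (Psi : list R -> R),
       forall p, dom p ->
         Q j p = u 1 p * Psi (map (fun k => Sx k p) (seq 0 (n + 1)))).
Proof.
  assert (H0 := repr_Phi_Q lambda k1 k2).
  split; [exact (Phi_S_fully_nonlinear lambda k1 k2 Hlambda Hk2)|].
  split; [exact (recursion_operator_Q lambda k1 k2 Hlambda Hk2 0 _ H0)|].
  set (Q := QA lambda (cst_c k1 k2) k2).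
  assert (HM : forall i, maps_to (R_S lambda k1 k2) (Q i) (Q (i + 1)%nat)).
  { intro i; rewrite Nat.add_1_r; apply maps_to_Q; assumption. }
  exists (fun j => val (Q j)); split; [|split; [|split]].
  - split; [|exact HM]. intros p Hp; symmetry; apply H0, Hp.
  - intro j; exists (2 * j + 3)%nat; apply (symmetry_Q lambda k1 k2 Hlambda Hk2 0), H0.
  - intro j; exists (2 * j + 3)%nat; split.
    + apply recursion_operator_Q; try assumption; apply repr_val.
    + exists (fun i => val (Q i)); split; [|split; [exact HM|]].
      * intro i; apply characteristic_Q; assumption.
      * intro N; exists N, (2 * N + 3)%nat; split; [lia|].
        apply (symmetry_Q lambda k1 k2 Hlambda Hk2 j), repr_val.
  - intro j.
    destruct (schwarzian_fun_list _ (schwarzian_fun_psi lambda k1 k2 j 0)) as (n & Psi & HPsi).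
    exists n, Psi; intros p Hp; rewrite <- HPsi by exact Hp.
    change (val (u1A * psiA lambda (cst_c k1 k2) k2 j 0)%dr p
      = u 1 p * val (psiA lambda (cst_c k1 k2) k2 j 0) p).
    rewrite val_mul, u1A_val by exact Hp; reflexivity.
Qed.
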